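(* Let $p\in(1,\infty)$. Let $P_0,P_1\in\mathbb{R}^2$ and $L>0$ be such that $r:=\frac{|P_0-P_1|}{L}\in[0,1)$. Suppose that $\gamma\in\mathcal{A}_{P_0,P_1,L}$ is a critical point of $\mathcal{B}_p$ in $\mathcal{A}_{P_0,P_1,L}$. Then the following hold. (i) If $r=0$, then $\gamma$ is an $\frac n2$-fold figure-eight $p$-elastica for some $n\in\mathbb{N}$. (ii) If $r\in(0,\frac1{p-1})$, then $\gamma$ is either a $(p,r,n)$-arc for some $n\in\mathbb{N}$, or a $(p,r,n)$-loop for some $n\in\mathbb{N}$. (iii) If $r\in[\frac1{p-1},1)$, then $\gamma$ is either a $(p,r,n)$-arc for some $n\in\mathbb{N}$, or a $(p,r,n,\boldsymbol{\sigma},\boldsymbol{L})$-flat-core for some $n\in\mathbb{N}$, $\boldsymbol{\sigma}=(\sigma_1,\dots,\sigma_n)\in\{+,-\}^n$, and $\boldsymbol{L}=(L_1,\dots,L_{n+1})\in[0,\infty)^{n+1}$ subject to $\sum_{j=1}^{n+1}L_j=2n\frac{r-\frac1{p-1}}{1-r}\mathrm{K}_p(1)$.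
   Context: $\mathbb{N}=\{1,2,\dots\}$. Energies and admissible set. $W^{2,p}_{\rm imm}(0,1;\mathbb{R}^2)$ is the set of $\gamma\in W^{2,p}(0,1;\mathbb{R}^2)$ with $\gamma'(t)\ne0$ for all $t\in[0,1]$. $\mathcal{B}_p[\gamma]=\int_\gamma|k|^p\,ds$ ($k$ signed curvature, $s$ arclength), $\mathcal{L}[\gamma]=\int_\gamma ds$. $\mathcal{A}_{P_0,P_1,L}$ is the set of $\gamma\in W^{2,p}_{\rm imm}(0,1;\mathbb{R}^2)$ with $\gamma(0)=P_0$, $\gamma(1)=P_1$, $\mathcal{L}[\gamma]=L$. A curve $\gamma\in\mathcal{A}_{P_0,P_1,L}$ is a critical point of $\mathcal{B}_p$ in $\mathcal{A}_{P_0,P_1,L}$ if $\frac{d}{d\varepsilon}\mathcal{B}_p[\gamma_\varepsilon]|_{\varepsilon=0}=0$ for every one-parameter family $\varepsilon\mapsto\gamma_\varepsilon\in\mathcal{A}_{P_0,P_1,L}$ ($\varepsilon$ near $0$) with $\gamma_0=\gamma$ whose derivative $\frac{d}{d\varepsilon}\gamma_\varepsilon|_{\varepsilon=0}$ exists (in $W^{2,p}(0,1;\mathbb{R}^2)$). $p$-elliptic integrals and functions. For $q\in[0,1)$, $x\in\mathbb{R}$: $\mathrm{F}_{1,p}(x,q)=\int_0^x\frac{|\cos\theta|^{1-2/p}}{\sqrt{1-q^2\sin^2\theta}}d\theta$, $\mathrm{E}_{1,p}(x,q)=\int_0^x\sqrt{1-q^2\sin^2\theta}\,|\cos\theta|^{1-2/p}d\theta$,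 $\mathrm{K}_{1,p}(q)=\mathrm{F}_{1,p}(\pi/2,q)$, $\mathrm{E}_{1,p}(q)=\mathrm{E}_{1,p}(\pi/2,q)$. $\mathrm{am}_{1,p}(\cdot,q):\mathbb{R}\to\mathbb{R}$ is the inverse function of $\mathrm{F}_{1,p}(\cdot,q)$, and $\mathrm{cn}_p(s,q)=|\cos\mathrm{am}_{1,p}(s,q)|^{\frac2p-1}\cos\mathrm{am}_{1,p}(s,q)$ (interpreted as $0$ where the cosine vanishes; likewise $|x|^{p-2}x:=0$ at $x=0$). For $p>2$: $\mathrm{K}_p(1)=\int_0^{\pi/2}(\cos\theta)^{-2/p}d\theta<\infty$; $\mathrm{am}_{1,p}(\cdot,1):[-\mathrm{K}_p(1),\mathrm{K}_p(1)]\to[-\frac\pi2,\frac\pi2]$ is the inverse of $x\mapsto\int_0^x(\cos\theta)^{-2/p}d\theta$; $\mathrm{sech}_p\,s=(\cos\mathrm{am}_{1,p}(s,1))^{2/p}$ and $\tanh_p s=\int_0^s(\mathrm{sech}_p\,t)^p\,dt$ for $s\in[-\mathrm{K}_p(1),\mathrm{K}_p(1)]$. Curves. ''Up to similarity and reparameterization'' means up to translation, rotation, reflection, dilation and change of parameter. For $q\in(0,1)$ let $$\gamma_w(s,q)=\Big(2\mathrm{E}_{1,p}(\mathrm{am}_{1,p}(s,q),q)-s,\ -q\tfrac{p}{p-1}|\mathrm{cn}_p(s,q)|^{p-2}\mathrm{cn}_p(s,q)\Big).$$ The function $Q_p(q)=2\frac{\mathrm{E}_{1,p}(q)}{\mathrm{K}_{1,p}(q)}-1$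 is strictly decreasing on $[0,1)$ with $Q_p(0)=1$, and $\lim_{q\uparrow1}Q_p(q)$ equals $-1$ if $p\le2$ and $-\frac1{p-1}$ if $p>2$. For $r\in[0,1)$, $n\in\mathbb{N}$: - A $(p,r,n)$-arc is a curve that, up to similarity and reparameterization, is $s\mapsto\gamma_w(s-\mathrm{K}_{1,p}(q),q)$, $s\in[0,2n\mathrm{K}_{1,p}(q)]$, where $q\in(0,1)$ is the unique solution of $Q_p(q)=r$. - A $(p,r,n)$-loop (defined if $r<\frac1{p-1}$) is the same with $q\in(0,1)$ the unique solution of $Q_p(q)=-r$. - An $\frac n2$-fold figure-eight $p$-elastica is a $(p,0,n)$-arc (equivalently a $(p,0,n)$-loop). - A $(p,r,n,\boldsymbol\sigma,\boldsymbol L)$-flat-core (defined if $p>2$, $r\ge\frac1{p-1}$) with $\boldsymbol\sigma\in\{+,-\}^n$, $\boldsymbol L\in[0,\infty)^{n+1}$ satisfying $\sum_{j=1}^{n+1}L_j=2n\frac{r-\frac1{p-1}}{1-r}\mathrm{K}_p(1)$ is a curve that, up to similarity and reparameterization, is $\big(\bigoplus_{j=1}^n(\gamma_\ell^{L_j}\oplus\gamma_b^{\sigma_j})\big)\oplus\gamma_\ell^{L_{n+1}}$, where $\gamma_\ell^{L_j}(s)=(-s,0)$ for $s\in[0,L_j]$ and $\gamma_b^\pm(s)=\big(2\tanh_p s-s,\ \mp\frac p{p-1}(\mathrm{sech}_p\,s)^{p-1}\big)$ for $s\in[-\mathrm{K}_p(1),\mathrm{K}_p(1)]$. Here, for $\gamma_j:[a_j,b_j]\to\mathbb{R}^2$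 with $\ell_j=b_j-a_j\ge0$, the concatenation $\gamma_1\oplus\gamma_2:[0,\ell_1+\ell_2]\to\mathbb{R}^2$ is $\gamma_1(s+a_1)$ for $s\in[0,\ell_1]$ and $\gamma_2(s+a_2-\ell_1)+\gamma_1(b_1)-\gamma_2(a_2)$ for $s\in[\ell_1,\ell_1+\ell_2]$; multiple concatenations are defined inductively. *)

(* Defs.v *)
From HB Require Import structures.
From mathcomp Require Import all_boot all_order all_algebra.
From mathcomp Require Import all_classical all_reals all_analysis.

Set Implicit Arguments.
Unset Strict Implicit.
Unset Printing Implicit Defensive.

Import Order.TTheory GRing.Theory Num.Theory.
Import numFieldNormedType.Exports.

Local Open Scope classical_set_scope.
Local Open Scope ring_scope.

Section Sobolev.
Context {R : realType}.
Implicit Types (p : R) (u v f phi : R -> R).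

Definition extend0 f : R -> R := f \_ `]0, 1[.

Definition Lp01 p f : Prop := extend0 f \in Lfun lebesgue_measure p%:E.

Definition Lpnorm01 p f : \bar R :=
  ('N[lebesgue_measure]_p%:E[EFin \o extend0 f])%E.

(* The class C^1_c(0,1); in dimension one it defines the same weak derivatives
   as C^oo_c(0,1) (Brezis, Functional Analysis, Section 8.2). *)
Definition test_function phi : Prop :=
  [/\ forall x, derivable phi x 1,
      continuous (derive1 phi)
    & exists a b, [/\ 0 < a, b < 1 & forall x, ~ (a <= x <= b) -> phi x = 0]].

Definition weak_derivative u v : Prop :=
  forall phi, test_function phi ->
    \int[lebesgue_measure]_(x in `]0, 1[) (u x * derive1 phi x) =
    - \int[lebesgue_measure]_(x in `]0, 1[) (v x * phi x).

(* An element u of W^{2,p}(0,1), given by the continuous representatives on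
   [0,1] of u and u' (which exist by the embedding W^{2,p} -> C^1, and are
   automatically in L^p) and by some representative of u''. Values outside
   [0,1] are irrelevant. *)
Record W2p p := MkW2p {
  wfun : R -> R;
  wder1 : R -> R;
  wder2 : R -> R;
  wfun_continuous : {within `[0, 1], continuous wfun};
  wder1_continuous : {within `[0, 1], continuous wder1};
  wder2_Lp : Lp01 p wder2;
  wder1_weak : weak_derivative wfun wder1;
  wder2_weak : weak_derivative wder1 wder2
}.

Definition wder p (u : W2p p) (i : 'I_3) : R -> R :=
  nth (wder2 u) [:: wfun u; wder1 u; wder2 u] i.

Definition curve p : Type := (W2p p * W2p p)%type.

End Sobolev.

Section Energies.
Context {R : realType}.
Variable p : R.
Implicit Types (gamma eta : curve p) (P v : R * R) (L : R).

Definition enorm v : R := Num.sqrt (v.1 ^+ 2 + v.2 ^+ 2).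

Definition cpos gamma (t : R) : R * R := (wfun gamma.1 t, wfun gamma.2 t).
Definition vel gamma (t : R) : R * R := (wder1 gamma.1 t, wder1 gamma.2 t).
Definition acc gamma (t : R) : R * R := (wder2 gamma.1 t, wder2 gamma.2 t).

Definition immersed gamma : Prop := forall t, 0 <= t <= 1 -> vel gamma t != 0.

Definition curvature gamma (t : R) : R :=
  ((vel gamma t).1 * (acc gamma t).2 - (vel gamma t).2 * (acc gamma t).1)
  / enorm (vel gamma t) ^+ 3.

Definition bending gamma : R :=
  \int[lebesgue_measure]_(t in `]0, 1[)
    (`|curvature gamma t| `^ p * enorm (vel gamma t)).

Definition curve_length gamma : R :=
  \int[lebesgue_measure]_(t in `]0, 1[) enorm (vel gamma t).

Definition admissible P0 P1 L gamma : Prop :=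
  [/\ immersed gamma, cpos gamma 0 = P0, cpos gamma 1 = P1
    & curve_length gamma = L].

(* The W^{2,p}-norm of (u - v) / e - h, as the sum of the L^p-norms of its
   derivatives of order 0, 1, 2. *)
Definition quotient_error (e : R) (u v h : W2p p) : \bar R :=
  (\sum_(i < 3)
    Lpnorm01 p (fun t => (wder u i t - wder v i t) / e - wder h i t)%R)%E.

Definition family_derivative (G : R -> curve p) eta : Prop :=
  adde (quotient_error e (G e).1 (G 0).1 eta.1)
       (quotient_error e (G e).2 (G 0).2 eta.2) @[e --> 0^'] --> 0%E.

Definition critical_point P0 P1 L gamma : Prop :=
  forall (G : R -> curve p) eta,
    G 0 = gamma ->
    (\forall e \near (0 : R), admissible P0 P1 L (G e)) ->
    family_derivative G eta ->
    is_derive (0 : R) (1 : R) (fun e => bending (G e)) 0.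

End Energies.

Section EllipticFunctions.
Context {R : realType}.
Implicit Types p q s x : R.

Definition integral_from0 (f : R -> R) x : R :=
  if 0 <= x then \int[lebesgue_measure]_(t in `[0, x]) f t
  else - \int[lebesgue_measure]_(t in `[x, 0]) f t.

Definition ellF p q x : R :=
  integral_from0 (fun th => `|cos th| `^ (1 - 2 / p)
                       / Num.sqrt (1 - q ^+ 2 * sin th ^+ 2)) x.

Definition ellE p q x : R :=
  integral_from0 (fun th => Num.sqrt (1 - q ^+ 2 * sin th ^+ 2)
                       * `|cos th| `^ (1 - 2 / p)) x.

Definition ellK p q : R := ellF p q (pi / 2).
Definition ellEc p q : R := ellE p q (pi / 2).

(* xget picks the unique solution: for 0 <= q < 1 < p, ellF p q is an increasing
   bijection of R. *)
Definition am p q s : R := xget 0 [set x | ellF p q x = s].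

(* Since 0 `^ a is a real number for every a, expressions |x|^a x are 0 at
   x = 0. *)
Definition cn p q s : R :=
  `|cos (am p q s)| `^ (2 / p - 1) * cos (am p q s).

Definition Qfun p q : R := 2 * (ellEc p q / ellK p q) - 1.

Definition ellF1 p x : R := integral_from0 (fun th => cos th `^ (- (2 / p))) x.

Definition ellK1 p : R := ellF1 p (pi / 2).

Definition am1 p s : R :=
  xget 0 [set x | - (pi / 2) <= x <= pi / 2 /\ ellF1 p x = s].

Definition sechp p s : R := cos (am1 p s) `^ (2 / p).

Definition tanhp p s : R := integral_from0 (fun t => sechp p t `^ p) s.

End EllipticFunctions.

Section ModelCurves.
Context {R : realType}.
Implicit Types p q r s : R.

(* The restriction of ptrace to [pstart, pstop]. *)
Record pcurve := Pcurve { pstart : R; pstop : R; ptrace : R -> R * R }.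
Implicit Types c : pcurve.

Definition concat c1 c2 : pcurve :=
  let l1 := pstop c1 - pstart c1 in
  let l2 := pstop c2 - pstart c2 in
  Pcurve 0 (l1 + l2) (fun s =>
    if s <= l1 then ptrace c1 (s + pstart c1)
    else ptrace c2 (s + pstart c2 - l1)
         + ptrace c1 (pstop c1) - ptrace c2 (pstart c2)).

(* Left-nested concatenation of a nonempty sequence of curves. *)
Definition concats (cs : seq pcurve) : pcurve :=
  if cs is c :: cs' then foldl concat c cs' else Pcurve 0 0 (fun=> 0).

(* Dilation by lam, rotation by th (preceded by the reflection in the x-axis
   if refl holds), and translation by v. *)
Definition similarity (lam th : R) (refl : bool) (v z : R * R) : R * R :=
  let y := if refl then - z.2 else z.2 in
  (v.1 + lam * (cos th * z.1 - sin th * y),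
   v.2 + lam * (sin th * z.1 + cos th * y)).

(* Increasing C^1-diffeomorphisms from [0, 1] onto [a, b]. Orientation reversal
   gives nothing new below: each family of model curves is, up to similarity,
   closed under reversal. *)
Definition change_of_parameter (a b : R) (phi : R -> R) : Prop :=
  exists dphi : R -> R,
    [/\ phi 0 = a /\ phi 1 = b,
        {within `[0, 1], continuous phi},
        {within `[0, 1], continuous dphi},
        forall t : R, 0 < t < 1 -> is_derive t (1 : R) phi (dphi t)
      & forall t, 0 <= t <= 1 -> 0 < dphi t].

Definition same_up_to_similarity p (gamma : curve p) c : Prop :=
  exists (lam th : R) (refl : bool) (v : R * R) (phi : R -> R),
    [/\ 0 < lam, change_of_parameter (pstart c) (pstop c) phi
      & forall t, 0 <= t <= 1 ->
          cpos gamma t = similarity lam th refl v (ptrace c (phi t))].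

Definition gamma_w p q s : R * R :=
  (2 * ellE p q (am p q s) - s,
   - (q * (p / (p - 1)) * (`|cn p q s| `^ (p - 2) * cn p q s))).

Definition wave p q (n : nat) : pcurve :=
  Pcurve 0 (2 * n%:R * ellK p q) (fun s => gamma_w p q (s - ellK p q)).

Definition is_arc p r (n : nat) (gamma : curve p) : Prop :=
  exists q, unique (fun q => 0 < q < 1 /\ Qfun p q = r) q /\
    same_up_to_similarity gamma (wave p q n).

Definition is_loop p r (n : nat) (gamma : curve p) : Prop :=
  r < 1 / (p - 1) /\
  exists q, unique (fun q => 0 < q < 1 /\ Qfun p q = - r) q /\
    same_up_to_similarity gamma (wave p q n).

Definition is_figure_eight p (n : nat) (gamma : curve p) : Prop :=
  is_arc 0 n gamma.

Definition line_curve (l : R) : pcurve := Pcurve 0 l (fun s => (- s, 0)).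

(* sg = true encodes the sign +. *)
Definition border_curve p (sg : bool) : pcurve :=
  Pcurve (- ellK1 p) (ellK1 p) (fun s =>
    (2 * tanhp p s - s,
     (if sg then -1 else 1) * (p / (p - 1) * sechp p s `^ (p - 1)))).

Definition flat_core p (n : nat) (sigma : 'I_n -> bool) (l : 'I_n.+1 -> R) :
    pcurve :=
  concat
    (concats [seq concat (line_curve (l (widen_ord (leqnSn n) j)))
                         (border_curve p (sigma j)) | j <- enum 'I_n])
    (line_curve (l ord_max)).

Definition is_flat_core p r (n : nat) (sigma : 'I_n -> bool)
    (l : 'I_n.+1 -> R) (gamma : curve p) : Prop :=
  [/\ 2 < p /\ 1 / (p - 1) <= r,
      forall j, 0 <= l j,
      \sum_(j < n.+1) l j =
        2 * n%:R * ((r - 1 / (p - 1)) / (1 - r)) * ellK1 p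
    & same_up_to_similarity gamma (flat_core p sigma l)].

End ModelCurves.

(* Main.v *)
(** A critical point is tested with variations that rotate the velocity by an
    angle e phi + a phi1 + b phi2: speed and length are unchanged, the curvature
    k becomes exactly k + (angle)' / speed, and the endpoint condition determines
    a, b = O(e^2). Convexity of |.|^p then gives, with W = |k|^(p-2) k, that the
    integral of W phi' vanishes for all phi satisfying the two linearized endpoint
    conditions; hence W is almost everywhere an affine function of the position,
    and the same affine function vanishes at both endpoints.

    So the curvature has a continuous representative, the tangent angle is C^1,
    and after rotation, scaling and arclength parametrization the curve solves
    th' = -2 q |y/(p'q)|^(1/(p-1)) sgn y, x' = cos th, y' = sin th with y = 0 at
    both ends (p' = p/(p-1)), whose conserved energy is
    |y/(p'q)|^p' + sin^2(th/2)/q^2 = 1. Between consecutive zeros of y the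
    substitution sin(th/2) = q sin(al) integrates the system by p-elliptic
    integrals. For q < 1 the solution is determined by its pieces, alternately
    reflected, and is a wave; its chord-to-length ratio is |Q_p(q)|, so q is found
    from the monotonicity of Q_p. For q = 1 the solution is straight if p <= 2,
    because y then satisfies a Gronwall inequality, while for p > 2 uniqueness fails
    at y = 0 and loops and segments alternate freely: a flat-core. *)

(* For p > 2 the right-hand side of the angle equation is a power with exponent 1/(p-1) < 1, not
   Lipschitz at y = 0, so uniqueness of solutions cannot be invoked. Solutions are integrated
   explicitly between zeros of y, where, up to symmetry, [asin (sin (th / 2) / q)] is a strictly
   increasing coordinate.

   As the variations keep the speed, length carries no multiplier; its effect is hidden in the
   initial angle, that is in q. The endpoint condition is solved with two functions dual to the
   velocity components. They exist unless the velocity stays on a fixed line, which |P0 - P1| < L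
   excludes. Test angles are free at both ends of the interval, so no integration constant survives:
   this is why the affine function vanishes at the endpoints. Since the curvature is at first only
   an L^p function, the tangent angle has to be recovered from an identity valid almost everywhere.

   The threshold 1/(p-1) comes from one integration by parts at q = 1, E(1) = (p-2)/(2(p-1)) K_p(1):
   a loop of length 2 K_p(1) advances by 2 K_p(1)/(p-1), and the same identity bounds Q_p from
   below. *)
Require Import Defs.
From HB Require Import structures.
From mathcomp Require Import all_boot all_order all_algebra.
From mathcomp Require Import all_classical all_reals all_analysis.
From mathcomp Require Import measurable_realfun.
From mathcomp Require Import ring lra.
Import Order.TTheory GRing.Theory Num.Theory.
Import numFieldNormedType.Exports.
Set Implicit Arguments.
Unset Strict Implicit.
Unset Printing Implicit Defensive.
Local Open Scope classical_set_scope.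
Local Open Scope ring_scope.

(** * Calculus on the line *)

Section PointwiseDerivatives.
Context {R : realType}.
Implicit Types (f g : R -> R) (x a b c k : R).

Lemma derD f g x a b : is_derive x (1:R) f a -> is_derive x (1:R) g b ->
  is_derive x (1:R) (fun t => f t + g t) (a + b).
Proof. by move=> fa gb; exact: is_deriveD fa gb. Qed.

Lemma derN f x a : is_derive x (1:R) f a -> is_derive x (1:R) (fun t => - f t) (- a).
Proof. by move=> fa; exact: is_deriveN fa. Qed.

Lemma derM f g x a b : is_derive x (1:R) f a -> is_derive x (1:R) g b ->
  is_derive x (1:R) (fun t => f t * g t) (a * g x + f x * b).
Proof.
move=> fa gb; have h := is_deriveM fa gb.
have -> : a * g x + f x * b = f x *: b + g x *: a by rewrite /GRing.scale /=; ring.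
exact: h.
Qed.

Lemma derC k x : is_derive x (1:R) (fun=> k : R) (0:R).
Proof. exact: is_derive_cst. Qed.

Lemma derI x : is_derive x (1:R) (fun t => t : R) (1:R).
Proof. exact: is_derive_id. Qed.

Lemma der_comp f g x a b : is_derive (g x) (1:R) f a -> is_derive x (1:R) g b ->
  is_derive x (1:R) (fun t => f (g t)) (a * b).
Proof. by move=> fa gb; apply: (is_derive1_comp fa gb). Qed.

Lemma der_sin g x b : is_derive x (1:R) g b ->
  is_derive x (1:R) (fun t => sin (g t)) (cos (g x) * b).
Proof. by move=> gb; apply: der_comp. Qed.

Lemma der_cos g x b : is_derive x (1:R) g b ->
  is_derive x (1:R) (fun t => cos (g t)) (- sin (g x) * b).
Proof. by move=> gb; apply: der_comp. Qed.

Lemma derX n f x a : is_derive x (1:R) f a ->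
  is_derive x (1:R) (fun t => f t ^+ n) (n%:R * f x ^+ n.-1 * a).
Proof.
move=> fa; have h := is_deriveX n fa.
by rewrite exprfctE in h.
Qed.

Lemma der_pow f x a k : 0 < f x -> is_derive x (1:R) f a ->
  is_derive x (1:R) (fun t => f t `^ k) (k * f x `^ (k - 1) * a).
Proof.
by move=> f0 fa; exact: (der_comp (is_derive1_powR k f0) fa).
Qed.

Lemma der_continuous f x a : is_derive x (1:R) f a -> {for x, continuous f}.
Proof.
move=> fa; apply: differentiable_continuous; apply/derivable1_diffP.
exact: ex_derive.
Qed.

Lemma der_near f g x a : (\forall t \near x, f t = g t) ->
  is_derive x (1:R) f a -> is_derive x (1:R) g a.
Proof. by move=> fg; apply: near_eq_is_derive => //; rewrite oner_eq0. Qed.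

Lemma der_eq_oo f g x a lo hi : lo < x < hi ->
  (forall t, lo < t < hi -> f t = g t) ->
  is_derive x (1:R) f a -> is_derive x (1:R) g a.
Proof.
move=> lxh fg; apply: der_near.
have : x \in `]lo, hi[ by rewrite in_itv.
by move/near_in_itvoo; apply: filterS => t; rewrite in_itv /=; exact: fg.
Qed.

Lemma der0_constant f a b : a <= b -> {within `[a, b], continuous f} ->
  (forall x, a < x < b -> is_derive x (1:R) f 0) ->
  forall x, a <= x <= b -> f x = f a.
Proof.
move=> ab cf df x /andP[ax xb].
have [||c _] := @MVT_segment _ f (fun=> 0) a x ax.
- by move=> y; rewrite in_itv/= => /andP[ay yx]; apply: df; rewrite ay/= (lt_le_trans yx).
- apply: continuous_subspaceW cf; apply: subset_itvl; by rewrite bnd_simp.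
- by rewrite mul0r => /eqP; rewrite subr_eq0 => /eqP.
Qed.

Lemma der_pos_lt f df a b : a < b -> {within `[a, b], continuous f} ->
  (forall x, a < x < b -> is_derive x (1:R) f (df x)) ->
  (forall x, a < x < b -> 0 < df x) -> f a < f b.
Proof.
move=> ab cf dfd df0.
have dfd' : forall x, x \in `]a, b[%R -> is_derive x 1 f (df x).
  by move=> y; rewrite in_itv/=; exact: dfd.
have [c + e] := MVT ab dfd' cf.
rewrite in_itv/= => /df0 c0; rewrite -subr_gt0 e mulr_gt0// subr_gt0//.
Qed.

Lemma der_nonneg_le f df a b : a <= b -> {within `[a, b], continuous f} ->
  (forall x, a < x < b -> is_derive x (1:R) f (df x)) ->
  (forall x, a < x < b -> 0 <= df x) -> f a <= f b.
Proof.
rewrite le_eqVlt => /orP[/eqP->//|ab] cf dfd df0.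
have dfd' : forall x, x \in `]a, b[%R -> is_derive x 1 f (df x).
  by move=> y; rewrite in_itv/=; exact: dfd.
have [c + e] := MVT ab dfd' cf.
rewrite in_itv/= => /df0 c0; rewrite -subr_ge0 e mulr_ge0// subr_ge0 ltW//.
Qed.

Lemma continuous_powR_nonneg k : 0 < k -> continuous (fun x : R => `|x| `^ k).
Proof.
move=> k0 x; have [->|x0] := eqVneq x 0; last first.
  apply: (@continuous_comp _ _ _ (fun t : R => `|t|) (fun t => t `^ k)).
    exact: norm_continuous.
  have h : 0 < `|x| by rewrite normr_gt0.
  apply: (der_continuous (a := k * `|x| `^ (k - 1))); exact: is_derive1_powR.
apply/cvgrPdist_lt => e e0 /=; rewrite normr0 powR0 ?gt_eqF//.
near=> t; rewrite sub0r normrN (ger0_norm (powR_ge0 _ _)).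
have -> : e = (e `^ k^-1) `^ k by rewrite -powRrM mulVf ?gt_eqF// powRr1// ltW.
apply: gt0_ltr_powR => //; rewrite ?nnegrE// ?powR_ge0//.
near: t; exists (e `^ k^-1); first exact: powR_gt0.
by move=> y /=; rewrite sub0r normrN.
Unshelve. all: by end_near. Qed.

End PointwiseDerivatives.

(** Higher-order patterns under the binder select the rule by the head symbol; the leaves come from
    hypotheses. The derivative is whatever the rules produce, so other shapes are reached through
    [is_derive_eq]. *)
Ltac der := repeat first
  [ eassumption
  | match goal with
    | |- is_derive _ _ (fun _ => ?c) _ => apply: derC
    | |- is_derive _ _ (fun x => x) _ => apply: derI
    | |- is_derive _ _ (fun x => sin (@?f x)) _ => apply: (@der_sin _ f)
    | |- is_derive _ _ (fun x => cos (@?f x)) _ => apply: (@der_cos _ f)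
    | |- is_derive _ _ (fun x => GRing.opp (@?f x)) _ => apply: (@derN _ f)
    | |- is_derive _ _ (fun x => GRing.exp (@?f x) ?n) _ => apply: (@derX _ n f)
    | |- is_derive _ _ (fun x => GRing.mul (@?f x) (@?g x)) _ => apply: (@derM _ f g)
    | |- is_derive _ _ (fun x => GRing.add (@?f x) (@?g x)) _ => apply: (@derD _ f g)
    end ].

(** The odd power |x|^(a-1) x, with value 0 at 0 for every exponent. For a = p - 1 it turns the
    curvature k into W = |k|^(p-2) k, and [spow a^-1] undoes it. *)
Definition spow {R : realType} (a x : R) : R := Num.sg x * `|x| `^ a.

Section PointwiseContinuity.
Context {R : realType}.
Implicit Types (f g : R -> R).

Lemma contM f g : continuous f -> continuous g -> continuous (fun x => f x * g x).
Proof. by move=> cf cg x; apply: (@continuousM _ _ f g); [exact: cf|exact: cg]. Qed.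

Lemma contD f g : continuous f -> continuous g -> continuous (fun x => f x + g x).
Proof. by move=> cf cg x; apply: (@continuousD _ _ _ f g); [exact: cf|exact: cg]. Qed.

Lemma contN f : continuous f -> continuous (fun x => - f x).
Proof. by move=> cf x; apply: (@continuousN _ _ _ f); exact: cf. Qed.

Lemma contC (c : R) : continuous (fun _ : R => c).
Proof. by move=> x; exact: cst_continuous. Qed.

Lemma contI : continuous (fun x : R => x).
Proof. by move=> x; exact: der_continuous (derI x). Qed.

Lemma cont_comp f g : continuous f -> continuous g -> continuous (fun x => f (g x)).
Proof. by move=> cf cg x; apply: (@continuous_comp _ _ _ g f); [exact: cg|exact: cf]. Qed.

Lemma cont_norm f : continuous f -> continuous (fun x => `|f x|).
Proof. by apply: cont_comp => x; exact: norm_continuous. Qed.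

Lemma cont_sin f : continuous f -> continuous (fun x => sin (f x)).
Proof. apply: cont_comp; exact: continuous_sin. Qed.

Lemma cont_cos f : continuous f -> continuous (fun x => cos (f x)).
Proof. apply: cont_comp; exact: continuous_cos. Qed.

Lemma contX n f : continuous f -> continuous (fun x => f x ^+ n).
Proof. apply: (@cont_comp (fun x => x ^+ n)); exact: exprn_continuous. Qed.

Lemma cont_sqrt f : continuous f -> continuous (fun x => Num.sqrt (f x)).
Proof. apply: (@cont_comp Num.sqrt); exact: sqrt_continuous. Qed.

Lemma contV f : continuous f -> (forall x, f x != 0) -> continuous (fun x => (f x)^-1).
Proof. by move=> cf f0 x; apply: (@continuousV _ _ f); [exact: f0|exact: cf]. Qed.

Lemma is_derive_continuous f df : (forall x, is_derive x (1:R) f (df x)) -> continuous f.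
Proof. by move=> h x; exact: der_continuous (h x). Qed.

End PointwiseContinuity.

Ltac cont := repeat first
  [ eassumption
  | match goal with
    | |- continuous (fun _ => ?c) => exact: contC
    | |- continuous (fun x => x) => exact: contI
    | |- continuous (fun x => sin (@?f x)) => apply: (@cont_sin _ f)
    | |- continuous (fun x => cos (@?f x)) => apply: (@cont_cos _ f)
    | |- continuous (fun x => Num.norm (@?f x)) => apply: (@cont_norm _ f)
    | |- continuous (fun x => Num.sqrt (@?f x)) => apply: (@cont_sqrt _ f)
    | |- continuous (fun x => GRing.opp (@?f x)) => apply: (@contN _ f)
    | |- continuous (fun x => GRing.exp (@?f x) ?n) => apply: (@contX _ n f)
    | |- continuous (fun x => GRing.mul (@?f x) (@?g x)) => apply: (@contM _ f g)
    | |- continuous (fun x => GRing.add (@?f x) (@?g x)) => apply: (@contD _ f g)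
    end ].

Section SignedPower.
Context {R : realType}.
Implicit Types (a b k x y : R).

Lemma spow_pos a x : 0 < x -> spow a x = x `^ a.
Proof. by move=> x0; rewrite /spow gtr0_sg// gtr0_norm// mul1r. Qed.

Lemma spow0 a : spow a (0 : R) = 0.
Proof. by rewrite /spow sgr0 mul0r. Qed.

Lemma spowN a x : spow a (- x) = - spow a x.
Proof. by rewrite /spow sgrN normrN mulNr. Qed.

Lemma normr_spow a x : a != 0 -> `|spow a x| = `|x| `^ a.
Proof.
move=> a0; rewrite /spow normrM normr_sg (ger0_norm (powR_ge0 _ _)).
by have [->|x0] := eqVneq x 0; rewrite ?normr0 ?powR0 ?mul0r ?mul1r.
Qed.

Lemma spow_sg a x : Num.sg (spow a x) = Num.sg x.
Proof.
rewrite /spow sgrM sgr_id; have [->|x0] := eqVneq x 0; first by rewrite sgr0 mul0r.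
by rewrite (@gtr0_sg _ (_ `^ _)) ?mulr1// powR_gt0// normr_gt0.
Qed.

Lemma spowM a x y : spow a (x * y) = spow a x * spow a y.
Proof. by rewrite /spow sgrM normrM powRM// mulrACA. Qed.

Lemma spowK a x : a != 0 -> spow a^-1 (spow a x) = x.
Proof.
move=> a0; rewrite /spow -/(spow a x) spow_sg normr_spow// -powRrM mulfV//.
by rewrite powRr1// -numEsg.
Qed.

Lemma continuous_spow a : 0 < a -> continuous (spow a : R -> R).
Proof.
move=> a0 x; have [x0|x0|->] := ltgtP x 0.
- have : {for x, continuous (fun t : R => - (`|t| `^ a))}.
    apply: continuousN; exact: continuous_powR_nonneg.
  rewrite /prop_for /continuous_at.
  rewrite [X in _ -> _ --> X]/spow ltr0_sg// mulN1r; apply: cvg_trans.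
  apply: near_eq_cvg; near=> t; rewrite /spow ltr0_sg ?mulN1r//.
  by near: t; exact: lt_nbhsl.
- have : {for x, continuous (fun t : R => (`|t| `^ a))}.
    exact: continuous_powR_nonneg.
  rewrite /prop_for /continuous_at.
  rewrite [X in _ -> _ --> X]/spow gtr0_sg// mul1r; apply: cvg_trans.
  apply: near_eq_cvg; near=> t; rewrite /spow gtr0_sg ?mul1r//.
  by near: t; exact: lt_nbhsr.
- rewrite /continuous_at spow0; apply/cvgr0Pnorm_lt => e e0 /=.
  have /cvgr0Pnorm_lt/(_ e e0) : (`|t| `^ a) @[t --> (0:R)] --> (0:R).
    have := @continuous_powR_nonneg R a a0 0.
    by rewrite /continuous_at normr0 powR0 ?gt_eqF.
  apply: filterS => t; by rewrite (ger0_norm (powR_ge0 _ _)) normr_spow// gt_eqF.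
Unshelve. all: by end_near. Qed.

Lemma is_derive_powR_norm k x : 1 < k ->
  is_derive x (1:R) (fun t : R => `|t| `^ k) (k * spow (k - 1) x).
Proof.
move=> k1; have [x0|x0|->] := ltgtP x 0.
- apply: (@der_near _ (fun t => (- t) `^ k)).
    near=> t; rewrite ltr0_norm//; near: t; exact: lt_nbhsl.
  have h : is_derive x (1:R) (fun t : R => - t) (- 1) by der.
  have x0' : 0 < - x by rewrite oppr_gt0.
  have hh := @der_pow _ (fun t => - t) x (-1) k x0' h.
  by apply: (is_derive_eq hh); rewrite /spow ltr0_sg// ltr0_norm//; ring.
- apply: (@der_near _ (fun t => t `^ k)).
    near=> t; rewrite gtr0_norm//; near: t; exact: lt_nbhsr.
  have h := @der_pow _ (fun t => t) x 1 k x0 (derI x).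
  by apply: (is_derive_eq h); rewrite /spow gtr0_sg// gtr0_norm//; ring.
- rewrite spow0 mulr0.
  (* At 0 the slope function is |z|^k / z = [spow (k - 1) z], continuous because k > 1. *)
  apply/is_derive1_caratheodory; exists (spow (k - 1)).
  have k10 : 0 < k - 1 by rewrite subr_gt0.
  split; [|exact: continuous_spow|by rewrite spow0].
  move=> z; rewrite normr0 powR0 ?subr0 ?gt_eqF ?(lt_trans ltr01)//.
  have [->|z0] := eqVneq z 0; first by rewrite spow0 mul0r normr0 powR0// gt_eqF// (lt_trans ltr01).
  rewrite /spow -mulrA mulrC -mulrA [z * _]mulrC -normrEsg [LHS]/=.
  by rewrite mulrC mulr_powRB1// (lt_trans ltr01).
Unshelve. all: by end_near. Qed.

End SignedPower.

Definition loc_integrable {R : realType} (f : R -> R) : Prop :=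
  forall a b : R, (@lebesgue_measure R).-integrable `[a, b] (EFin \o f).

Section IntegralFrom0.
Context {R : realType}.
Notation mu := (@lebesgue_measure R).
Implicit Types (f g : R -> R) (a b x y : R).

Lemma continuous_loc_integrable f : continuous f -> loc_integrable f.
Proof.
move=> cf a b; apply: continuous_compact_integrable; first exact: segment_compact.
exact: continuous_subspaceT.
Qed.

Lemma Rintegral_itv_split f a b c : loc_integrable f -> a <= b -> b <= c ->
  \int[mu]_(t in `[a, c]) f t =
  \int[mu]_(t in `[a, b]) f t + \int[mu]_(t in `[b, c]) f t.
Proof.
move=> lf ab bc.
have := @Rintegral_itvB R f (BLeft a) (BRight c) b (lf a c).
rewrite !bnd_simp => /(_ ab bc) h.
rewrite -(@Rintegral_itv_obnd_cbnd _ b (BRight c)); last first.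
  by apply: integrableS (lf b c) => //; apply: subset_itvr; rewrite bnd_simp.
by rewrite -h addrC subrK.
Qed.

Lemma integral_from0B f a b : loc_integrable f -> a <= b ->
  integral_from0 f b - integral_from0 f a = \int[mu]_(t in `[a, b]) f t.
Proof.
move=> lf ab; rewrite /integral_from0.
case: (leP 0 a) => a0.
  rewrite (le_trans a0 ab) (@Rintegral_itv_split f 0 a b)//; ring.
case: (leP 0 b) => b0.
  rewrite (@Rintegral_itv_split f a 0 b)// ?(ltW a0)//; ring.
rewrite (@Rintegral_itv_split f a b 0)// ?(ltW b0)//; ring.
Qed.

Lemma integral_from0_0 f : integral_from0 f 0 = 0.
Proof. by rewrite /integral_from0 lexx set_itv1 Rintegral_set1. Qed.

Lemma integral_from0_shift f a x : loc_integrable f -> a <= x ->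
  integral_from0 f x = \int[mu]_(t in `[a, x]) f t + integral_from0 f a.
Proof. by move=> lf ax; rewrite -integral_from0B// subrK. Qed.

Lemma is_derive_integral_from0 f x : loc_integrable f -> {for x, continuous f} ->
  is_derive x (1:R) (integral_from0 f) (f x).
Proof.
(* A base point to the left of x replaces 0, which avoids the case distinction on the sign of x in
   [integral_from0]; the two primitives differ by a constant. *)
move=> lf cf; pose a := x - 1.
have ax : a < x by rewrite ltrBlDr ltrDl.
have xu : x < x + 1 by rewrite ltrDl.
have [dF F'] := @continuous_FTC1_closed R f a x (x + 1) xu (lf _ _) ax cf.
have h : is_derive x (1:R) (fun y => \int[mu]_(t in `[a, y]) f t) (f x).
  by split; [exact: dF|rewrite -derive1E].
apply: (@der_eq_oo _ (fun y => (\int[mu]_(t in `[a, y]) f t) + integral_from0 f a) _ _ _ a (x + 1)).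
- by rewrite ax.
- by move=> t /andP[/ltW at_ _]; rewrite (@integral_from0_shift f a t).
- by rewrite -[f x]addr0; der.
Qed.

Lemma continuous_integral_from0 f : loc_integrable f -> continuous (integral_from0 f).
Proof.
move=> lf x; pose a := x - 1.
have ax : a < x by rewrite ltrBlDr ltrDl.
have xu : x < x + 1 by rewrite ltrDl.
have h : {for x, continuous (fun y => \int[mu]_(t in `[a, y]) f t)}.
  apply: (@within_continuous_continuous _ _ _ a (x + 1)).
  - exact: lt_trans xu.
  - by apply: parameterized_integral_continuous; [rewrite ltW// (lt_trans ax)|exact: lf].
  - by rewrite in_itv/= ax.
have : {for x, continuous (fun y => (\int[mu]_(t in `[a, y]) f t) + integral_from0 f a)}.
  by apply: continuousD; [exact: h|exact: cst_continuous].
rewrite /prop_for /continuous_at -integral_from0_shift ?ltW//.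
apply: cvg_trans; apply: near_eq_cvg; near=> y.
by rewrite -integral_from0_shift// ltW//; near: y; exact: lt_nbhsr.
Unshelve. all: by end_near. Qed.

Lemma eq_integral_from0 f g x : (forall t, 0 <= t <= x \/ x <= t <= 0 -> f t = g t) ->
  integral_from0 f x = integral_from0 g x.
Proof.
move=> fg; rewrite /integral_from0; case: ifP => x0; [|congr (- _)];
  apply: eq_Rintegral => t; rewrite inE/= in_itv/= => ht; apply: fg; [by left|by right].
Qed.

Lemma Rintegral_oo_cc f a b : loc_integrable f ->
  \int[mu]_(t in `]a, b[) f t = \int[mu]_(t in `[a, b]) f t.
Proof.
move=> lf; rewrite Rintegral_itv_bndo_bndc; last first.
  by apply: integrableS (lf a b) => //; apply: subset_itv; rewrite bnd_simp.
rewrite Rintegral_itv_obnd_cbnd//.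
by apply: integrableS (lf a b) => //; apply: subset_itvr; rewrite bnd_simp.
Qed.

End IntegralFrom0.

(** * The p-elliptic integrals *)

Section ImproperIntegrals.
Context {R : realType}.
Notation mu := (@lebesgue_measure R).
Implicit Types (f H : R -> R) (a b c k x : R).

(** Improper integrability at both ends: on compact subintervals the fundamental theorem bounds the
    integral by H b - H a, and monotone convergence carries the bound to the open interval. *)
Lemma integrable_ge0_primitive f H a b : a < b -> continuous H ->
  (forall x, a < x < b -> is_derive x (1:R) H (f x)) ->
  (forall x, a < x < b -> 0 <= f x) -> {in `]a, b[, continuous f} ->
  mu.-integrable `]a, b[ (EFin \o f).
Proof.
move=> ab cH dH f0 cf.
have mf : measurable_fun `]a, b[ f.
  apply: open_continuous_measurable_fun; first exact: interval_open.
  by move=> x; rewrite inE /= => xab; apply: cf.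
(* The denominator n + 3 keeps d n below (b - a)/2, so every [F n] is a nondegenerate interval,
   already for n = 0. *)
pose d (n : nat) : R := (b - a) / n.+3%:R.
pose F (n : nat) := `[a + d n, b - d n]%classic.
have ba : 0 < b - a by rewrite subr_gt0.
have d0 n : 0 < d n by rewrite divr_gt0.
have dlt n : a + d n < b - d n.
  have : d n < (b - a) / 2.
    by rewrite ltr_pM2l// ltf_pV2 ?posrE// ltr_nat.
  move: (d n) => t; lra.
have dmono n m : (n <= m)%N -> d m <= d n.
  by move=> nm; rewrite ler_pM2l// lef_pV2 ?posrE// ler_nat.
have Fsub n : F n `<=` `]a, b[.
  move=> x; rewrite /F /= !in_itv/= => /andP[h1 h2].
  by rewrite (lt_le_trans _ h1) ?ltrDl// (le_lt_trans h2)// gtrBl.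
have UF : \bigcup_i F i = `]a, b[%classic.
  apply/seteqP; split => [x [i _]|x]; first exact: Fsub.
  rewrite /= in_itv/= => /andP[ax xb].
  have e0 : 0 < Num.min (x - a) (b - x) by rewrite lt_min !subr_gt0 ax.
  have [n nP] : exists n, d n <= Num.min (x - a) (b - x).
    have [n hn] := @ltr_add_invr R 0 (Num.min (x - a) (b - x) / (b - a)) (divr_gt0 e0 ba).
    exists n; rewrite /d mulrC -ler_pdivlMr//.
    apply: le_trans (ltW hn); rewrite add0r lef_pV2 ?posrE// ler_nat.
    exact: leq_trans (leqnSn _) (leqnSn _).
  move: nP; rewrite le_min => /andP[h1 h2].
  exists n => //; rewrite /F /= in_itv/=; apply/andP; split; move: (d n) h1 h2 => t; lra.
have Ile n : (\int[mu]_(x in F n) (f x)%:E <= (H b - H a)%:E)%E.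
  rewrite (@continuous_FTC2 R f H _ _ (dlt n)).
  - rewrite -EFinB lee_fin lerB//.
      apply: (@der_nonneg_le _ H f) => //.
      + by rewrite gerBl ltW.
      + exact: continuous_subspaceT.
      + move=> x /andP[h1 h2]; apply: dH; rewrite h2 andbT (lt_trans _ h1)//.
        by rewrite (lt_trans _ (dlt n))// ltrDl.
      + move=> x /andP[h1 h2]; apply: f0; rewrite h2 andbT (lt_trans _ h1)//.
        by rewrite (lt_trans _ (dlt n))// ltrDl.
    apply: (@der_nonneg_le _ H f) => //.
      + by rewrite lerDl ltW.
      + exact: continuous_subspaceT.
      + move=> x /andP[h1 h2]; apply: dH; rewrite h1/= (lt_trans h2)//.
        by rewrite (lt_trans (dlt n))// gtrBl.
      + move=> x /andP[h1 h2]; apply: f0; rewrite h1/= (lt_trans h2)//.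
        by rewrite (lt_trans (dlt n))// gtrBl.
  - apply: continuous_in_subspaceT => x; rewrite inE => /Fsub; exact: cf.
  - split; last 2 first.
    + by apply: cvg_at_right_filter; exact: cH.
    + by apply: cvg_at_left_filter; exact: cH.
    + move=> x xF; have : x \in `]a, b[.
        apply: Fsub; rewrite /F /=; exact: subset_itv_oo_cc xF.
      by rewrite in_itv/= => /dH h; apply: ex_derive.
  - move=> x xF; rewrite derive1E.
    have : x \in `]a, b[.
      apply: Fsub; rewrite /F /=; exact: subset_itv_oo_cc xF.
    by rewrite in_itv/= => /dH h; apply: derive_val.
apply/integrableP; split; first exact/measurable_EFinP.
rewrite -UF.
have h : (\int[mu]_(x in F i) `|(f x)%:E| @[i --> \oo] -->
   \int[mu]_(x in \bigcup_i F i) `|(f x)%:E|)%E.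
  apply: ge0_nondecreasing_set_cvg_integral.
  - move=> n m nm; apply/subsetPset => x; rewrite /F /= !in_itv/= => /andP[h1 h2].
    have := dmono _ _ nm; move: (d n) (d m) h1 h2 => u v h1 h2 uv; apply/andP; split; lra.
  - by move=> i; exact: measurable_itv.
  - move=> i; apply: measurableT_comp => //; apply/measurable_EFinP.
    exact: measurable_funS mf.
  - by move=> i x _; exact: abse_ge0.
rewrite (@le_lt_trans _ _ (H b - H a)%:E) ?ltry//.
have -> : (\int[mu]_(x in \bigcup_i F i) `|(EFin \o f) x|)%E =
  limn (fun i => \int[mu]_(x in F i) `|(f x)%:E|)%E by apply/esym/cvg_lim.
apply: lime_le; first by apply/cvg_ex; eexists; exact: h.
apply: nearW => n; apply: le_trans (Ile n).
rewrite le_eqVlt; apply/orP; left; apply/eqP.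
apply: eq_integral => x; rewrite inE => /Fsub xab.
by rewrite /= ger0_norm// f0//; move: xab; rewrite /= in_itv.
Qed.

Lemma integrable_itv_cc f a b : mu.-integrable `]a, b[ (EFin \o f) ->
  measurable_fun setT f -> mu.-integrable `[a, b] (EFin \o f).
Proof.
move=> /integrableP[_ h] mf.
have mf' (D : set R) : measurable_fun D (EFin \o f).
  by apply/measurable_EFinP; exact: measurable_funS mf.
have mf2 (D : set R) : measurable_fun D (fun x => `|(EFin \o f) x|)%E by apply: measurableT_comp.
apply/integrableP; split; first exact: mf'.
by rewrite -integral_itv_obnd_cbnd// -integral_itv_bndo_bndc.
Qed.

Lemma integrable_itv_join f a b c : measurable_fun setT f -> a <= b -> b <= c ->
  mu.-integrable `[a, b] (EFin \o f) -> mu.-integrable `[b, c] (EFin \o f) ->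
  mu.-integrable `[a, c] (EFin \o f).
Proof.
move=> mf ab bc /integrableP[_ h1] /integrableP[_ h2].
have mf' (D : set R) : measurable_fun D (EFin \o f).
  by apply/measurable_EFinP; exact: measurable_funS mf.
have mf2 (D : set R) : measurable_fun D (fun x => `|(EFin \o f) x|)%E by apply: measurableT_comp.
apply/integrableP; split; first exact: mf'.
rewrite (@itv_bndbnd_setU _ _ _ (BRight b)) ?bnd_simp//.
rewrite integral_setU; [| | |exact: mf2|]; last first.
- apply/disj_set2P; rewrite -subset0 => z/=; rewrite !in_itv/= => -[/andP[_]].
  by rewrite leNgt => /negbTE ->.
- exact: measurable_itv.
- exact: measurable_itv.
by rewrite lte_add_pinfty// integral_itv_obnd_cbnd.
Qed.

End ImproperIntegrals.

(** * Integrals with the weight |cos|^b for b > -1 *)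

Section CosWeight.
Context {R : realType}.
Notation mu := (@lebesgue_measure R).
Implicit Types (x y : R).

Lemma is_derive_powR_norm_neq0 (k x : R) : x != 0 ->
  is_derive x (1:R) (fun t : R => `|t| `^ k) (k * spow (k - 1) x).
Proof.
move=> x00; have [x0|x0|x0] := ltgtP x 0; last by rewrite x0 eqxx in x00.
- apply: (@der_near _ (fun t => (- t) `^ k)).
    near=> t; rewrite ltr0_norm//; near: t; exact: lt_nbhsl.
  have h : is_derive x (1:R) (fun t : R => - t) (- 1) by der.
  have x0' : 0 < - x by rewrite oppr_gt0.
  have hh := @der_pow _ (fun t => - t) x (-1) k x0' h.
  by apply: (is_derive_eq hh); rewrite /spow ltr0_sg// ltr0_norm//; ring.
- apply: (@der_near _ (fun t => t `^ k)).
    near=> t; rewrite gtr0_norm//; near: t; exact: lt_nbhsr.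
  have h := @der_pow _ (fun t => t) x 1 k x0 (derI x).
  by apply: (is_derive_eq h); rewrite /spow gtr0_sg// gtr0_norm//; ring.
Unshelve. all: by end_near. Qed.

(** Induction by quarter turns: shifting the argument by pi/2 exchanges sine and cosine and reverses
    exactly one sign. *)
Lemma sin_cos_quarter (n : nat) x : n%:R * (pi / 2) < x < n.+1%:R * (pi / 2) ->
  0 < (-1) ^+ n * (sin x * cos x).
Proof.
elim: n x => [|n IH] x.
  rewrite mul0r mul1r => /andP[x0 xp]; rewrite expr0 mul1r mulr_gt0//.
    by rewrite sin_gt0_pihalf// x0.
  rewrite cos_gt0_pihalf// xp andbT (lt_trans _ x0)// oppr_lt0; have := pi_gt0 R; lra.
move: IH; set P : R := pi / 2 => IH /andP[h1 h2].
have := IH (x - P); rewrite sinBpihalf cosBpihalf exprS mulN1r => /(_ _)/wrap[].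
  rewrite ltrBrDr ltrBlDr -[n%:R * P + P](_ : n.+1%:R * P = _) ?h1/=; last first.
    by rewrite mulrSr mulrDl mul1r.
  by rewrite -[n.+1%:R * P + P](_ : n.+2%:R * P = _)// [in LHS]mulrSr mulrDl mul1r.
by move=> h; apply: lt_le_trans h _; rewrite le_eqVlt; apply/orP; left; apply/eqP; ring.
Qed.

(** The shift by a multiple of pi changes both factors simultaneously; it reaches negative arguments
    while quarters stay indexed by natural numbers. *)
Lemma sin_cos_quarter_shift (N n : nat) x :
  n%:R * (pi / 2) < x + N%:R * pi < n.+1%:R * (pi / 2) ->
  0 < (-1) ^+ n * (sin x * cos x).
Proof.
move/sin_cos_quarter; rewrite mulr_natl.
rewrite (alternatingn (@sinDpi R)) (alternatingn (@cosDpi R)).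
by rewrite mulrACA -exprD addnn -mul2n exprM sqrrN expr1n expr1n mul1r.
Qed.

Variables (b : R).
Hypothesis hb : -1 < b.

(** Comparison function for |cos|^b: on each quarter it has the primitive |cos|^(b+1)/(b+1) up to
    sign, which is continuous at the zeros of the cosine because b > -1. *)
Let s x := `|sin x| * `|cos x| `^ b.

Let measurable_norm_cos_powR : measurable_fun setT (fun x : R => `|cos x| `^ b).
Proof.
apply: (measurableT_comp (measurable_powR b)).
apply: measurableT_comp => //; apply: continuous_measurable_fun; exact: continuous_cos.
Qed.

Let measurable_s : measurable_fun setT s.
Proof.
apply: measurable_funM; last exact: measurable_norm_cos_powR.
apply: measurableT_comp => //.
apply: continuous_measurable_fun; exact: continuous_sin.
Qed.

Let integrable_s_quarter (N n : nat) :
  mu.-integrable `[n%:R * (pi / 2) - N%:R * pi, n.+1%:R * (pi / 2) - N%:R * pi] (EFin \o s).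
Proof.
apply: integrable_itv_cc; last exact: measurable_s.
have b1 : 0 < b + 1 by rewrite -ltrBlDr sub0r.
have e2 : ((-1) ^+ n : R) * (-1) ^+ n = 1 by rewrite -exprD addnn -mul2n exprM sqrrN expr1n expr1n.
have sc x : n%:R * (pi / 2) - N%:R * pi < x < n.+1%:R * (pi / 2) - N%:R * pi ->
    0 < (-1) ^+ n * (sin x * cos x).
  by move=> /andP[h1 h2]; apply: (@sin_cos_quarter_shift N); rewrite -ltrBlDr h1 -ltrBrDr h2.
apply: (@integrable_ge0_primitive _ s (fun x => - (-1) ^+ n / (b + 1) * `|cos x| `^ (b + 1))).
- rewrite ltrD2r ltr_pM2r ?divr_gt0 ?pi_gt0// ltr_nat//.
- apply: contM; first exact: contC.
  apply: (@cont_comp _ (fun y => `|y| `^ (b + 1))); [exact: continuous_powR_nonneg|exact: continuous_cos].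
- move=> x /sc hx.
  have c0 : cos x != 0 by apply: contraTneq hx => ->; rewrite !mulr0 ltxx.
  have h1 := der_comp (is_derive_powR_norm_neq0 (b + 1) c0) (is_derive_cos x).
  apply: (is_derive_eq (derM (derC _ x) h1)).
  rewrite mul0r add0r addrK /s /spow.
  have hs : `|sin x| = (-1) ^+ n * Num.sg (cos x) * sin x.
    have : 0 < (-1) ^+ n * Num.sg (cos x) * sin x * `|cos x|.
      by rewrite [X in 0 < X](_ : _ = (-1) ^+ n * (sin x * cos x))// {3}(numEsg (cos x)); ring.
    rewrite pmulr_lgt0 ?normr_gt0// => h3.
    rewrite -[RHS]gtr0_norm// normrM normrM normr_sg c0 normrX normrN normr1 expr1n.
    by rewrite !mul1r.
  rewrite hs.
  transitivity ((b + 1) / (b + 1) * ((-1) ^+ n * Num.sg (cos x) * sin x * `|cos x| `^ b)).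
    ring.
  by rewrite mulfV ?mul1r// gt_eqF.
- by move=> x _; rewrite mulr_ge0// powR_ge0.
- move=> x; rewrite in_itv/= => /sc hx.
  have c0 : cos x != 0 by apply: contraTneq hx => ->; rewrite !mulr0 ltxx.
  have hs : continuous (fun x : R => `|sin x|) by cont; exact: continuous_sin.
  apply: (@continuousM _ _ (fun x => `|sin x|) (fun x => `|cos x| `^ b)); first exact: hs.
  exact: (der_continuous (der_comp (is_derive_powR_norm_neq0 b c0) (is_derive_cos x))).
Qed.

Let integrable_s_quarters (N n : nat) :
  mu.-integrable `[- (N%:R * pi), n%:R * (pi / 2) - N%:R * pi] (EFin \o s).
Proof.
elim: n => [|n IH].
  rewrite mul0r sub0r set_itv1.
  apply/integrableP; split; last by rewrite integral_set1.
  by apply/measurable_EFinP; exact: measurable_funS measurable_s.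
apply: (@integrable_itv_join _ _ _ (n%:R * (pi / 2) - N%:R * pi)) => //.
- rewrite lerDr mulr_ge0// divr_ge0// pi_ge0//.
- by rewrite lerD2r ler_pM2r ?divr_gt0 ?pi_gt0// ler_nat.
Qed.

(** The singularities sit where |sin| is near 1. Where |sin| >= 1/2 the weight is at most 2 [s];
    elsewhere |cos| >= 1/2 and the weight is bounded. *)
Lemma loc_integrable_norm_cos_powR : loc_integrable (fun x : R => `|cos x| `^ b).
Proof.
move=> u v.
have [N hN] : exists N : nat, - u <= N%:R.
  by exists (Num.trunc (- u)).+1; rewrite ltW// truncnS_gt.
have [n hn] : exists n : nat, v + N%:R * pi <= n%:R.
  by exists (Num.trunc (v + N%:R * pi)).+1; rewrite ltW// truncnS_gt.
have Is : mu.-integrable `[u, v] (EFin \o s).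
  apply: integrableS (integrable_s_quarters N n) => //.
  apply: subset_itv; rewrite bnd_simp.
    have := @ler_wpM2l R N%:R (ler0n _ _) 1 pi; rewrite mulr1 => /(_ _)/wrap[].
      by have := pi_ge2 R; lra.
    by lra.
  have := @ler_wpM2l R n%:R (ler0n _ _) 1 (pi / 2); rewrite mulr1 => /(_ _)/wrap[].
    by have := pi_ge2 R; lra.
  by lra.
(* For b < 0 the bound on |cos|^b where |cos| >= 1/2 is (1/2)^b; for b >= 0 it is 1. The sum covers
   both cases. *)
pose C : R := (2^-1) `^ b + 1.
have IC : mu.-integrable `[u, v] (EFin \o (fun x => 2 * s x + C)).
  have -> : EFin \o (fun x => 2 * s x + C) = (fun x => 2%:E * (EFin \o s) x)%E \+ (EFin \o cst C).
    by apply/funext => x /=; rewrite EFinD EFinM.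
  apply: integrableD => //; first exact: integrableZl.
  apply: continuous_compact_integrable; first exact: segment_compact.
  exact/continuous_subspaceT/cst_continuous.
apply: le_integrable IC => //.
  by apply/measurable_EFinP; exact: measurable_funS measurable_norm_cos_powR.
move=> x _ /=; rewrite lee_fin (ger0_norm (powR_ge0 `|cos x| b)) (@ger0_norm _ (2 * _ + _)); last first.
  by rewrite addr_ge0 ?mulr_ge0 ?powR_ge0// addr_ge0 ?powR_ge0.
have [h|h] := leP (2^-1) `|sin x|.
  rewrite -[leLHS]addr0 lerD//; last by rewrite addr_ge0 ?powR_ge0.
  by rewrite /s mulrA -[leLHS]mul1r ler_wpM2r ?powR_ge0//; lra.
rewrite -[leLHS]add0r lerD// ?mulr_ge0 ?powR_ge0// /C.
have c1 : 2^-1 <= `|cos x|.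
  have h2 : `|sin x| ^+ 2 <= 4^-1.
    have -> : (4^-1 : R) = (2^-1) ^+ 2 by rewrite exprVn; congr (_^-1); ring.
    by rewrite lerXn2r ?nnegrE// ltW.
  rewrite leNgt; apply/negP => h3.
  have : `|cos x| ^+ 2 <= 4^-1.
    have -> : (4^-1 : R) = (2^-1) ^+ 2 by rewrite exprVn; congr (_^-1); ring.
    by rewrite lerXn2r ?nnegrE// ltW.
  move: h2; rewrite !real_normK ?num_real// => h2 h4; have := cos2Dsin2 x; lra.
rewrite /s.
have [b0|b0] := leP 0 b.
  rewrite -[leLHS]add0r lerD ?powR_ge0//.
  have := ge0_ler_powR b0 (normr_ge0 (cos x) : `|cos x| \in Num.nneg) (ler01 : (1:R) \in Num.nneg) (cos_max x).
  by rewrite powR1.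
rewrite -[leLHS]addr0 lerD//.
have nb : 0 <= - b by rewrite oppr_ge0 ltW.
have n1 : (2^-1 : R) \in Num.nneg by rewrite nnegrE.
have n2 : `|cos x| \in Num.nneg by rewrite nnegrE.
have := ge0_ler_powR nb n1 n2 c1; rewrite !powRN.
have c2 : 0 < `|cos x| by rewrite (lt_le_trans _ c1).
by rewrite lef_pV2// posrE powR_gt0.
Qed.

Variable h : R -> R.
Hypothesis hc : continuous h.
Hypothesis heven : forall x, h (- x) = h x.
Hypothesis hper : forall x, h (x + pi) = h x.

(** One integrand for three integrals: h is the inverse of the elliptic root for F, the root itself
    for E, and 1 for the limit modulus q = 1. *)
Let f x := `|cos x| `^ b * h x.
Let G := integral_from0 f.

Lemma loc_integrable_cos_weight : loc_integrable f.
Proof.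
move=> u v.
have -> : EFin \o f = ((EFin \o h) \* (EFin \o (fun x : R => `|cos x|%R `^ b)%R))%E.
  by apply/funext => x /=; rewrite -EFinM mulrC.
apply: integrableMr => //.
- by apply: (measurable_funS measurableT) => //; exact: continuous_measurable_fun.
- have [M hM] : exists M, forall x, u <= x <= v -> `|h x| <= M.
    have [uv|vu] := leP u v; last first.
      by exists 0 => x /andP[h1 h2]; have := le_trans h1 h2; rewrite leNgt vu.
    have cn : {within `[u, v], continuous (fun x => `|h x|)}.
      apply: continuous_subspaceT => x; apply: continuous_comp; [exact: hc|exact: norm_continuous].
    have [c _ hcM] := EVT_max uv cn.
    by exists `|h c| => x xuv; apply: hcM; rewrite in_itv.
  exists M; split; first exact: num_real.
  move=> y My x; rewrite /= in_itv/= => /hM; move=> h1; exact: (le_trans h1 (ltW My)).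
- exact: loc_integrable_norm_cos_powR.
Qed.

Lemma continuous_cos_weight_integral : continuous G.
Proof. exact/continuous_integral_from0/loc_integrable_cos_weight. Qed.

Lemma is_derive_cos_weight_integral x : cos x != 0 -> is_derive x (1:R) G (f x).
Proof.
move=> c0; apply: is_derive_integral_from0; first exact: loc_integrable_cos_weight.
apply: continuousM; last exact: hc.
exact: (der_continuous (der_comp (is_derive_powR_norm_neq0 b c0) (is_derive_cos x))).
Qed.

Let cos_neq0_pihalf x : - (pi / 2) < x < pi / 2 -> cos x != 0.
Proof. by move=> /cos_gt0_pihalf /gt_eqF ->. Qed.

(** A derivative argument replaces the change of variables: G y + G (- y) has zero derivative
    between consecutive zeros of the cosine, is continuous up to them, and vanishes at 0. *)
Lemma cos_weight_integral_odd x : - (pi / 2) <= x <= pi / 2 -> G (- x) = - G x.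
Proof.
move=> hx; suff : G x + G (- x) = 0 by move/eqP; rewrite addrC addr_eq0 => /eqP.
have cD : continuous (fun y => G y + G (- y)).
  move=> y; apply: continuousD; first exact: continuous_cos_weight_integral.
  apply: continuous_comp; [exact: opp_continuous|exact: continuous_cos_weight_integral].
have p0 := pi_gt0 R.
have pp : - (pi / 2) <= (pi : R) / 2 by lra.
have K := @der0_constant _ (fun y => G y + G (- y)) _ _ pp (continuous_subspaceT cD).
have {}K := K _; have : forall x, - (pi / 2) < x < pi / 2 ->
    is_derive x (1:R) (fun y => G y + G (- y)) 0.
  move=> y hy; have c0 := cos_neq0_pihalf hy.
  have c0' : cos (- y) != 0 by rewrite cosN.
  have h1 := is_derive_cos_weight_integral c0.
  have h2 := der_comp (is_derive_cos_weight_integral c0') (derN (derI y)).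
  apply: (is_derive_eq (derD h1 h2)); rewrite /f cosN heven; ring.
move/K => {}K; rewrite (K x hx) -(K 0); first by rewrite oppr0 /G integral_from0_0 addr0.
by apply/andP; split; lra.
Qed.

Lemma cos_weight_integral_shift (n : nat) x : - (pi / 2) <= x <= pi / 2 ->
  G (x + n%:R * pi) = G x + 2 * n%:R * G (pi / 2).
Proof.
have p0 := pi_gt0 R.
elim: n x => [|n IH] x hx; first by rewrite mul0r addr0 mulr0 mul0r addr0.
pose D y := G (y + n.+1%:R * pi) - G y.
have cD : continuous D.
  have cG := continuous_cos_weight_integral.
  apply: contD; last exact: contN.
  by apply: (@cont_comp _ G) => //; cont.
have pp : - (pi / 2) <= (pi : R) / 2 by lra.
have fper (m : nat) y : f (y + m%:R * pi) = f y.
  rewrite /f mulr_natl (alternatingn (@cosDpi R)) normrM normrX normrN normr1 expr1n mul1r.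
  by congr (_ * _); elim: m => [|m IHm]; rewrite ?mulr0n ?addr0// mulrSr addrA hper.
have K : D x = D (- (pi / 2)).
  apply: (@der0_constant _ D _ _ pp) => //; first exact: continuous_subspaceT.
  move=> y hy; have c0 := cos_neq0_pihalf hy.
  have c0' : cos (y + n.+1%:R * pi) != 0.
    by rewrite mulr_natl (alternatingn (@cosDpi R)) mulf_neq0// signr_eq0.
  have h1 := @der_comp _ G (fun y => y + n.+1%:R * pi) y _ _ (is_derive_cos_weight_integral c0') (derD (derI y) (derC (n.+1%:R * pi) y)).
  have h2 := derN (is_derive_cos_weight_integral c0).
  apply: (is_derive_eq (derD h1 h2)); rewrite fper; ring.
have e : (n.+1%:R : R) = n%:R + 1 by rewrite natr1.
(* The constant is read off at - pi/2: there the shifted argument is pi/2 + n pi, so the induction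
   hypothesis and oddness apply. *)
have {K} : D x = 2 * n.+1%:R * G (pi / 2).
  rewrite K /D.
  have -> : - (pi / 2) + n.+1%:R * pi = (pi : R) / 2 + n%:R * pi by rewrite e; field.
  rewrite IH; last by apply/andP; split; lra.
  rewrite cos_weight_integral_odd; last by apply/andP; split; lra.
  rewrite e; ring.
by move=> <-; rewrite /D; ring.
Qed.

Hypothesis h0 : forall x, 0 < h x.

(** Since f may vanish at zeros of the cosine, positivity only gives weak monotonicity at once.
    Equality would make G constant between x and y, against the positive derivative at a point where
    the cosine is not zero. *)
Lemma cos_weight_integral_incr x y : x < y -> G x < G y.
Proof.
move=> xy.
have f0 t : 0 <= f t by rewrite mulr_ge0 ?powR_ge0// ltW.
have Gle u v : u <= v -> G u <= G v.
  move=> uv; rewrite -subr_ge0 integral_from0B//; last exact: loc_integrable_cos_weight.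
  exact: Rintegral_ge0.
have [//|yx] := ltP (G x) (G y).
have e : G x = G y by apply/eqP; rewrite eq_le yx Gle ?ltW.
have cst t : x <= t <= y -> G t = G x.
  by move=> /andP[h1 h2]; apply/eqP; rewrite eq_le {1}e !Gle.
(* If the cosine vanished on the whole interval, its derivative - sin would vanish at the midpoint
   too, contradicting cos^2 + sin^2 = 1. *)
have [t ht c0] : exists2 t, x < t < y & cos t != 0.
  apply: contrapT => hn.
  have z t : x < t < y -> cos t = 0.
    by move=> ht; apply/eqP; apply: contrapT => /negP c; apply: hn; exists t.
  pose m := (x + y) / 2.
  have hm : x < m < y by rewrite midf_lt// midf_lt.
  have d1 := @der_eq_oo _ (fun=> 0) cos m 0 x y hm (fun t ht => esym (z t ht)) (derC 0 m).
  have d2 := is_derive_cos m.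
  have : - sin m = 0 by rewrite -(@derive_val _ _ _ _ _ _ _ d2) (@derive_val _ _ _ _ _ _ _ d1).
  move/eqP; rewrite oppr_eq0 => /eqP s0.
  have := cos2Dsin2 m; rewrite s0 (z _ hm) expr0n addr0 => /eqP; rewrite eq_sym oner_eq0//.
have d1 := is_derive_cos_weight_integral c0.
have d2 : is_derive t (1:R) G 0.
  have hh u : x < u < y -> G x = G u by move=> /andP[h1 h2]; rewrite cst// !ltW.
  exact: (@der_eq_oo _ (fun=> G x) G t 0 x y ht hh (derC _ _)).
have : f t = 0 by rewrite -(@derive_val _ _ _ _ _ _ _ d1) (@derive_val _ _ _ _ _ _ _ d2).
have h1 : 0 < f t by rewrite mulr_gt0// powR_gt0// normr_gt0.
by move=> h2; rewrite h2 ltxx in h1.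
Qed.

End CosWeight.

(** * Monotonicity of K, E and Q_p; the limit modulus q = 1 *)

Section EllipticIntegrals.
Context {R : realType}.
Variable p : R.
Hypothesis hp : 1 < p.
Implicit Types (q x s : R).

Lemma ell_exponent_gt : -1 < 1 - 2 / p.
Proof.
have p0 : 0 < p := lt_trans ltr01 hp.
have : 2 / p < 2 by rewrite ltr_pdivrMr// ltr_pMr.
lra.
Qed.

Definition ell_root q x : R := Num.sqrt (1 - q ^+ 2 * sin x ^+ 2).

Lemma ell_root_arg_gt0 q x : 0 <= q < 1 -> 0 < 1 - q ^+ 2 * sin x ^+ 2.
Proof.
move=> /andP[q0 q1]; have q2 : q ^+ 2 < 1 by rewrite expr_lt1.
have s2 : sin x ^+ 2 <= 1 by rewrite -(cos2Dsin2 x) lerDr sqr_ge0.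
rewrite subr_gt0; apply: le_lt_trans q2.
by rewrite -[leRHS]mulr1 ler_wpM2l// sqr_ge0.
Qed.

Lemma ell_root_arg_gt0_cos q x : 0 <= q <= 1 -> cos x != 0 -> 0 < 1 - q ^+ 2 * sin x ^+ 2.
Proof.
move=> /andP[q0 q1] c0; have q2 : q ^+ 2 <= 1 by rewrite expr_le1.
have s2 : sin x ^+ 2 < 1 by rewrite -(cos2Dsin2 x) ltrDr exprn_even_gt0.
rewrite subr_gt0; apply: le_lt_trans s2.
by rewrite -[leRHS]mul1r ler_wpM2r// sqr_ge0.
Qed.

Lemma ell_root_gt0 q x : 0 <= q < 1 -> 0 < ell_root q x.
Proof. by move=> hq; rewrite sqrtr_gt0 ell_root_arg_gt0. Qed.

Lemma cont_ell_root q : continuous (ell_root q).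
Proof. by rewrite /ell_root; cont. Qed.

Lemma ell_rootN q x : ell_root q (- x) = ell_root q x.
Proof. by rewrite /ell_root sinN sqrrN. Qed.

Lemma ell_root_pi q x : ell_root q (x + pi) = ell_root q x.
Proof. by rewrite /ell_root sinDpi sqrrN. Qed.

Let contV_root q : 0 <= q < 1 -> continuous (fun x => (ell_root q x)^-1).
Proof. by move=> hq; apply: contV; [exact: cont_ell_root|move=> x; rewrite gt_eqF// ell_root_gt0]. Qed.

Lemma ellEE q x : ellE p q x = integral_from0 (fun x => `|cos x| `^ (1 - 2 / p) * ell_root q x) x.
Proof. by apply: eq_integral_from0 => t _; rewrite mulrC. Qed.

Lemma is_derive_ellF q x : 0 <= q < 1 -> cos x != 0 ->
  is_derive x (1:R) (ellF p q) (`|cos x| `^ (1 - 2 / p) / ell_root q x).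
Proof.
move=> hq c0; apply: (@is_derive_cos_weight_integral R _ ell_exponent_gt (fun x => (ell_root q x)^-1)) => //.
exact: contV_root.
Qed.

Lemma continuous_ellF q : 0 <= q < 1 -> continuous (ellF p q).
Proof.
move=> hq; apply: (@continuous_cos_weight_integral R _ ell_exponent_gt (fun x => (ell_root q x)^-1)).
exact: contV_root.
Qed.

Lemma ellF_odd q x : 0 <= q < 1 -> - (pi / 2) <= x <= pi / 2 -> ellF p q (- x) = - ellF p q x.
Proof.
move=> hq hx; apply: (@cos_weight_integral_odd R _ ell_exponent_gt (fun x => (ell_root q x)^-1)) => //.
  exact: contV_root.
by move=> t; rewrite ell_rootN.
Qed.

Lemma ellF_shift q (n : nat) x : 0 <= q < 1 -> - (pi / 2) <= x <= pi / 2 ->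
  ellF p q (x + n%:R * pi) = ellF p q x + 2 * n%:R * ellK p q.
Proof.
move=> hq hx; apply: (@cos_weight_integral_shift R _ ell_exponent_gt (fun x => (ell_root q x)^-1)) => //.
- exact: contV_root.
- by move=> t; rewrite ell_rootN.
- by move=> t; rewrite ell_root_pi.
Qed.

Lemma ellF_incr q x y : 0 <= q < 1 -> x < y -> ellF p q x < ellF p q y.
Proof.
move=> hq xy; apply: (@cos_weight_integral_incr R _ ell_exponent_gt (fun x => (ell_root q x)^-1)) => //.
- exact: contV_root.
- by move=> t; rewrite invr_gt0 ell_root_gt0.
Qed.

Lemma ellF_inj q : 0 <= q < 1 -> injective (ellF p q).
Proof.
move=> hq x y e; have [h|h|//] := ltgtP x y; have := ellF_incr hq h; rewrite e ltxx//.
Qed.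

Lemma ellF0 q : ellF p q 0 = 0.
Proof. exact: integral_from0_0. Qed.

Lemma ellK_gt0 q : 0 <= q < 1 -> 0 < ellK p q.
Proof. by move=> hq; have := ellF_incr hq (divr_gt0 (pi_gt0 R) (ltr0n R 2)); rewrite ellF0. Qed.

Lemma am_ellF q x : 0 <= q < 1 -> am p q (ellF p q x) = x.
Proof.
move=> hq; rewrite /am; case: xgetP => [y _ | /(_ x)]; last by rewrite /=.
by move=> /= /(ellF_inj hq).
Qed.

Lemma is_derive_ellE q x : cos x != 0 ->
  is_derive x (1:R) (ellE p q) (`|cos x| `^ (1 - 2 / p) * ell_root q x).
Proof.
move=> c0; rewrite (funext (ellEE q)).
apply: (@is_derive_cos_weight_integral R _ ell_exponent_gt (ell_root q)) => //.
exact: cont_ell_root.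
Qed.

Lemma continuous_ellE q : continuous (ellE p q).
Proof.
rewrite (funext (ellEE q)).
apply: (@continuous_cos_weight_integral R _ ell_exponent_gt (ell_root q)).
exact: cont_ell_root.
Qed.

Lemma ellE_odd q x : - (pi / 2) <= x <= pi / 2 -> ellE p q (- x) = - ellE p q x.
Proof.
move=> hx; rewrite !ellEE; apply: (@cos_weight_integral_odd R _ ell_exponent_gt (ell_root q)) => //.
  exact: cont_ell_root.
by move=> t; rewrite ell_rootN.
Qed.

Lemma ellE_shift q (n : nat) x : - (pi / 2) <= x <= pi / 2 ->
  ellE p q (x + n%:R * pi) = ellE p q x + 2 * n%:R * ellEc p q.
Proof.
move=> hx; rewrite /ellEc !ellEE; apply: (@cos_weight_integral_shift R _ ell_exponent_gt (ell_root q)) => //.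
- exact: cont_ell_root.
- by move=> t; rewrite ell_rootN.
- by move=> t; rewrite ell_root_pi.
Qed.

Lemma ellE0 q : ellE p q 0 = 0.
Proof. exact: integral_from0_0. Qed.

Let pi2_gt0 : 0 < (pi : R) / 2. Proof. by rewrite divr_gt0// pi_gt0. Qed.

Let quarter_cos_gt0 x : 0 < x < pi / 2 -> 0 < cos x.
Proof. move=> /andP[h1 h2]; apply: cos_gt0_pihalf; rewrite h2 andbT; have := pi2_gt0; lra. Qed.

Lemma ellEc_decr q q' : 0 <= q < q' -> q' <= 1 -> ellEc p q' < ellEc p q.
Proof.
move=> /andP[q0 qq'] q'1.
rewrite -subr_gt0; have := (@der_pos_lt _ (fun x => ellE p q x - ellE p q' x)
  (fun x => `|cos x| `^ (1 - 2 / p) * ell_root q x - `|cos x| `^ (1 - 2 / p) * ell_root q' x) 0 (pi / 2) pi2_gt0).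
rewrite !ellE0 subrr; apply.
- apply: continuous_subspaceT; apply: contD; [|apply: contN]; exact: continuous_ellE.
- move=> x hx; have c0 : cos x != 0 by rewrite gt_eqF// quarter_cos_gt0.
  by apply: derD; [|apply: derN]; apply: is_derive_ellE.
- move=> x hx; have c0 := quarter_cos_gt0 hx.
  rewrite subr_gt0 ltr_pM2l; last by rewrite powR_gt0// normr_gt0 gt_eqF.
  have c0' : cos x != 0 by rewrite gt_eqF.
  rewrite ltr_sqrt; last by apply: ell_root_arg_gt0_cos => //; lra.
  rewrite ltrD2l ltrN2 ltr_pM2r; first by rewrite ltr_pXn2r// nnegrE; lra.
  rewrite exprn_gt0// sin_gt0_pihalf//.
Qed.

Lemma ellK_incr q q' : 0 <= q < q' -> q' < 1 -> ellK p q < ellK p q'.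
Proof.
move=> /andP[q0 qq'] q'1.
have hq : 0 <= q < 1 by lra.
have hq' : 0 <= q' < 1 by lra.
rewrite -subr_gt0; have := (@der_pos_lt _ (fun x => ellF p q' x - ellF p q x)
  (fun x => `|cos x| `^ (1 - 2 / p) / ell_root q' x - `|cos x| `^ (1 - 2 / p) / ell_root q x) 0 (pi / 2) pi2_gt0).
rewrite !ellF0 subrr; apply.
- apply: continuous_subspaceT; apply: contD; [|apply: contN]; exact: continuous_ellF.
- move=> x hx; have c0 : cos x != 0 by rewrite gt_eqF// quarter_cos_gt0.
  by apply: derD; [|apply: derN]; apply: is_derive_ellF.
- move=> x hx; have c0 := quarter_cos_gt0 hx.
  rewrite subr_gt0 ltr_pM2l; last by rewrite powR_gt0// normr_gt0 gt_eqF.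
  have c0' : cos x != 0 by rewrite gt_eqF.
  rewrite ltf_pV2 ?posrE ?ell_root_gt0//.
  rewrite ltr_sqrt; last by apply: ell_root_arg_gt0.
  rewrite ltrD2l ltrN2 ltr_pM2r; first by rewrite ltr_pXn2r// nnegrE; lra.
  rewrite exprn_gt0// sin_gt0_pihalf//.
Qed.

Lemma ellEc_ge0 q : 0 <= ellEc p q.
Proof.
rewrite /ellEc /ellE /integral_from0 (ltW pi2_gt0).
by apply: Rintegral_ge0 => x _; rewrite mulr_ge0 ?sqrtr_ge0 ?powR_ge0.
Qed.

(** In the quotient E/K the numerator decreases and the denominator increases. *)
Lemma Qfun_decr q q' : 0 < q < 1 -> 0 < q' < 1 -> q < q' -> Qfun p q' < Qfun p q.
Proof.
move=> /andP[q0 q1] /andP[q'0 q'1] qq'; rewrite /Qfun ltrD2r ltr_pM2l//.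
have K0 : 0 < ellK p q by rewrite ellK_gt0// ltW.
have K0' : 0 < ellK p q' by rewrite ellK_gt0// ltW.
have E := @ellEc_decr q q' (introT andP (conj (ltW q0) qq')) (ltW q'1).
have K := @ellK_incr q q' (introT andP (conj (ltW q0) qq')) q'1.
rewrite (@lt_le_trans _ _ (ellEc p q / ellK p q'))//.
  by rewrite ltr_pM2r ?invr_gt0.
by rewrite ler_wpM2l ?ellEc_ge0// lef_pV2 ?posrE// ltW.
Qed.

Lemma Qfun_inj q q' : 0 < q < 1 -> 0 < q' < 1 -> Qfun p q = Qfun p q' -> q = q'.
Proof.
move=> hq hq' e; have [h|h|//] := ltgtP q q'.
  by have := Qfun_decr hq hq' h; rewrite e ltxx.
by have := Qfun_decr hq' hq h; rewrite e ltxx.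
Qed.

Section Separatrix.
Hypothesis hp2 : 2 < p.

Let p0 : 0 < p. Proof. exact: lt_trans ltr01 hp. Qed.

Lemma sep_exponent_gt : -1 < - (2 / p).
Proof. by rewrite ltrN2 ltr_pdivrMr// mul1r. Qed.

(** [ellF1] continued beyond the quarter period by the absolute value, which makes it continuous and
    strictly increasing on the whole line; the factor 1 is the weight h of the general integrals. *)
Definition sepF x : R := integral_from0 (fun x : R => `|cos x| `^ (- (2 / p)) * 1) x.

Lemma ellF1E x : - (pi / 2) <= x <= pi / 2 -> ellF1 p x = sepF x.
Proof.
move=> /andP[h1 h2]; apply: eq_integral_from0 => t ht; rewrite mulr1 ger0_norm//.
by apply: cos_ge0_pihalf; have := pi2_gt0; case: ht => /andP[]; lra.
Qed.

Lemma ellK1E : ellK1 p = sepF (pi / 2).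
Proof. by rewrite /ellK1 ellF1E//; have := pi2_gt0; lra. Qed.

Let c1 : continuous (fun _ : R => 1 : R). Proof. exact: contC. Qed.

Lemma is_derive_sepF x : cos x != 0 -> is_derive x (1:R) sepF (`|cos x| `^ (- (2 / p))).
Proof.
move=> c0; have := @is_derive_cos_weight_integral R _ sep_exponent_gt _ c1 x c0.
by rewrite mulr1.
Qed.

Lemma continuous_sepF : continuous sepF.
Proof. exact: (@continuous_cos_weight_integral R _ sep_exponent_gt _ c1). Qed.

Lemma sepF_odd x : - (pi / 2) <= x <= pi / 2 -> sepF (- x) = - sepF x.
Proof. exact: (@cos_weight_integral_odd R _ sep_exponent_gt _ c1). Qed.

Lemma sepF_incr x y : x < y -> sepF x < sepF y.
Proof. exact: (@cos_weight_integral_incr R _ sep_exponent_gt _ c1). Qed.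

Lemma sepF0 : sepF 0 = 0. Proof. exact: integral_from0_0. Qed.

Lemma ellK1_gt0 : 0 < ellK1 p.
Proof. by rewrite ellK1E; have := sepF_incr pi2_gt0; rewrite sepF0. Qed.

Lemma am1_sepF x : - (pi / 2) <= x <= pi / 2 -> am1 p (sepF x) = x.
Proof.
move=> hx; rewrite /am1; case: xgetP => [y _ [hy]| /(_ x)]; last first.
  by rewrite /= ellF1E// => h; exfalso; apply: h.
by rewrite ellF1E// => e; have [/sepF_incr|/sepF_incr|//] := ltgtP x y; rewrite e ltxx.
Qed.

(** Integration by parts: the boundary term sin x |cos x|^(1-2/p) vanishes at 0 and, as p > 2, at
    pi/2. The threshold 1/(p-1) originates here. *)
Lemma ellEc1_ellK1 : (2 - 2 / p) * ellEc p 1 = (1 - 2 / p) * ellK1 p.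
Proof.
have e0 : 0 < 1 - 2 / p by have := sep_exponent_gt; lra.
pose D x := (2 - 2 / p) * ellE p 1 x - (1 - 2 / p) * sepF x
  - sin x * `|cos x| `^ (1 - 2 / p).
have cD : continuous D.
  rewrite /D; cont; [exact: continuous_ellE|exact: continuous_sepF|].
  apply: (@cont_comp _ (fun y => `|y| `^ (1 - 2 / p))); last exact: continuous_cos.
  exact: continuous_powR_nonneg.
have dD x : 0 < x < pi / 2 -> is_derive x (1:R) D 0.
  move=> hx; have cx := quarter_cos_gt0 hx.
  have c0 : cos x != 0 by rewrite gt_eqF.
  have d1 := is_derive_ellE 1 c0.
  have d2 := is_derive_sepF c0.
  have d3 := der_comp (is_derive_powR_norm_neq0 (1 - 2 / p) c0) (is_derive_cos x).
  have d4 := is_derive_sin x.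
  have d5 := derD (derD (derM (derC (2 - 2 / p) x) d1) (derN (derM (derC (1 - 2 / p) x) d2)))
    (derN (derM d4 d3)).
  apply: (is_derive_eq d5); rewrite !mul0r !add0r.
  have -> : ell_root 1 x = cos x.
    rewrite /ell_root expr1n mul1r -cos2sin2 sqrtr_sqr gtr0_norm//.
  rewrite spow_pos// !gtr0_norm//.
  have -> : 1 - 2 / p - 1 = - (2 / p) by ring.
  have -> : cos x `^ (1 - 2 / p) = cos x * cos x `^ (- (2 / p)).
    by rewrite powRD ?c0 ?implybT// powRr1// ltW.
  have sc : sin x ^+ 2 = 1 - cos x ^+ 2 := sin2cos2 x.
  have -> : (2 - 2 / p) * (cos x * cos x `^ (- (2 / p)) * cos x) -
    (1 - 2 / p) * cos x `^ (- (2 / p)) -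
    (cos x * (cos x * cos x `^ (- (2 / p))) +
     sin x * ((1 - 2 / p) * cos x `^ (- (2 / p)) * - sin x)) =
    cos x `^ (- (2 / p)) * (1 - 2 / p) * (sin x ^+ 2 - (1 - cos x ^+ 2)) by ring.
  by rewrite sc subrr mulr0.
have := @der0_constant _ D 0 (pi / 2) (ltW pi2_gt0) (continuous_subspaceT cD) dD (pi / 2).
rewrite /D sin0 ellE0 sepF0 cos_pihalf normr0 powR0 ?gt_eqF// -ellK1E !mulr0 mul0r !subr0.
move=> /(_ _)/wrap[|/eqP]; first by rewrite lexx ltW.
by rewrite subr_eq0 => /eqP.
Qed.

(** On the open quarter cos x lies below the elliptic root, so cos^(1-2/p)/root lies below
    cos^(-2/p). *)
Lemma ellK_lt_ellK1 q : 0 <= q < 1 -> ellK p q < ellK1 p.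
Proof.
move=> hq; rewrite ellK1E -subr_gt0; have := (@der_pos_lt _ (fun x => sepF x - ellF p q x)
  (fun x => `|cos x| `^ (- (2 / p)) - `|cos x| `^ (1 - 2 / p) / ell_root q x) 0 (pi / 2) pi2_gt0).
rewrite sepF0 ellF0 subrr; apply.
- apply: continuous_subspaceT; apply: contD; [|apply: contN]; [exact: continuous_sepF|exact: continuous_ellF].
- move=> x hx; have c0 : cos x != 0 by rewrite gt_eqF// quarter_cos_gt0.
  by apply: derD; [apply: is_derive_sepF|apply: derN; apply: is_derive_ellF].
- move=> x hx; have c0 := quarter_cos_gt0 hx.
  have c0' : cos x != 0 by rewrite gt_eqF.
  rewrite gtr0_norm// powRD ?c0' ?implybT// powRr1 ?ltW// mulrAC.
  rewrite -[X in _ < X - _]mul1r -mulrBl mulr_gt0 ?powR_gt0// subr_gt0.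
  rewrite ltr_pdivrMr ?ell_root_gt0// mul1r -(gtr0_norm c0) -sqrtr_sqr ltr_sqrt ?ell_root_arg_gt0//.
  rewrite cos2sin2 ltrD2l ltrN2 gtr_pMl; first by rewrite expr_lt1//; lra.
  rewrite exprn_gt0// sin_gt0_pihalf//.
Qed.

(** No limit q -> 1 is taken: E(q) > E(1) and K(q) < K_p(1), and the ratio E(1)/K_p(1) is known
    exactly. This excludes loops for r >= 1/(p-1). *)
Lemma Qfun_gt q : 0 < q < 1 -> - (1 / (p - 1)) < Qfun p q.
Proof.
move=> /andP[q0 q1].
have hq : 0 <= q < 1 by rewrite ltW.
have K0 := ellK_gt0 hq; have K1 := ellK_lt_ellK1 hq.
have E1 : ellEc p 1 < ellEc p q by apply: ellEc_decr => //; lra.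
have E : ellEc p 1 = (p - 2) / (2 * (p - 1)) * ellK1 p.
  have h := ellEc1_ellK1; have n0 : 2 - 2 / p != 0.
    rewrite gt_eqF//; have := ell_exponent_gt; lra.
  have pn : p - 1 != 0 by rewrite gt_eqF// subr_gt0.
  have pn0 : p != 0 by rewrite gt_eqF.
  apply: (mulfI n0); rewrite h mulrA; congr (_ * _); field.
  by rewrite pn pn0.
have k : (p - 2) / (2 * (p - 1)) < ellEc p q / ellK p q.
  rewrite ltr_pdivlMr//; apply: le_lt_trans E1; rewrite E ler_wpM2l ?(ltW K1)//.
  have a1 : 0 <= p - 2 by rewrite subr_ge0 ltW.
  have a2 : 0 <= 2 * (p - 1) by rewrite mulr_ge0// subr_ge0 ltW.
  by rewrite divr_ge0.
rewrite /Qfun.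
have -> : - (1 / (p - 1)) = 2 * ((p - 2) / (2 * (p - 1))) - 1.
  field; by rewrite gt_eqF// subr_gt0.
lra.
Qed.

End Separatrix.

End EllipticIntegrals.

(** * Solutions of the reduced elastica system *)

Section RealLemmas.
Context {R : realType}.
Implicit Types (f g : R -> R) (a b s x : R).

(** Meant for outer functions such as [asin] and [am1], whose continuity is available only on a
    closed interval. *)
Lemma continuous_within_comp f g (A : set R) a b : continuous f ->
  {within A, continuous g} -> (forall s, a <= s <= b -> A (f s)) ->
  {within `[a, b], continuous (fun s => g (f s))}.
Proof.
move=> cf /subspace_continuousP cg fA; apply/subspace_continuousP => s /=.
rewrite in_itv/= => hs; have h := cg (f s) (fA _ hs).
apply: (@cvg_comp _ _ _ f g _ (within A (nbhs (f s))) _ _ h) => B /= hB.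
have h2 : nbhs s [set t | A (f t) -> B (f t)] := cf s _ hB.
rewrite /within /=; apply: filterS h2 => t /= h3; rewrite in_itv/= => /fA; exact: h3.
Qed.

Lemma within_continuous_comp f g (A : set R) : continuous f ->
  {within A, continuous g} -> {within A, continuous (fun s => f (g s))}.
Proof. by move=> cf cg u; apply: continuous_comp; [exact: cg|exact: cf]. Qed.

Lemma asin_continuous_within : {within `[-1, 1], continuous (@asin R)}.
Proof.
have p0 := pi_gt0 R.
have := @segment_can_le_continuous R (- (pi / 2)) (pi / 2) sin asin.
rewrite sinN sin_pihalf; apply.
- by have := pi_gt0 R; lra.
- exact/continuous_subspaceT/continuous_sin.
- by move=> x hx; apply: sinK.
Qed.

Lemma asin1 : asin (1 : R) = pi / 2.
Proof.
have h : (pi : R) / 2 \in `[(- (pi / 2)), pi / 2].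
  by rewrite in_itv/=; have := pi_gt0 R; lra.
by have := sinK h; rewrite sin_pihalf.
Qed.

Lemma ivt_const_sign f a b : continuous f ->
  (forall s, a < s < b -> f s != 0) ->
  (forall s, a < s < b -> 0 < f s) \/ (forall s, a < s < b -> f s < 0).
Proof.
move=> cf f0; have [ab|ba] := ltP a b; last first.
  by left => s /andP[h1 h2]; have := lt_trans h1 h2; rewrite ltNge ba.
have key s t : a < s < b -> a < t < b -> 0 < f s -> 0 < f t.
  move=> hs ht fs; rewrite lt_neqAle eq_sym f0//= leNgt; apply/negP => ft.
  wlog st : f cf f0 s t hs ht fs ft / s <= t => [h|].
    have [st|/ltW ts] := leP s t; first exact: (h f cf f0 s t).
    apply: (h (fun x => - f x) _ _ t s) => //; first exact: contN.
    - by move=> u hu; rewrite oppr_eq0 f0.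
    - by rewrite oppr_gt0.
    - by rewrite oppr_lt0.
  have [||u] := @IVT R f s t 0 st.
  - exact: continuous_subspaceT.
  - by rewrite ge_min le_max (ltW ft) (ltW fs) orbT.
  - rewrite in_itv/= => /andP[h1 h2] /eqP; apply/negP/f0.
    by case/andP: hs => [h3 _]; case/andP: ht => [_ h4]; rewrite (lt_le_trans h3)// (le_lt_trans h2).
pose m := (a + b) / 2.
have hm : a < m < b by rewrite midf_lt// midf_lt.
have [fm|fm|fm] := ltgtP (f m) 0.
- right => s hs; have := f0 s hs; have := @key s m hs hm.
  by case: (ltgtP (f s) 0) => // _ /(_ isT); rewrite ltNge (ltW fm).
- by left => s hs; apply: (key m).
- by have := f0 m hm; rewrite fm eqxx.
Qed.

Lemma first_zero f s b : continuous f -> s <= b -> f s != 0 -> f b = 0 ->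
  exists c, [/\ s < c <= b, f c = 0 & forall u, s <= u < c -> f u != 0].
Proof.
move=> cf sb fs fb.
pose Z := [set u | s <= u /\ f u = 0].
have Zb : Z b by [].
have hl : has_lbound Z by exists s => u [].
have hi : has_inf Z by split; [exists b|].
pose c := inf Z.
have sc : s <= c by apply: lb_le_inf; [exists b|move=> u []].
have cb : c <= b by apply: ge_inf.
have fc : f c = 0.
  apply: contrapT => /eqP fc.
  have cn : continuous (fun x => `|f x|) by exact: cont_norm.
  have h : 0 < `|f c| by rewrite normr_gt0.
  have /= := cn c; move/cvgrPdist_lt => /(_ _ h) [e /= e0 he].
  have [u [su fu] uc] := inf_adherent e0 hi.
  have cu : c <= u by apply: ge_inf.
  have := he u; rewrite /= fu normr0 subr0 normr_id ltxx => /(_ _)/wrap[]//.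
  by rewrite distrC ger0_norm ?subr_ge0// ltrBlDl.
exists c; split => //.
  by rewrite cb andbT lt_neqAle sc andbT; apply/eqP => e; move: fs; rewrite e fc eqxx.
move=> u /andP[su uc]; apply/eqP => fu; have : c <= u by apply: ge_inf.
by rewrite leNgt uc.
Qed.

Lemma last_zero f a s : continuous f -> a <= s -> f s != 0 -> f a = 0 ->
  exists c, [/\ a <= c < s, f c = 0 & forall u, c < u <= s -> f u != 0].
Proof.
move=> cf as_ fs fa.
have cf' : continuous (fun x => f (- x)) by exact: (@cont_comp _ f _ cf (contN contI)).
have [|||c [/andP[h1 h2] fc hc]] := @first_zero (fun x => f (- x)) (- s) (- a) cf'.
- by rewrite lerN2.
- by rewrite opprK.
- by rewrite opprK.
exists (- c); split => //; first by rewrite lerNr h2 ltrNl.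
move=> u /andP[cu us]; rewrite -(opprK u); apply: hc; rewrite lerN2 us/=.
by rewrite ltrNl.
Qed.

Lemma zero_component f lo hi s : continuous f -> lo <= s <= hi ->
  f lo = 0 -> f hi = 0 -> f s != 0 ->
  exists a b, [/\ lo <= a < s, s < b <= hi, f a = 0, f b = 0 &
    (forall u, a < u < b -> 0 < f u) \/ (forall u, a < u < b -> f u < 0)].
Proof.
move=> cf /andP[ls sh] fl fh fs.
have [b [sb fb hb]] := first_zero cf sh fs fh.
have [a [as_ fa ha]] := last_zero cf ls fs fl.
exists a, b; split => //; apply: ivt_const_sign => // u /andP[au ub].
have [us|su] := leP u s; first by apply: ha; rewrite au.
by apply: hb; rewrite ub ltW.
Qed.

Lemma sin_double x : sin x = 2 * sin (x / 2) * cos (x / 2).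
Proof.
have -> : sin x = sin ((x / 2) *+ 2) by congr sin; rewrite mulr2n; field.
by rewrite sin_mulr2n mulr2n; ring.
Qed.

Lemma cos_double x : cos x = 1 - 2 * sin (x / 2) ^+ 2.
Proof.
have -> : cos x = cos ((x / 2) *+ 2) by congr cos; rewrite mulr2n; field.
by rewrite cos_mulr2n cos2sin2 mulr2n; ring.
Qed.

End RealLemmas.

(* Arclength form of the Euler-Lagrange system, scaled so that the modulus q is the
   amplitude of sin (th / 2); outside ]0, L[ only continuity is recorded. *)
Record elastica {R : realType} (p q L : R) (th x y : R -> R) : Prop := Elastica {
  el_th : continuous th;
  el_x : continuous x;
  el_y : continuous y;
  el_dth : forall s, 0 < s < L -> is_derive s (1:R) th
    (- (2 * q) * spow (p - 1)^-1 (y s / (p / (p - 1) * q)));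
  el_dx : forall s, 0 < s < L -> is_derive s (1:R) x (cos (th s));
  el_dy : forall s, 0 < s < L -> is_derive s (1:R) y (sin (th s));
  el_x0 : x 0 = 0;
  el_y0 : y 0 = 0;
  el_yL : y L = 0;
  el_q : sin (th 0 / 2) ^+ 2 = q ^+ 2
}.

Section ElasticaTheory.
Context {R : realType}.
Variable p : R.
Hypothesis hp : 1 < p.
Implicit Types (q L a b s : R) (th x y F : R -> R).

Notation P := (p / (p - 1)).

Lemma p_gt0 : 0 < p. Proof. exact: lt_trans ltr01 hp. Qed.

Lemma pB1_gt0 : 0 < p - 1. Proof. by rewrite subr_gt0. Qed.

Lemma conj_gt1 : 1 < P.
Proof. by rewrite ltr_pdivlMr ?pB1_gt0// mul1r ltrBlDr ltrDl. Qed.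

Lemma conj_gt0 : 0 < P. Proof. exact: lt_trans ltr01 conj_gt1. Qed.

Lemma conjB1 : P - 1 = (p - 1)^-1.
Proof. have h : p - 1 != 0 by rewrite gt_eqF// pB1_gt0. by field. Qed.

Lemma elastica_reflect q L th x y : elastica p q L th x y ->
  elastica p q L (fun s => - th s) x (fun s => - y s).
Proof.
case=> cth cx cy dth dx dy x0 y0 yL hq; split => //.
- exact: contN.
- exact: contN.
- move=> s hs; apply: (is_derive_eq (derN (dth s hs))); rewrite !mulNr spowN; ring.
- by move=> s hs; rewrite cosN; exact: dx.
- by move=> s hs; rewrite sinN; apply: derN; exact: dy.
- by rewrite y0 oppr0.
- by rewrite yL oppr0.
- by rewrite mulNr sinN sqrrN.
Qed.

(** A full turn of th moves th/2 by pi; this symmetry allows cos (th/2) to be taken positive. *)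
Lemma elastica_rotate q L th x y : elastica p q L th x y ->
  elastica p q L (fun s => th s + pi *+ 2) x y.
Proof.
case=> cth cx cy dth dx dy x0 y0 yL hq; split => //.
- by cont.
- by move=> s hs; apply: (is_derive_eq (derD (dth s hs) (derC _ s))); rewrite addr0.
- by move=> s hs; rewrite cosD2pi; exact: dx.
- by move=> s hs; rewrite sinD2pi; exact: dy.
- have -> : (th 0 + pi *+ 2) / 2 = th 0 / 2 + pi by rewrite mulr2n; field.
  by rewrite sinDpi sqrrN.
Qed.

(** The two derivative terms cancel since P - 1 = 1/(p-1) is the exponent in the angle equation; y 0
    = 0 and [el_q] fix the constant at 1. *)
Lemma elastica_energy q L th x y : 0 < q -> elastica p q L th x y ->
  forall s, 0 <= s <= L -> `|y s / (P * q)| `^ P = 1 - sin (th s / 2) ^+ 2 / q ^+ 2.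
Proof.
move=> q0 [cth cx cy dth dx dy x0 y0 yL hq] s hs.
have L0 : 0 <= L by case/andP: hs; exact: le_trans.
have Pq : P * q != 0 by rewrite mulf_neq0// gt_eqF// conj_gt0.
pose D s := `|y s / (P * q)| `^ P + sin (th s / 2) ^+ 2 / q ^+ 2 - 1.
have cD : continuous D.
  rewrite /D; cont.
  apply: (@cont_comp _ (fun t => `|t| `^ P)); last by cont.
  by apply: continuous_powR_nonneg; exact: conj_gt0.
have dD t : 0 < t < L -> is_derive t (1:R) D 0.
  move=> ht; have d1 := dth t ht; have d2 := dy t ht.
  have d3 : is_derive t (1:R) (fun s => y s / (P * q)) (sin (th t) / (P * q)).
    by apply: (is_derive_eq (derM d2 (derC _ t))); rewrite mulr0 addr0.
  have d4 := @der_comp _ (fun t => `|t| `^ P) (fun s => y s / (P * q)) t _ _ (is_derive_powR_norm (y t / (P * q)) conj_gt1) d3.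
  have d5 := derX 2 (der_sin (derM d1 (derC 2^-1 t))).
  have d6 := derD (derD d4 (derM d5 (derC (q ^+ 2)^-1 t))) (derC (- 1) t).
  apply: (is_derive_eq d6); rewrite conjB1 (sin_double (th t)) /=.
  have q1 : q != 0 by rewrite gt_eqF.
  have pn : p != 0 by rewrite gt_eqF// p_gt0.
  have pn1 : p - 1 != 0 by rewrite gt_eqF// pB1_gt0.
  field; by rewrite q1 pn1 pn.
have := der0_constant L0 (continuous_subspaceT cD) dD hs.
rewrite /D y0 mul0r normr0 powR0; last by rewrite gt_eqF// conj_gt0.
rewrite hq mulfV; last by rewrite expf_neq0// gt_eqF.
rewrite add0r subrr => h; lra.
Qed.

(** F is abstract so that one proof serves [ellF p q] for q < 1 and [sepF p] for q = 1. Under the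
    sign conditions al increases from - pi/2 to pi/2 with al' = 1/F'(al), so F (al s) - s is
    constant. *)
Lemma elastica_piece q L th x y F a b : 0 < q <= 1 -> elastica p q L th x y ->
  continuous F ->
  (forall t, - (pi / 2) < t < pi / 2 ->
    is_derive t (1:R) F (cos t `^ (1 - 2 / p) / ell_root q t)) ->
  F (- (pi / 2)) = - F (pi / 2) ->
  0 <= a -> a < b -> b <= L -> y a = 0 -> y b = 0 ->
  (forall s, a < s < b -> y s < 0) -> (forall s, a < s < b -> 0 < cos (th s / 2)) ->
  let al s := asin (sin (th s / 2) / q) in
  [/\ b - a = 2 * F (pi / 2), sin (th a / 2) = - q, sin (th b / 2) = q,
      {within `[a, b], continuous al} &
      forall s, a <= s <= b -> [/\ - (pi / 2) <= al s <= pi / 2,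
        F (al s) = s - a - F (pi / 2), sin (al s) = sin (th s / 2) / q,
        x s - x a = 2 * (ellE p q (al s) + ellEc p q) - (s - a) &
        y s = - (P * q * cos (al s) `^ (2 - 2 / p))]].
Proof.
move=> /andP[q0 q1] el cF dF Fodd a0 ab bL ya yb yneg cpos al.
have [cth cx cy dth dx dy x0 y0 yL hq] := el.
have en s : a <= s <= b -> `|y s / (P * q)| `^ P = 1 - (sin (th s / 2) / q) ^+ 2.
  move=> /andP[h1 h2]; rewrite expr_div_n; apply: (elastica_energy q0 el).
  by rewrite (le_trans a0 h1) (le_trans h2 bL).
have Pq0 : 0 < P * q by rewrite mulr_gt0// conj_gt0.
have p0 := p_gt0. have pp0 := pi_gt0 R.
have pn : p != 0 by rewrite gt_eqF. have pn1 : p - 1 != 0 by rewrite gt_eqF// pB1_gt0.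
pose z s := sin (th s / 2) / q.
have z2 s : a <= s <= b -> z s ^+ 2 <= 1.
  by move=> hs; rewrite -subr_ge0 -en// powR_ge0.
have z1 s : a <= s <= b -> -1 <= z s <= 1.
  move=> /z2 h; rewrite -ler_norml -(@ler_pXn2r _ 2)// ?nnegrE// expr1n.
  by rewrite real_normK ?num_real.
have oo_cc s : a < s < b -> a <= s <= b by move=> /andP[h1 h2]; rewrite !ltW.
have oo_0L s : a < s < b -> 0 < s < L.
  by move=> /andP[h1 h2]; rewrite (le_lt_trans a0 h1) (lt_le_trans h2 bL).
have sal s : a <= s <= b -> sin (al s) = z s by move=> hs; apply: asinK; rewrite in_itv/= z1.
have alr s : a <= s <= b -> - (pi / 2) <= al s <= pi / 2.
  by move=> hs; rewrite asin_geNpi2 ?asin_lepi2// z1.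
have cal s : a <= s <= b -> cos (al s) = Num.sqrt (1 - z s ^+ 2).
  by move=> hs; apply: cos_asin; rewrite z1.
have cal0 s : a <= s <= b -> 0 <= cos (al s) by move=> hs; rewrite cal// sqrtr_ge0.
have cz : continuous z by rewrite /z; cont.
have cw : {within `[a, b], continuous al}.
  apply: (@continuous_within_comp R z asin `[-1, 1]%classic) => //.
    exact: asin_continuous_within.
(* The energy identity reads |y/(P q)|^P = cos^2 al, and 2/P = 2 - 2/p. *)
have gE s : a <= s <= b -> `|y s / (P * q)| = cos (al s) `^ (2 - 2 / p).
  move=> hs.
  have h : (cos (al s)) `^ 2 = `|y s / (P * q)| `^ P.
    rewrite powR_mulrn ?cal0// cal// sqr_sqrtr ?en//.
    by rewrite subr_ge0 z2.
  have -> : 2 - 2 / p = 2 * P^-1 by field; rewrite pn pn1.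
  by rewrite powRrM h -powRrM mulfV ?powRr1// gt_eqF// conj_gt0.
have yE s : a <= s <= b -> y s = - (P * q * cos (al s) `^ (2 - 2 / p)).
  move=> hs; rewrite -gE//.
  have ys : y s <= 0.
    case/andP: (hs); rewrite le_eqVlt => /orP[/eqP <- _|h1]; first by rewrite ya.
    by rewrite le_eqVlt => /orP[/eqP ->|h2]; [rewrite yb|rewrite ltW// yneg// h1].
  rewrite normrM (ler0_norm ys) (gtr0_norm (_ : 0 < (P * q)^-1)) ?invr_gt0//.
  move: Pq0; set c := P * q => c0.
  by rewrite mulrCA mulfV ?gt_eqF// mulr1 opprK.
have cal_gt0 s : a < s < b -> 0 < cos (al s).
  move=> hs; have hs' := oo_cc _ hs; rewrite lt_neqAle cal0// andbT.
  apply/eqP => h; have := yneg s hs; rewrite yE// -h powR0 ?mulr0 ?oppr0 ?ltxx//.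
  have -> : 2 - 2 / p = 2 * P^-1 by field; rewrite pn pn1.
  by rewrite gt_eqF// mulr_gt0// invr_gt0 conj_gt0.
have alr_oo s : a < s < b -> - (pi / 2) < al s < pi / 2.
  move=> hs; have h := cal_gt0 _ hs; have /andP[h1 h2] := alr _ (oo_cc _ hs).
  rewrite !lt_neqAle h1 h2 !andbT; apply/andP; split; apply/eqP => e.
    by move: h; rewrite -e cosN cos_pihalf ltxx.
  by move: h; rewrite e cos_pihalf ltxx.
have rootE s : a < s < b -> ell_root q (al s) = cos (th s / 2).
  move=> hs; rewrite /ell_root sal ?oo_cc// /z expr_div_n mulrCA mulfV; last first.
    by rewrite expf_neq0// gt_eqF.
  by rewrite mulr1 -cos2sin2 sqrtr_sqr gtr0_norm// cpos.
(* The derivative of asin contributes 1/cos al and the angle equation contributes 2 q cos^(2/p) al;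
   the product is the reciprocal of the integrand of F. *)
have dal s : a < s < b -> is_derive s (1:R) al (ell_root q (al s) * cos (al s) `^ (2 / p - 1)).
  move=> hs; have hs' := oo_cc _ hs.
  have d1 := dth s (oo_0L _ hs).
  have d2 := derM (der_sin (derM d1 (derC 2^-1 s))) (derC q^-1 s).
  have zs : -1 < z s < 1.
    have := cal_gt0 _ hs; rewrite cal// sqrtr_gt0 subr_gt0 => h.
    rewrite -ltr_norml -(@ltr_pXn2r _ 2)// ?nnegrE// expr1n.
    by rewrite real_normK ?num_real.
  have d3 := @der_comp _ asin z s _ _ (is_derive1_asin zs) d2.
  apply: (is_derive_eq d3); rewrite -cal// rootE//.
  have c0 := cal_gt0 _ hs.
  have -> : spow (p - 1)^-1 (y s / (P * q)) = - cos (al s) `^ (2 / p).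
    have g0 : y s / (P * q) < 0 by rewrite ltr_pdivrMr// mul0r yneg.
    rewrite /spow ltr0_sg// mulN1r gE// -powRrM; congr (- (_ `^ _)); field.
    by rewrite pn pn1.
  rewrite powRB ?powRr1 ?cal0//; last by rewrite (gt_eqF c0) implybT.
  have cn : cos (al s) != 0 by rewrite gt_eqF.
  have qn : q != 0 by rewrite gt_eqF.
  rewrite !mulr0 !addr0; field; by rewrite cn qn.
have alab : al a < al b.
  apply: (der_pos_lt ab cw dal) => s hs.
  by rewrite mulr_gt0 ?powR_gt0 ?cal_gt0// rootE// cpos.
(* At a zero of y the energy forces sin^2 al = 1; strict monotonicity of al then assigns - pi/2 to a
   and pi/2 to b. *)
have endp s : a <= s <= b -> y s = 0 -> al s = - (pi / 2) \/ al s = pi / 2.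
  move=> hs ys; have := en s hs; rewrite ys mul0r normr0 powR0; last first.
    by rewrite gt_eqF// conj_gt0.
  move/esym/eqP; rewrite subr_eq0 => /eqP h.
  have : cos (al s) = 0 by rewrite cal// /z -h subrr sqrtr0.
  move: (alr _ hs) => /andP[h1 h2] c0.
  have [e|/eqP n1] := eqVneq (al s) (- (pi / 2)); first by left.
  have [e|/eqP n2] := eqVneq (al s) (pi / 2); first by right.
  have : 0 < cos (al s).
    by apply: cos_gt0_pihalf; rewrite !lt_neqAle h1 h2 !andbT; apply/andP; split; apply/eqP => // /esym.
  by rewrite c0 ltxx.
have haa : a <= a <= b by rewrite lexx ltW.
have hbb : a <= b <= b by rewrite lexx ltW.
have [ala alb] : al a = - (pi / 2) /\ al b = pi / 2.
  have h1 := endp a haa ya; have h2 := endp b hbb yb.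
  by case: h1 => h1; case: h2 => h2; move: alab; rewrite h1 h2; split => //; lra.
have Fal s : a <= s <= b -> F (al s) = s - a - F (pi / 2).
  move=> hs.
  have cD : {within `[a, b], continuous (fun s => F (al s) - s)}.
    apply: (@within_continuousB _ _ _ _ (fun s => F (al s)) (fun s => s)).
      move=> u; apply: continuous_comp; [exact: cw|exact: cF].
    exact/continuous_subspaceT/contI.
  have := @der0_constant _ (fun s => F (al s) - s) a b (ltW ab) cD _ s hs.
  rewrite ala Fodd => h; have {}h : F (al s) - s = - F (pi / 2) - a.
    apply: h => t ht; have d1 := der_comp (dF _ (alr_oo _ ht)) (dal _ ht).
    apply: (is_derive_eq (derD d1 (derN (derI t)))).
    have c0 := cal_gt0 _ ht.
    have -> : cos (al t) `^ (1 - 2 / p) / ell_root q (al t) *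
      (ell_root q (al t) * cos (al t) `^ (2 / p - 1)) =
      (ell_root q (al t) / ell_root q (al t)) * (cos (al t) `^ (1 - 2 / p) * cos (al t) `^ (2 / p - 1)) by ring.
    rewrite -powRD; last by rewrite (gt_eqF c0) implybT.
    rewrite mulfV; last by rewrite rootE// gt_eqF// cpos.
    by rewrite (_ : 1 - 2 / p + (2 / p - 1) = 0) ?powRr0 ?mulr1 ?subrr//; ring.
  by rewrite -[LHS](subrK s) h; ring.
split => //.
- have := Fal b hbb; rewrite alb => h; lra.
- have := sal a haa; rewrite ala sinN sin_pihalf /z => h.
  by rewrite -[LHS](divfK (_ : q != 0)) ?gt_eqF// -h mulN1r.
- have := sal b hbb; rewrite alb sin_pihalf /z => h.
  by rewrite -[LHS](divfK (_ : q != 0)) ?gt_eqF// -h mul1r.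
move=> s hs; split => //; [exact: alr|exact: Fal|exact: sal| |exact: yE].
(* This combination is constant because 2 root^2 - 1 = 2 cos^2 (th/2) - 1 = cos th. *)
have cD : {within `[a, b], continuous (fun s => 2 * ellE p q (al s) - s - x s)}.
  pose E2 t := 2 * ellE p q t.
  have cE2 : continuous E2 by apply: contM; [exact: contC|exact: continuous_ellE].
  apply: (@within_continuousB _ _ _ _ (fun s => E2 (al s) - s) x); last exact: continuous_subspaceT.
  apply: (@within_continuousB _ _ _ _ (fun s => E2 (al s)) (fun s => s)).
    exact: within_continuous_comp.
  exact/continuous_subspaceT/contI.
have := @der0_constant _ (fun s => 2 * ellE p q (al s) - s - x s) a b (ltW ab) cD _ s hs.
rewrite ala ellE_odd; [|by []|by lra].
rewrite -/(ellEc p q) => h; have {}h : 2 * ellE p q (al s) - s - x s = 2 * - ellEc p q - a - x a.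
  apply: h => t ht; have c0 := cal_gt0 _ ht.
  have c0' : cos (al t) != 0 by rewrite gt_eqF.
  have d1 := der_comp (is_derive_ellE hp q c0') (dal _ ht).
  apply: (is_derive_eq (derD (derD (derM (derC 2 t) d1) (derN (derI t))) (derN (dx _ (oo_0L _ ht))))).
  rewrite gtr0_norm// mul0r add0r.
  have -> : cos (al t) `^ (1 - 2 / p) * ell_root q (al t) *
      (ell_root q (al t) * cos (al t) `^ (2 / p - 1)) =
      (ell_root q (al t) ^+ 2) * (cos (al t) `^ (1 - 2 / p) * cos (al t) `^ (2 / p - 1)) by ring.
  rewrite -powRD; last by rewrite c0' implybT.
  rewrite (_ : 1 - 2 / p + (2 / p - 1) = 0) ?powRr0 ?mulr1; last by ring.
  rewrite rootE// cos2sin2 (cos_double (th t)); ring.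
lra.
Qed.

End ElasticaTheory.

(** * Modulus q < 1: waves *)

Section ElasticaClassification.
Context {R : realType}.
Variable p : R.
Hypothesis hp : 1 < p.
Implicit Types (q L a b s : R) (th x y : R -> R).

Notation P := (p / (p - 1)).

Lemma elastica_sign q L th x y (j : nat) : elastica p q L th x y ->
  elastica p q L (fun s => (-1) ^+ j * th s) x (fun s => (-1) ^+ j * y s).
Proof.
move=> el; rewrite -signr_odd; case: (odd j).
  have -> : (fun s => (-1) ^+ true * th s) = (fun s => - th s).
    by apply/funext => s; rewrite expr1 mulN1r.
  have -> : (fun s => (-1) ^+ true * y s) = (fun s => - y s).
    by apply/funext => s; rewrite expr1 mulN1r.
  exact: elastica_reflect.
have -> : (fun s => (-1) ^+ false * th s) = th by apply/funext => s; rewrite expr0 mul1r.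
by have -> : (fun s => (-1) ^+ false * y s) = y by apply/funext => s; rewrite expr0 mul1r.
Qed.

(** The sign of sin (th a) sends y strictly below 0 just after a, so a is an isolated zero on its
    right; y L = 0 guarantees a next one. *)
Lemma elastica_next_zero q L th x y a : elastica p q L th x y -> 0 <= a < L ->
  y a = 0 -> sin (th a) < 0 ->
  exists b, [/\ a < b <= L, y b = 0 & forall s, a < s < b -> y s < 0].
Proof.
move=> [cth cx cy dth dx dy x0 y0 yL hq] /andP[a0 aL] ya sa.
have cs : continuous (fun s => sin (th s)) by cont.
have h : 0 < - sin (th a) by rewrite oppr_gt0.
have /= := cs a; move/cvgrPdist_lt => /(_ _ h) [e /= e0 he].
have neg s : a < s < a + e -> sin (th s) < 0.
  move=> /andP[h1 h2]; have := he s; rewrite /= distrC => /(_ _)/wrap[].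
    by rewrite ger0_norm; lra.
  by rewrite ltr_norml => /andP[]; lra.
(* Halving the minimum keeps a + d strictly below both a + e and L. *)
pose d := Num.min e (L - a) / 2.
have d0 : 0 < d by rewrite divr_gt0// lt_min e0 subr_gt0.
have m1 : Num.min e (L - a) <= e by rewrite ge_min lexx.
have m2 : Num.min e (L - a) <= L - a by rewrite ge_min lexx orbT.
have de : d < e by move: d0 m1; rewrite /d; move: (Num.min _ _) => t; lra.
have dL : a + d < L by move: d0 m2; rewrite /d; move: (Num.min _ _) => t; lra.
have yneg s : a < s <= a + d -> y s < 0.
  move=> /andP[h1 h2].
  have := @der_pos_lt _ (fun s => - y s) (fun s => - sin (th s)) a s h1.
  rewrite ya oppr0 oppr_gt0; apply.
  - exact/continuous_subspaceT/contN.
  - by move=> t ht; apply: derN; apply: dy; lra.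
  - by move=> t ht; rewrite oppr_gt0; apply: neg; lra.
have ad : a < a + d <= a + d by rewrite ltrDl d0 lexx.
have yd : y (a + d) != 0 by rewrite lt_eqF// yneg.
have [b [hb yb nz]] := first_zero cy (ltW dL) yd yL.
exists b; split => //; first by lra.
have : forall s, a < s < b -> y s != 0.
  move=> s hs; have [h1|h1] := leP s (a + d); first by rewrite lt_eqF// yneg//; lra.
  by apply: nz; lra.
move/(ivt_const_sign cy) => [pos|//].
have := pos (a + d); have := yneg _ ad; move=> h1 /(_ _)/wrap[]; lra.
Qed.

(** The second component of [gamma_w] in terms of the amplitude: cn has exponent 2/p in c, and
    (2/p)(p - 1) = 2 - 2/p is the exponent delivered by the energy. The sign is that of the cosine
    after j half turns. *)
Lemma signed_cn_power (j : nat) (c : R) : 0 <= c ->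
  `| `|(-1) ^+ j * c| `^ (2 / p - 1) * ((-1) ^+ j * c)| `^ (p - 2) *
   (`|(-1) ^+ j * c| `^ (2 / p - 1) * ((-1) ^+ j * c)) = (-1) ^+ j * c `^ (2 - 2 / p).
Proof.
have p0 := p_gt0 hp. have pn : p != 0 by rewrite gt_eqF.
rewrite le_eqVlt => /orP[/eqP <-|c0].
  rewrite !mulr0 powR0 ?mulr0//.
  have -> : 2 - 2 / p = 2 * (p - 1) / p by field.
  by rewrite gt_eqF// divr_gt0// mulr_gt0// pB1_gt0.
have n1 : `|(-1) ^+ j * c| = c by rewrite normrM normrX normrN normr1 expr1n mul1r gtr0_norm.
have cn : c != 0 by rewrite gt_eqF.
rewrite n1.
have -> : c `^ (2 / p - 1) * ((-1) ^+ j * c) = (-1) ^+ j * c `^ (2 / p).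
  rewrite powRB ?cn ?implybT// powRr1 ?ltW//; field; exact: cn.
rewrite normrM normrX normrN normr1 expr1n mul1r (ger0_norm (powR_ge0 _ _)) mulrCA.
congr (_ * _); rewrite -powRrM -powRD ?cn ?implybT//; congr (_ `^ _).
by field.
Qed.

(** Pieces are glued one after another. Each has length 2K, and the reflected solution enters the
    next piece in the same configuration as the first, so the glued curve is a single [gamma_w]. *)
Lemma elastica_wave_core q L th x y : 0 < q < 1 -> 0 < L -> elastica p q L th x y ->
  sin (th 0 / 2) = - q -> 0 < cos (th 0 / 2) ->
  exists n : nat, [/\ (0 < n)%N, L = 2 * n%:R * ellK p q &
    forall s, 0 <= s <= L -> x s = (gamma_w p q (s - ellK p q)).1 - (ellK p q - 2 * ellEc p q) /\
       y s = (gamma_w p q (s - ellK p q)).2].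
Proof.
move=> hq L0 el s0 c0.
have [q0 q1] := andP hq.
have q01 : 0 <= q < 1 by lra.
have qle : 0 < q <= 1 by lra.
have pp0 := pi_gt0 R.
set K := ellK p q.
have K0 : 0 < K by exact: ellK_gt0.
pose T := 2 * K.
have T0 : 0 < T by rewrite mulr_gt0.
have [cth cx cy dth dx dy x0 y0 yL hq0] := el.
(* A zero of the cosine would give the energy the value 1 - 1/q^2, negative because q < 1. *)
have cpos s : 0 <= s <= L -> 0 < cos (th s / 2).
  move=> hs; rewrite ltNge; apply/negP => cn.
  have cc : continuous (fun s => cos (th s / 2)) by cont.
  have [s00 _] := andP hs.
  have [|u] := @IVT R _ 0 s 0 s00 (continuous_subspaceT cc).
    by rewrite ge_min le_max cn (ltW c0) orbT.
  rewrite in_itv/= => /andP[u0 us] cu.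
  have uL : 0 <= u <= L by lra.
  have := elastica_energy hp q0 el uL.
  have -> : sin (th u / 2) ^+ 2 = 1 by rewrite sin2cos2 cu expr0n subr0.
  have : 1 < 1 / q ^+ 2 by rewrite ltr_pdivlMr ?exprn_gt0// mul1r expr_lt1// ltW.
  by have := powR_ge0 `|y u / (P * q)| P; lra.
have dF t : - (pi / 2) < t < pi / 2 ->
    is_derive t (1:R) (ellF p q) (cos t `^ (1 - 2 / p) / ell_root q t).
  move=> /cos_gt0_pihalf ct; have := @is_derive_ellF _ _ hp q t q01.
  by rewrite gtr0_norm//; apply; rewrite gt_eqF.
have hpi : - (pi / 2) <= (pi : R) / 2 <= pi / 2 by lra.
have Fodd : ellF p q (- (pi / 2)) = - ellF p q (pi / 2) by apply: ellF_odd.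
(* The state after j pieces. The factor (-1)^j restores the initial value - q of the half-angle
   sine, so every piece is of the negative type treated in [elastica_piece]. *)
pose inv (j : nat) := [/\ j%:R * T <= L, y (j%:R * T) = 0,
  sin ((-1) ^+ j * th (j%:R * T) / 2) = - q,
  x (j%:R * T) = 4 * j%:R * ellEc p q - j%:R * T &
  forall s, 0 <= s <= j%:R * T ->
    x s = (gamma_w p q (s - K)).1 - (K - 2 * ellEc p q) /\ y s = (gamma_w p q (s - K)).2].
(* Adding j pi to the amplitude adds 2 j K = j T to F, which cancels the elapsed time. *)
have am_piece (j : nat) al s : - (pi / 2) <= al <= pi / 2 ->
    ellF p q al = s - j%:R * T - K -> am p q (s - K) = al + j%:R * pi.
  move=> hal e; rewrite -(am_ellF hp (al + j%:R * pi) q01) ellF_shift// e.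
  by congr (am p q _); rewrite -/K /T; ring.
have step j : inv j -> j%:R * T < L -> inv j.+1.
  move=> [_ yj sj xj form] jL; set a := j%:R * T in yj sj xj form jL *.
  have a0 : 0 <= a by rewrite mulr_ge0// ltW.
  have elj := elastica_sign j el.
  have cj s : 0 <= s <= L -> 0 < cos ((-1) ^+ j * th s / 2).
    move=> hs; have := cpos s hs; rewrite -signr_odd; case: (odd j).
      by rewrite expr1 mulN1r mulNr cosN.
    by rewrite expr0 mul1r.
  have aL : 0 <= a < L by rewrite a0.
  have ya : (-1) ^+ j * y a = 0 by rewrite yj mulr0.
  (* Double angle: the half-angle sine is - q and its cosine is positive, so y, with the sign of the
     current piece, turns negative again. *)
  have sa : sin ((-1) ^+ j * th a) < 0.
    rewrite sin_double sj mulrN mulNr oppr_lt0 !mulr_gt0//.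
    by apply: cj; lra.
  have [b [/andP[ab bL] yb yneg]] := elastica_next_zero elj aL ya sa.
  have cc s : a < s < b -> 0 < cos ((-1) ^+ j * th s / 2) by move=> hs; apply: cj; lra.
  have [ba sa' sb _ Hs] := elastica_piece hp qle elj (continuous_ellF hp q01) dF Fodd a0 ab bL ya yb yneg cc.
  have bT : b = j.+1%:R * T.
    have ba' : b - a = 2 * K := ba.
    rewrite -[j.+1%:R]natr1 mulrDl mul1r -/a /T; lra.
  have yb' : y b = 0.
    by move/eqP: yb; rewrite mulf_eq0 signr_eq0 /= => /eqP.
  have formb s : a <= s <= b -> x s = (gamma_w p q (s - K)).1 - (K - 2 * ellEc p q) /\
      y s = (gamma_w p q (s - K)).2.
    move=> hs; have [hal Fal sal xs ys] := Hs s hs.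
    set al := asin _ in hal Fal sal xs ys.
    rewrite -/(ellK p q) -/K in Fal.
    have ae := am_piece j al s hal Fal.
    rewrite /gamma_w /= /cn ae; split.
      rewrite ellE_shift// ; move: xs; rewrite xj => xs; lra.
    have -> : cos (al + j%:R * pi) = (-1) ^+ j * cos al.
      by rewrite mulr_natl (alternatingn (@cosDpi R)).
    rewrite signed_cn_power; last exact: cos_ge0_pihalf.
    have e2 : ((-1) ^+ j : R) * (-1) ^+ j = 1 by rewrite -exprD addnn -mul2n exprM sqrrN expr1n expr1n.
    have -> : y s = (-1) ^+ j * ((-1) ^+ j * y s) by rewrite mulrA e2 mul1r.
    rewrite ys; move: ((-1) ^+ j) => sg; ring.
  split; rewrite -?bT//.
  - by rewrite exprS mulN1r !mulNr sinN sb.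
  - have hb : a <= b <= b by lra.
    have [hal Fal sal xs ys] := Hs b hb.
    set al := asin _ in hal Fal sal xs ys.
    have ealb : al = pi / 2.
      by rewrite /al sb mulfV ?gt_eqF// asin1.
    move: xs; rewrite ealb -/(ellEc p q) xj => xs.
    have bj : b - a = T by rewrite bT -natr1 mulrDl mul1r addrC addKr.
    rewrite -natr1; lra.
  - move=> s /andP[h1 h2]; have [sa1|sa1] := leP s a; first by apply: form; rewrite h1.
    by apply: formb; rewrite h2 ltW.
have inv0 : inv 0%N.
  rewrite /inv !mul0r expr0 mul1r; split => //; [exact: ltW| |].
    by rewrite x0 mulr0 mul0r subrr.
  move=> s hs; have -> : s = 0 by apply/eqP; rewrite eq_le andbC.
  rewrite x0 y0.
  have ae : am p q (0 - K) = - (pi / 2) + 0%:R * pi.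
    by apply: am_piece; [lra|rewrite Fodd -/(ellK p q) -/K mul0r; ring].
  rewrite /gamma_w /= /cn ae mul0r addr0 cosN cos_pihalf !mulr0 oppr0 ellE_odd// -/(ellEc p q).
  by split => //; ring.
have [N hN] : exists N : nat, L < N%:R * T.
  by exists (Num.trunc (L / T)).+1; rewrite -ltr_pdivrMr// truncnS_gt.
(* Pieces are added until T divides the distance covered exactly to L; as [inv N] would need N T <=
   L, the second alternative must occur. *)
have : forall j, inv j \/ exists n, inv n /\ n%:R * T = L.
  elim=> [|j [IH|IH]]; [by left| |by right].
  have [jL _ _ _ _] := IH.
  move: jL; rewrite le_eqVlt => /orP[/eqP e|h]; first by right; exists j.
  by left; apply: step.
move=> /(_ N) [[h _ _ _ _]|[n [[_ _ _ _ form] e]]]; first by rewrite leNgt hN in h.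
exists n; split.
- by case: n e {form} => //; rewrite mul0r => e; rewrite -e ltxx in L0.
- by rewrite -e /T; ring.
- by move=> s hs; apply: form; rewrite e.
Qed.

(** Two normalizations lead to the core case: a full turn if the half-angle cosine is negative (it
    is not 0 since q < 1), and a reflection, recorded in [rf], if the half-angle sine is q. *)
Lemma elastica_wave q L th x y : 0 < q < 1 -> 0 < L -> elastica p q L th x y ->
  exists (n : nat) (rf : bool), [/\ (0 < n)%N, L = 2 * n%:R * ellK p q &
    forall s, 0 <= s <= L -> x s = (gamma_w p q (s - ellK p q)).1 - (ellK p q - 2 * ellEc p q) /\
       y s = if rf then - (gamma_w p q (s - ellK p q)).2 else (gamma_w p q (s - ellK p q)).2].
Proof.
move=> hq L0.
have [q0 q1] := andP hq.
wlog c0 : th / 0 < cos (th 0 / 2) => [W el|el].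
  have [c0|c0] := ltP 0 (cos (th 0 / 2)); first exact: (W th).
  have cn : cos (th 0 / 2) != 0.
    apply/eqP => c; have := cos2Dsin2 (th 0 / 2); rewrite c (el_q el) expr0n add0r => /eqP.
    by apply/negP; rewrite lt_eqF// expr_lt1// ltW.
  apply: (W (fun s => th s + pi *+ 2)); last exact: elastica_rotate.
  have -> : (th 0 + pi *+ 2) / 2 = th 0 / 2 + pi by rewrite mulr2n; field.
  by rewrite cosDpi oppr_gt0 lt_neqAle cn.
have : (sin (th 0 / 2) == q) || (sin (th 0 / 2) == - q) by rewrite -eqf_sqr (el_q el).
case/orP => /eqP s0.
  have c0' : 0 < cos (- th 0 / 2) by rewrite mulNr cosN.
  have s0' : sin (- th 0 / 2) = - q by rewrite mulNr sinN s0.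
  have [n [n0 Ln form]] := elastica_wave_core hq L0 (elastica_reflect el) s0' c0'.
  exists n, true; split => // s hs; have [h1 h2] := form s hs; split => //.
  by rewrite -h2 opprK.
have [n [n0 Ln form]] := elastica_wave_core hq L0 el s0 c0.
by exists n, false; split.
Qed.

End ElasticaClassification.

(** * Modulus q = 1: straight lines and flat-cores *)

Section FlatCore.
Context {R : realType}.
Variable p : R.
Hypothesis hp : 1 < p.
Implicit Types (L a b s u : R) (th x y : R -> R).

Notation P := (p / (p - 1)).
Notation K1 := (ellK1 p).

Lemma elastica_straight q L th x y : 0 < L -> elastica p q L th x y ->
  (forall s, 0 <= s <= L -> y s = 0) -> x L ^+ 2 = L ^+ 2.
Proof.
move=> L0 [cth cx cy dth dx dy x0 y0 yL hq] yz.
have thc s : 0 <= s <= L -> th s = th 0.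
  apply: (der0_constant (ltW L0) (continuous_subspaceT cth)) => t ht.
  apply: (is_derive_eq (dth t ht)); rewrite yz ?mul0r ?spow0 ?mulr0//; lra.
have xs s : 0 <= s <= L -> x s = cos (th 0) * s.
  move=> hs.
  have cD : continuous (fun s => x s - cos (th 0) * s) by cont.
  have := der0_constant (ltW L0) (continuous_subspaceT cD) _ hs.
  rewrite x0 mulr0 subrr => h; apply/eqP; rewrite -subr_eq0; apply/eqP; apply: h => t ht.
  apply: (is_derive_eq (derD (dx t ht) (derN (derM (derC (cos (th 0)) t) (derI t))))).
  rewrite thc; first by ring.
  lra.
have ys s : 0 <= s <= L -> y s = sin (th 0) * s.
  move=> hs.
  have cD : continuous (fun s => y s - sin (th 0) * s) by cont.
  have := der0_constant (ltW L0) (continuous_subspaceT cD) _ hs.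
  rewrite y0 mulr0 subrr => h; apply/eqP; rewrite -subr_eq0; apply/eqP; apply: h => t ht.
  apply: (is_derive_eq (derD (dy t ht) (derN (derM (derC (sin (th 0)) t) (derI t))))).
  rewrite thc; first by ring.
  lra.
have hL : 0 <= L <= L by rewrite ltW/=.
have : sin (th 0) * L = 0 by rewrite -ys.
move/eqP; rewrite mulf_eq0 (gt_eqF L0) orbF => /eqP s0.
by rewrite xs// exprMn cos2sin2 s0 expr0n subr0 mul1r.
Qed.

(** The Gronwall quantity is C = cos^2 (th/2), equal by the energy to |y/P|^P. It starts at 0 and
    satisfies C' <= 2 C, so it and y vanish identically. *)
Lemma elastica_straight_le2 L th x y : p <= 2 -> 0 < L -> elastica p 1 L th x y ->
  x L ^+ 2 = L ^+ 2.
Proof.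
move=> p2 L0 el; apply: (elastica_straight L0 el).
have [cth cx cy dth dx dy x0 y0 yL hq] := el.
have p0 := p_gt0 hp.
have en := elastica_energy hp ltr01 el.
have pn : p != 0 by rewrite gt_eqF. have pn1 : p - 1 != 0 by rewrite gt_eqF// pB1_gt0.
pose C s := cos (th s / 2) ^+ 2.
have C0 s : 0 <= C s by rewrite sqr_ge0.
have enC s : 0 <= s <= L -> `|y s / (P * 1)| `^ P = C s.
  by move=> hs; rewrite en// expr1n divr1 /C cos2sin2.
have c00 : C 0 = 0 by rewrite -enC ?lexx ?ltW// y0 mul0r normr0 powR0// gt_eqF// conj_gt0.
pose D s := expR (- (2 * s)) * C s.
have dC s : 0 < s < L -> exists2 d, is_derive s (1:R) C d & d <= 2 * C s.
  move=> hs; have hs' : 0 <= s <= L by lra.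
  have d1 := derX 2 (der_cos (derM (dth s hs) (derC 2^-1 s))).
  eexists; first exact: d1.
  rewrite mulr0 addr0 /=.
  set g := y s / _.
  (* By the energy the left side is |cos (th/2)|^(2/p); it is at most |cos (th/2)| precisely because
     2/p >= 1. *)
  have gle : `|spow (p - 1)^-1 g| <= `|cos (th s / 2)|.
    rewrite normr_spow ?invr_neq0//.
    have -> : (p - 1)^-1 = P * p^-1 by field; rewrite pn pn1.
    rewrite powRrM /g enC//.
    have -> : C s = `|cos (th s / 2)| `^ 2 by rewrite powR_mulrn// real_normK ?num_real.
    rewrite -powRrM.
    have [c0|c0] := eqVneq (cos (th s / 2)) 0.
      by rewrite c0 normr0 powR0// gt_eqF// divr_gt0.
    apply: ge1r_powR; first by rewrite normr_gt0 c0 cos_max.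
    by rewrite ler_pdivlMr// mul1r.
  have sle : `|sin (th s / 2)| <= 1 := sin_max _.
  have h : `|cos (th s / 2) * (sin (th s / 2) * spow (p - 1)^-1 g)| <= C s.
    rewrite normrM /C -[leRHS]real_normK ?num_real// expr2 ler_wpM2l//.
    by rewrite normrM -[leRHS]mul1r ler_pM.
  move: h; rewrite ler_norml => /andP[h1 h2].
  have -> : 2 * cos (th s / 2) ^+ 1 * (- sin (th s / 2) * (- (2 * 1) * spow (p - 1)^-1 g / 2)) =
     2 * (cos (th s / 2) * (sin (th s / 2) * spow (p - 1)^-1 g)).
    by rewrite expr1; field.
  by rewrite ler_pM2l.
have cC : continuous C by rewrite /C; cont.
have Dle s : 0 <= s <= L -> C s <= 0.
  move=> /andP[s0 sL].
  have cD : continuous (fun s => - D s).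
    rewrite /D; cont; apply: (@cont_comp _ expR); [exact: continuous_expR|by cont].
  pose dD t := 2 * D t - expR (- (2 * t)) * ('D_1 C t).
  have := @der_nonneg_le _ (fun s => - D s) dD 0 s s0 (continuous_subspaceT cD).
  have D0 : D 0 = 0 by rewrite /D c00 mulr0.
  rewrite D0 oppr0 oppr_ge0 => /(_ _ _)/wrap[||h].
  - move=> t ht; have ht' : 0 < t < L by lra.
    have [d d1 dle] := dC t ht'.
    have d2 := @der_comp _ expR (fun t => - (2 * t)) t _ _ (is_derive_expR (- (2 * t))) (derN (derM (derC 2 t) (derI t))).
    apply: (is_derive_eq (derN (derM d2 d1))); rewrite /dD /D.
    rewrite (@derive_val _ _ _ _ _ _ _ d1); first by lra.
  - move=> t ht; have ht' : 0 < t < L by lra.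
    have [d d1 dle] := dC t ht'; rewrite /dD (@derive_val _ _ _ _ _ _ _ d1).
    rewrite /D mulrCA -mulrBr mulr_ge0 ?expR_ge0// subr_ge0//.
  - by move: h; rewrite /D pmulr_rle0// expR_gt0.
move=> s hs; have Cs : C s = 0 by apply/eqP; rewrite eq_le Dle//=.
have := enC s hs; rewrite Cs mulr1 => /powR_eq0_eq0 /normr0_eq0 /eqP.
by rewrite mulf_eq0 invr_eq0 [P == 0]gt_eqF ?conj_gt0// orbF => /eqP.
Qed.

Hypothesis hp2 : 2 < p.

Let pi2_gt0 : 0 < (pi : R) / 2. Proof. by rewrite divr_gt0// pi_gt0. Qed.

Let K1_gt0 : 0 < K1. Proof. exact: ellK1_gt0. Qed.

Let sepF_pi : sepF p (pi / 2) = K1. Proof. by rewrite ellK1E. Qed.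

Let sepFN_pi : sepF p (- (pi / 2)) = - K1.
Proof. by rewrite sepF_odd// ?sepF_pi//; have := pi2_gt0; lra. Qed.

Lemma am1_continuous_within : {within `[- K1, K1], continuous (am1 p)}.
Proof.
have := @segment_can_le_continuous R (- (pi / 2)) (pi / 2) (sepF p) (am1 p).
rewrite sepF_pi sepFN_pi; apply.
- by have := pi2_gt0; lra.
- exact/continuous_subspaceT/continuous_sepF.
- by move=> x; rewrite in_itv/= => hx; apply: am1_sepF.
Qed.

(** The integrand sech_p^p = cos^2 am is controlled only on [-K1, K1]; composing with a projection
    onto that interval gives a globally continuous integrand, differentiable primitives included at
    the ends. *)
Lemma tanhp_primitive : exists2 H : R -> R,
  (forall u, - K1 <= u <= K1 -> tanhp p u = H u) &
  forall u, - K1 <= u <= K1 -> is_derive u (1:R) H (cos (am1 p u) ^+ 2).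
Proof.
have K0 := K1_gt0.
pose clamp u := Num.max (- K1) (Num.min K1 u).
have cclamp : continuous clamp.
  move=> u; apply: (@continuous_max _ _ (fun=> - K1) (fun u => Num.min K1 u)).
    exact: cst_continuous.
  apply: (@continuous_min _ _ (fun=> K1) (fun u => u)); first exact: cst_continuous.
  exact: contI.
have clampE u : - K1 <= u <= K1 -> clamp u = u.
  by move=> /andP[h1 h2]; rewrite /clamp (min_idPr h2) (max_idPr h1).
have clampi u : - K1 <= clamp u <= K1.
  by rewrite /clamp le_max lexx/= ge_max ge_min lexx /= andbT; lra.
pose h u := cos (am1 p (clamp u)) ^+ 2.
have ch : continuous h.
  rewrite /h; apply: contX; apply: cont_cos => u.
  have := @continuous_within_comp R clamp (am1 p) `[- K1, K1]%classic (u - 1) (u + 1) cclamp am1_continuous_within.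
  move=> /(_ _)/wrap[s _|hh]; first by rewrite /= in_itv/=.
  apply: (@within_continuous_continuous _ _ _ (u - 1) (u + 1) _ u _ hh); first lra.
  by rewrite in_itv/=; lra.
exists (integral_from0 h).
  move=> u hu; apply: eq_integral_from0 => t ht.
  have htt : - K1 <= t <= K1 by case: ht => /andP[]; lra.
  rewrite /h clampE// /sechp -powRrM.
  have -> : 2 / p * p = 2%:R by rewrite divfK// gt_eqF// p_gt0.
  rewrite powR_mulrn//.
  (* The value comes either from [- pi/2, pi/2] or from the default 0; the cosine is nonnegative in
     both cases. *)
  rewrite /am1; case: xgetP => [v _ [hv _]|_]; first exact: cos_ge0_pihalf.
  by rewrite cos0.
move=> u hu; have := @is_derive_integral_from0 R h u (continuous_loc_integrable ch) (ch u).
by rewrite {2}/h clampE.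
Qed.

(** Positions are compared relative to the start in x only, because loops begin at arbitrary points
    of the axis. The displacement is recorded separately for the length count of the flat-core. *)
Definition border_match (sg : bool) x y a b := [/\ b - a = 2 * K1,
  x b - x a = - (2 * K1 / (p - 1)) &
  forall s, a <= s <= b ->
    x s - x a = (ptrace (border_curve p sg) (s - a - K1)).1 - (ptrace (border_curve p sg) (- K1)).1 /\
    y s = (ptrace (border_curve p sg) (s - a - K1)).2].

(** For q = 1 the root is the cosine itself, so the integrand of F becomes cos^(-2/p) and the piece
    is parametrized by [am1]. *)
Lemma elastica_border_core L th x y a b : elastica p 1 L th x y ->
  0 <= a -> a < b -> b <= L -> y a = 0 -> y b = 0 ->
  (forall s, a < s < b -> y s < 0) -> (forall s, a < s < b -> 0 < cos (th s / 2)) ->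
  border_match true x y a b.
Proof.
move=> el a0 ab bL ya yb yneg cpos.
have q01 : 0 < (1 : R) <= 1 by rewrite ltr01 lexx.
have K0 := K1_gt0.
have dF t : - (pi / 2) < t < pi / 2 ->
    is_derive t (1:R) (sepF p) (cos t `^ (1 - 2 / p) / ell_root 1 t).
  move=> /cos_gt0_pihalf ct; have ctn : cos t != 0 by rewrite gt_eqF.
  apply: (is_derive_eq (is_derive_sepF hp hp2 ctn)); rewrite gtr0_norm//.
  have -> : ell_root 1 t = cos t.
    by rewrite /ell_root expr1n mul1r -cos2sin2 sqrtr_sqr gtr0_norm.
  by rewrite powRD ?ctn ?implybT// powRr1 ?ltW// mulrAC mulfV// mul1r.
have Fodd : sepF p (- (pi / 2)) = - sepF p (pi / 2) by rewrite sepF_pi.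
have [ba sa sb cal Hs] := elastica_piece hp q01 el (continuous_sepF hp hp2) dF Fodd a0 ab bL ya yb yneg cpos.
rewrite sepF_pi in ba.
have pn : p != 0 by rewrite gt_eqF// p_gt0. have pn1 : p - 1 != 0 by rewrite gt_eqF// pB1_gt0.
have [cth cx cy dth dx dy x0 y0 yL hq] := el.
split => //.
  have hb : a <= b <= b by rewrite lexx ltW.
  have [_ _ _ xb _] := Hs b hb; move: xb.
  have -> : asin (sin (th b / 2) / 1) = pi / 2.
    by rewrite sb divr1 asin1.
  rewrite -/(ellEc p 1) => ->; rewrite ba.
  have n0 : 2 - 2 / p != 0 by rewrite gt_eqF//; have := ell_exponent_gt hp; lra.
  (* With this value 4 E(1) - 2 K1 = - 2 K1/(p-1), the displacement of one loop. *)
  have E : ellEc p 1 = (p - 2) / (2 * (p - 1)) * K1.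
    apply: (mulfI n0); rewrite ellEc1_ellK1// mulrA; congr (_ * _); field.
    by rewrite pn1 pn.
  by rewrite E; field.
have [H tH dH] := tanhp_primitive.
move=> s hs.
have am1E t : a <= t <= b -> am1 p (t - a - K1) = asin (sin (th t / 2) / 1).
  by move=> ht; have [hal Fal _ _ _] := Hs t ht; rewrite -sepF_pi -Fal am1_sepF.
have ur t : a <= t <= b -> - K1 <= t - a - K1 <= K1 by lra.
split; last first.
  have [hal Fal sal xs ys] := Hs s hs.
  rewrite /= /sechp am1E// ys mulN1r mulr1 -powRrM.
  by congr (- (_ * (_ `^ _))); field.
rewrite /= !tH; [|lra|exact: ur].
have cD : {within `[a, b], continuous (fun s => x s - 2 * H (s - a - K1) + s)}.
  apply: (@within_continuousD _ _ _ _ (fun s => x s - 2 * H (s - a - K1)) (fun s => s)).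
    apply: (@within_continuousB _ _ _ _ x (fun s => 2 * H (s - a - K1))).
      exact: continuous_subspaceT.
    apply: derivable_within_continuous => t; rewrite in_itv/= => ht.
    have d := @der_comp _ H (fun s => s - a - K1) t _ _ (dH _ (ur _ ht))
      (derD (derD (derI t) (derC (- a) t)) (derC (- K1) t)).
    exact: (@ex_derive _ _ _ _ _ _ _ (derM (derC 2 t) d)).
  exact/continuous_subspaceT/contI.
have := @der0_constant _ (fun s => x s - 2 * H (s - a - K1) + s) a b (ltW ab) cD _ s hs.
rewrite (_ : a - a - K1 = - K1); last by ring.
move=> h; have {h} : x s - 2 * H (s - a - K1) + s = x a - 2 * H (- K1) + a.
  apply: h => t ht; have ht' : a <= t <= b by lra.
  have htL : 0 < t < L by lra.
  have d := @der_comp _ H (fun s => s - a - K1) t _ _ (dH _ (ur _ ht'))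
      (derD (derD (derI t) (derC (- a) t)) (derC (- K1) t)).
  apply: (is_derive_eq (derD (derD (dx t htL) (derN (derM (derC 2 t) d))) (derI t))).
  have [hal Fal sal xs ys] := Hs t ht'.
  rewrite am1E// cos2sin2 sal divr1 (cos_double (th t)); ring.
lra.
Qed.

Lemma border_match_reflect sg x y a b : border_match sg x (fun s => - y s) a b ->
  border_match (~~ sg) x y a b.
Proof.
move=> [h1 h2 h3]; split => // s hs; have [h4 h5] := h3 s hs; split; first exact: h4.
by rewrite -[LHS]opprK h5 /=; case: sg {h1 h2 h3 h4 h5} => /=; ring.
Qed.

(** Reflection makes y negative. The energy keeps cos (th/2) away from 0 where y is not 0, so it has
    a constant sign, which a full turn makes positive. *)
Lemma elastica_border L th x y a b : elastica p 1 L th x y ->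
  0 <= a -> a < b -> b <= L -> y a = 0 -> y b = 0 ->
  (forall s, a < s < b -> 0 < y s) \/ (forall s, a < s < b -> y s < 0) ->
  exists sg, border_match sg x y a b.
Proof.
move=> el a0 ab bL ya yb sy.
wlog yneg : th y el ya yb {sy} / forall s, a < s < b -> y s < 0 => [W|].
  case: sy => sy; last exact: (W th).
  have [||| sg m] := W _ _ (elastica_reflect el).
  - by rewrite ya oppr0.
  - by rewrite yb oppr0.
  - by move=> s hs; rewrite oppr_lt0 sy.
  by exists (~~ sg); exact: border_match_reflect.
have cn s : a < s < b -> cos (th s / 2) != 0.
  move=> hs; have hs' : 0 <= s <= L by lra.
  have := elastica_energy hp ltr01 el hs'; rewrite expr1n divr1 -cos2sin2 => h.
  apply/eqP => c; move: h; rewrite c expr0n mulr1 => /powR_eq0_eq0 /normr0_eq0 /eqP.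
  rewrite mulf_eq0 invr_eq0 [P == 0]gt_eqF ?conj_gt0// orbF => /eqP h.
  by have := yneg s hs; rewrite h ltxx.
have cc : continuous (fun s => cos (th s / 2)).
  by have cth := el_th el; cont.
exists true; case: (ivt_const_sign cc cn) => c; first exact: (elastica_border_core el).
apply: (elastica_border_core (elastica_rotate el)) => // s hs.
have -> : (th s + pi *+ 2) / 2 = th s / 2 + pi by rewrite mulr2n; field.
by rewrite cosDpi oppr_gt0 c.
Qed.

(** Where y = 0 and q = 1 the energy gives sin^2 (th/2) = 1, hence cos th = -1: segments always run
    to the left, as [line_curve] does. *)
Lemma elastica_line L th x y l a : elastica p 1 L th x y -> 0 <= l -> l <= a -> a <= L ->
  (forall s, l <= s <= a -> y s = 0) -> forall s, l <= s <= a -> x s = x l - (s - l).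
Proof.
move=> el l0 la aL yz s hs.
have [cth cx cy dth dx dy x0 y0 yL hq] := el.
have cD : continuous (fun s => x s + s) by cont.
have := der0_constant la (continuous_subspaceT cD) _ hs => h.
have {h} : x s + s = x l + l.
  apply: h => t ht; have htL : 0 < t < L by lra.
  apply: (is_derive_eq (derD (dx t htL) (derI t))).
  have htL' : 0 <= t <= L by lra.
  have := elastica_energy hp ltr01 el htL'; rewrite yz; last by lra.
  rewrite mul0r normr0 powR0; last by rewrite gt_eqF// conj_gt0.
  rewrite expr1n divr1 (cos_double (th t)); lra.
lra.
Qed.

Definition flat_piece (d : R * bool) : pcurve := concat (line_curve d.1) (border_curve p d.2).

Definition flat_pieces (cs : seq (R * bool)) : pcurve := concats (map flat_piece cs).

(** The invariant of the decomposition up to the parameter l: [cs] lists, in order, the length of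
    each segment with the sign of the loop after it. *)
Definition flat_state x y (cs : seq (R * bool)) (l : R) : Prop :=
  [/\ pstart (flat_pieces cs) = 0 /\ pstop (flat_pieces cs) = l,
      forall d, d \in cs -> 0 <= d.1,
      y l = 0,
      l = (\sum_(d <- cs) d.1) + 2 * (size cs)%:R * K1 /\
      x l = - (\sum_(d <- cs) d.1) - 2 * (size cs)%:R * K1 / (p - 1) &
      forall s, 0 <= s <= l -> ptrace (flat_pieces cs) s = (x s, y s)].

Lemma line_concat_trace (bc : pcurve) l s :
  ptrace (concat (line_curve l) bc) s = if s <= l then (- s, 0) else
    ((ptrace bc (s + pstart bc - l)).1 - l - (ptrace bc (pstart bc)).1,
     (ptrace bc (s + pstart bc - l)).2 - (ptrace bc (pstart bc)).2).
Proof.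
rewrite /= subr0 addr0; case: ifP => // _.
by case: (ptrace bc _) (ptrace bc _) => [u1 u2] [v1 v2]; congr pair => /=; rewrite addr0.
Qed.

Lemma line_concat_match (bc : pcurve) x y l a b : 0 <= l -> l <= a -> y l = 0 ->
  (forall s, l <= s <= a -> y s = 0) ->
  (forall s, l <= s <= a -> x s = x l - (s - l)) ->
  pstart bc = - K1 -> b = a + 2 * K1 ->
  (forall s, a <= s <= b ->
    x s - x a = (ptrace bc (s - a - K1)).1 - (ptrace bc (- K1)).1 /\
    y s = (ptrace bc (s - a - K1)).2) ->
  forall s, 0 <= s <= a - l + 2 * K1 ->
  ptrace (concat (line_curve (a - l)) bc) s = (x (s + l) - x l, y (s + l)).
Proof.
move=> l0 la yl yz xz bs bE mt s hs.
have K0 := K1_gt0.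
have xa : x a = x l - (a - l) by apply: xz; rewrite la lexx.
rewrite line_concat_trace bs; case: ifPn => [sl|].
  by rewrite xz ?yz//; [congr pair; ring|lra|lra].
rewrite -ltNge => sl.
have hs' : a <= s + l <= b by lra.
have haa : a <= a <= b by lra.
have [m1 m2] := mt _ hs'.
have [_ m3] := mt a haa.
rewrite (_ : s + - K1 - (a - l) = s + l - a - K1); last by ring.
rewrite (_ : a - a - K1 = - K1) in m3; last by ring.
have ya : y a = 0 by apply: yz; rewrite la lexx.
congr pair; first by lra.
by rewrite m2 -m3 ya subr0.
Qed.

(** One segment [l, a] followed by one loop [a, b] is appended; y l = 0 makes the translation in
    [concat] purely horizontal. *)
Lemma flat_extend x y cs l a b sg : flat_state x y cs l -> 0 <= l -> l <= a ->
  (forall s, l <= s <= a -> y s = 0) ->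
  (forall s, l <= s <= a -> x s = x l - (s - l)) ->
  y b = 0 -> border_match sg x y a b ->
  flat_state x y (rcons cs (a - l, sg)) b.
Proof.
move=> [[st sp] hd yl [ls xl] tr] l0 la yz xz yb [ba xba mt].
have K0 := K1_gt0.
have pn1 : p - 1 != 0 by rewrite gt_eqF// pB1_gt0.
have xa : x a = x l - (a - l) by apply: xz; rewrite la lexx.
have bE : b = a + 2 * K1 by lra.
set d := (a - l, sg).
have trp s : 0 <= s <= a - l + 2 * K1 -> ptrace (flat_piece d) s = (x (s + l) - x l, y (s + l)).
  by rewrite /flat_piece /d; exact: (line_concat_match l0 la yl yz xz _ bE mt).
have pd : pstart (flat_piece d) = 0 /\ pstop (flat_piece d) = a - l + 2 * K1.
  by split => //=; ring.
have trd : ptrace (flat_piece d) 0 = (0, 0).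
  by rewrite trp ?add0r ?subrr ?yl//; lra.
have fpE : [/\ pstart (flat_pieces (rcons cs d)) = 0, pstop (flat_pieces (rcons cs d)) = b &
    forall s, 0 <= s <= b -> ptrace (flat_pieces (rcons cs d)) s = (x s, y s)].
  (* The empty list is separate because [concats] starts its fold at the first curve, not at a
     neutral element. *)
  case: cs st sp hd ls xl tr => [|c cs'] st sp hd ls xl tr.
    have ll : l = 0 by rewrite ls big_nil mulr0 mul0r addr0.
    have E : flat_pieces (rcons [::] d) = flat_piece d by [].
    rewrite E; case: pd => -> ->; split; [by []|by rewrite ll; lra|].
    move=> s hs; rewrite trp; last by lra.
    have x0 : x l = 0 by rewrite xl big_nil /= mulr0 !mul0r oppr0 addr0.
    by rewrite x0 subr0 ll addr0.
  have E : flat_pieces (rcons (c :: cs') d) = concat (flat_pieces (c :: cs')) (flat_piece d).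
    by rewrite /flat_pieces /concats rcons_cons /= map_rcons foldl_rcons.
  rewrite E; move: st sp tr; set fc := flat_pieces _ => st sp tr.
  have [pd1 pd2] := pd.
  split => //; first by rewrite /concat; cbn [pstop]; rewrite st sp pd1 pd2; lra.
  move=> s hs; rewrite /concat; cbn [ptrace]; rewrite st sp pd1 !subr0 !addr0 trd.
  case: ifPn => [sl|]; first by apply: tr; lra.
  rewrite -ltNge => sl; rewrite trp; last by lra.
  rewrite tr; last by rewrite lexx l0.
  rewrite subrK yl; congr pair => /=; ring.
have [f1 f2 f3] := fpE.
split => //.
- move=> e; rewrite mem_rcons inE => /orP[/eqP ->|/hd//]; by rewrite /= subr_ge0.
- have szE : ((size (rcons cs d))%:R : R) = (size cs)%:R + 1 by rewrite size_rcons natr1.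
  rewrite szE -cats1 big_cat big_seq1 /=; split; first by lra.
  have -> : x b = x a - 2 * K1 / (p - 1) by lra.
  rewrite xa xl; field; exact: pn1.
Qed.

(** The next loop starts at the infimum a of the later parameters with y not 0. Loops cannot
    accumulate at a, since each of them has length 2 K1. *)
Lemma flat_step L th x y cs l : elastica p 1 L th x y -> flat_state x y cs l ->
  0 <= l <= L -> (forall s, l <= s <= L -> y s = 0) \/
  exists d b, flat_state x y (rcons cs d) b /\ l <= b <= L.
Proof.
move=> el fs /andP[l0 lL].
have [cth cx cy dth dx dy x0 y0 yL hq] := el.
have [yz|] := pselect (forall s, l <= s <= L -> y s = 0); first by left.
move=> /existsNP[s1] /not_implyP[hs1 ys1]; right.
have K0 := K1_gt0.
have yl : y l = 0 by case: fs.
pose N := [set s | l <= s <= L /\ y s != 0].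
have N1 : N s1 by split => //; apply/eqP.
have hi : has_inf N by split; [exists s1|exists l => u [/andP[]]].
pose a := inf N.
have la : l <= a by apply: lb_le_inf; [exists s1|move=> u [/andP[]]].
have aL : a <= L.
  by apply: le_trans (ge_inf hi.2 N1) _; case/andP: hs1.
have yza s : l <= s <= a -> y s = 0.
  move=> /andP[h1]; rewrite le_eqVlt => /orP[/eqP ->|h2]; last first.
    apply/eqP; apply: contrapT => /negP ys; have : a <= s.
      by apply: ge_inf; [case: hi|split => //; rewrite h1 (le_trans (ltW h2))].
    by rewrite leNgt h2.
  apply/eqP; apply: contrapT => /negP ya.
  have lta : l < a by rewrite lt_neqAle la andbT; apply/eqP => e; rewrite -e yl eqxx in ya.
  have [c [/andP[c1 c2] yc nz]] := last_zero cy la ya yl.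
  have : y ((c + a) / 2) != 0 by apply: nz; lra.
  move=> ym; have : a <= (c + a) / 2.
    apply: ge_inf; [by case: hi|split => //]; lra.
  lra.
have ya : y a = 0 by apply: yza; rewrite la lexx.
have pick e : 0 < e -> exists s, [/\ a < s, s < a + e, s <= L & y s != 0].
  move=> e0; have [s [/andP[h1 h2] h3] h4] := inf_adherent e0 hi.
  exists s; split => //; rewrite lt_neqAle ge_inf ?andbT; [|by case: hi|by split; rewrite ?h1].
  by apply/eqP => e1; rewrite -e1 ya eqxx in h3.
have [s2 [as2 s2K s2L ys2]] := pick (2 * K1) (mulr_gt0 (ltr0n R 2) K0).
have hs2 : a <= s2 <= L by rewrite ltW.
have [a1 [b1 [/andP[aa1 a1s] /andP[sb1 b1L] ya1 yb1 sy1]]] := zero_component cy hs2 ya yL ys2.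
have a10 : 0 <= a1 by lra.
have [sg bm] := elastica_border el a10 (lt_trans a1s sb1) b1L ya1 yb1 sy1.
(* Were a1 > a, a nonzero value of y between them would lie in a loop contained in [a, a1], an
   interval shorter than 2 K1. *)
have ea : a1 = a.
  apply/eqP; rewrite eq_le aa1 andbT leNgt; apply/negP => lt1.
  have [|s3 [as3 s3K s3L ys3]] := pick (a1 - a); first by rewrite subr_gt0.
  have hs3 : a <= s3 <= a1 by lra.
  have [a2 [b2 [/andP[aa2 a2s] /andP[sb2 b2L] ya2 yb2 sy2]]] := zero_component cy hs3 ya ya1 ys3.
  have a20 : 0 <= a2 by lra.
  have b2L' : b2 <= L by lra.
  have [sg' [bm1 _ _]] := elastica_border el a20 (lt_trans a2s sb2) b2L' ya2 yb2 sy2.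
  lra.
rewrite ea in bm.
exists (a - l, sg), b1; split; last by lra.
by apply: flat_extend => //; apply: (elastica_line el) => //; lra.
Qed.

(** Each step of the decomposition consumes at least 2 K1 of the length, so it stops; the strict
    inequality on x L rules out a decomposition without loops. *)
Lemma elastica_flat L th x y : 0 < L -> elastica p 1 L th x y -> x L ^+ 2 < L ^+ 2 ->
  exists (cs : seq (R * bool)) (lm : R),
    [/\ (0 < size cs)%N, forall d, d \in cs -> 0 <= d.1, 0 <= lm,
        pstart (concat (flat_pieces cs) (line_curve lm)) = 0 /\
        pstop (concat (flat_pieces cs) (line_curve lm)) = L &
        [/\ L = (\sum_(d <- cs) d.1) + lm + 2 * (size cs)%:R * K1,
        x L = - ((\sum_(d <- cs) d.1) + lm) - 2 * (size cs)%:R * K1 / (p - 1) &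
        forall s, 0 <= s <= L ->
          ptrace (concat (flat_pieces cs) (line_curve lm)) s = (x s, y s)]].
Proof.
move=> L0 el xL.
have [cth cx cy dth dx dy x0 y0 yL hq] := el.
have K0 := K1_gt0.
have [N hN] : exists N : nat, L < N%:R * (2 * K1).
  by exists (Num.trunc (L / (2 * K1))).+1; rewrite -ltr_pdivrMr ?mulr_gt0// truncnS_gt.
have fs0 : flat_state x y [::] 0.
  split => //; first by rewrite big_nil /= x0 mulr0 !mul0r oppr0 !addr0.
  by move=> s hs; have -> : s = 0 by [apply/eqP; rewrite eq_le andbC]; rewrite x0 y0.
have : forall k, (exists cs l, [/\ flat_state x y cs l, 0 <= l <= L & size cs = k]) \/
   exists cs l, [/\ flat_state x y cs l, 0 <= l <= L & forall s, l <= s <= L -> y s = 0].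
  elim=> [|k [[cs [l [fs hl sz]]]|IH]]; [|have [yz|[d [b [fs' hb]]]] := flat_step el fs hl|by right].
  - by left; exists [::], 0; rewrite lexx ltW.
  - by right; exists cs, l.
  - by left; exists (rcons cs d), b; rewrite size_rcons sz; split => //; lra.
(* N loops would already be longer than L. *)
move=> /(_ N) [[cs [l [[_ hd _ [lE _] _] hl sz]]]|[cs [l [fs hl yz]]]].
  exfalso; have : 0 <= \sum_(d <- cs) d.1 by rewrite big_seq; apply: sumr_ge0.
  rewrite sz in lE; move: hN; have -> : N%:R * (2 * K1) = 2 * N%:R * K1 by ring.
  lra.
have xz : forall s, l <= s <= L -> x s = x l - (s - l).
  by apply: (elastica_line el) => //; lra.
have [[st sp] hd yl [lE xl] tr] := fs.
have xLE : x L = x l - (L - l) by apply: xz; lra.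
exists cs, (L - l); split => //.
(* Without loops the curve is one segment and x L = - L, against the hypothesis. *)
- case: cs {fs st sp hd tr} lE xl => // lE xl; exfalso.
  move: lE xl xLE xL; rewrite big_nil /= => lE xl xLE; rewrite xLE xl lE.
  by rewrite (_ : - 0 - 2 * 0 * K1 / (p - 1) - (L - (0 + 2 * 0 * K1)) = - L) ?sqrrN ?ltxx//; ring.
- lra.
- by rewrite /concat; cbn [pstart pstop line_curve]; rewrite st sp; split => //; ring.
split; first by lra.
  by rewrite xLE xl; ring.
move=> s hs; rewrite /concat; cbn [ptrace pstart pstop line_curve]; rewrite st sp !subr0 !addr0.
case: ifPn => [sl|]; first by apply: tr; lra.
rewrite -ltNge => sl; rewrite tr; last by lra.
have xs : x s = x l - (s - l) by apply: xz; lra.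
have ys : y s = 0 by apply: yz; lra.
by rewrite xs ys yl; congr pair => /=; ring.
Qed.

End FlatCore.

(** * Sobolev calculus on the unit interval *)

Section UnitInterval.
Context {R : realType}.
Notation mu := (@lebesgue_measure R).
Notation int01 f := (\int[mu]_(t in `]0, 1[) (f t)).
Implicit Types (f g h : R -> R) (a b c M x y t : R).

Lemma oo01W t : 0 < t < 1 -> 0 <= t <= 1.
Proof. by move=> /andP[t0 t1]; rewrite !ltW. Qed.

Definition L01 f : Prop := mu.-integrable `]0, 1[ (EFin \o f).

Lemma L01_continuous f : continuous f -> L01 f.
Proof.
move=> cf; apply: (integrableS _ _ _ (continuous_loc_integrable cf 0 1)) => //.
exact: subset_itv_oo_cc.
Qed.

Lemma L01_measurable f : L01 f -> measurable_fun (`]0, 1[ : set R) f.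
Proof. by move=> /integrableP[/measurable_EFinP]. Qed.

Lemma L01D f g : L01 f -> L01 g -> L01 (fun t => f t + g t).
Proof. by move=> lf lg; exact: (integrableD _ lf lg). Qed.

Lemma L01N f : L01 f -> L01 (fun t => - f t).
Proof. by move=> lf; exact: (integrableN lf). Qed.

Lemma L01B f g : L01 f -> L01 g -> L01 (fun t => f t - g t).
Proof. by move=> lf lg; apply: L01D => //; apply: L01N. Qed.

Lemma L01Z f c : L01 f -> L01 (fun t => c * f t).
Proof. by move=> lf; exact: (integrableZl _ c lf). Qed.

Lemma L01_norm f : L01 f -> L01 (fun t => `|f t|).
Proof. by move=> lf; exact: (integrable_norm lf). Qed.

Lemma eq_L01 f g : (forall t, 0 < t < 1 -> f t = g t) -> L01 f -> L01 g.
Proof.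
move=> fg lf; apply: (eq_integrable _ _ _ _ lf) => // t.
by rewrite inE /= in_itv /= => ht; rewrite fg.
Qed.

Lemma L01_dom f g : measurable_fun (`]0, 1[ : set R) f -> L01 g ->
  (forall t, 0 < t < 1 -> `|f t| <= g t) -> L01 f.
Proof.
move=> mf lg fg; apply: (le_integrable _ _ _ lg) => //; first exact/measurable_EFinP.
move=> t /=; rewrite in_itv /= => /fg h; rewrite lee_fin (le_trans h)//.
exact: ler_norm.
Qed.

Lemma continuous_bounded01 f : continuous f ->
  exists2 M, 0 < M & forall t, 0 <= t <= 1 -> `|f t| <= M.
Proof.
move=> cf; have cn : continuous (fun t => `|f t|) by cont.
have [c _ hc] := EVT_max (@ler01 R) (continuous_subspaceT cn).
exists (`|f c| + 1); first by rewrite ltr_wpDl.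
move=> t ht; rewrite (le_trans (hc t _)) ?lerDl//.
Qed.

Lemma measurable01_continuous f : continuous f -> measurable_fun (`]0, 1[ : set R) f.
Proof. by move=> cf; apply: L01_measurable; apply: L01_continuous. Qed.

Lemma L01M f g : L01 f -> continuous g -> L01 (fun t => f t * g t).
Proof.
move=> lf cg; have [M M0 hM] := continuous_bounded01 cg.
apply: (@L01_dom _ (fun t => M * `|f t|)).
- by apply: measurable_funM; [exact: L01_measurable|exact: measurable01_continuous].
- by apply: L01Z; apply: L01_norm.
- move=> t ht; rewrite normrM mulrC ler_wpM2r// hM//; lra.
Qed.

Lemma L01Mr f g : continuous f -> L01 g -> L01 (fun t => f t * g t).
Proof.
by move=> cf lg; apply: (eq_L01 _ (L01M lg cf)) => t _; rewrite mulrC.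
Qed.

Lemma int01D f g : L01 f -> L01 g -> int01 (fun t => f t + g t) = int01 f + int01 g.
Proof. by move=> lf lg; rewrite -RintegralD. Qed.

Lemma int01B f g : L01 f -> L01 g -> int01 (fun t => f t - g t) = int01 f - int01 g.
Proof. by move=> lf lg; rewrite -RintegralB. Qed.

Lemma int01Z f c : L01 f -> int01 (fun t => c * f t) = c * int01 f.
Proof. by move=> lf; rewrite -RintegralZl. Qed.

Lemma int01N f : L01 f -> int01 (fun t => - f t) = - int01 f.
Proof.
move=> lf; rewrite -mulN1r -int01Z//; apply: eq_Rintegral => t _; ring.
Qed.

Lemma eq_int01 f g : (forall t, 0 < t < 1 -> f t = g t) -> int01 f = int01 g.
Proof. by move=> fg; apply: eq_Rintegral => t; rewrite inE /= in_itv /= => /fg. Qed.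

Lemma le_int01 f g : L01 f -> L01 g -> (forall t, 0 < t < 1 -> f t <= g t) ->
  int01 f <= int01 g.
Proof.
by move=> lf lg fg; apply: le_Rintegral => // t; rewrite /= in_itv /= => /fg.
Qed.

Lemma int01_cst c : int01 (fun=> c) = c.
Proof.
rewrite Rintegral_cst//.
have h : mu (`]0, 1[ : set R) = 1%:E.
  by have := @lebesgue_measure_itv R `]0, 1[; rewrite /= lte_fin ltr01 -EFinD subr0.
rewrite -[RHS]mulr1; congr (_ * _); exact: (congr1 fine h).
Qed.

Lemma norm_int01_le f M : L01 f -> (forall t, 0 < t < 1 -> `|f t| <= M) -> `|int01 f| <= M.
Proof.
move=> lf fM; rewrite (le_trans (le_normr_Rintegral _ lf))//.
rewrite -[leRHS]int01_cst; apply: le_int01 => //; first exact: L01_norm.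
by apply: L01_continuous; cont.
Qed.

Lemma int01_from0 f : loc_integrable f -> int01 f = integral_from0 f 1.
Proof. by move=> lf; rewrite Rintegral_oo_cc// /integral_from0 ler01. Qed.

Lemma int01_derivative f df : (forall t, is_derive t (1 : R) f (df t)) -> continuous df ->
  int01 df = f 1 - f 0.
Proof.
move=> fd cd; have ld := continuous_loc_integrable cd.
have cf := is_derive_continuous fd.
have cI := continuous_integral_from0 ld.
have cD : continuous (fun t => f t - integral_from0 df t) by cont.
have := @der0_constant _ (fun t => f t - integral_from0 df t) 0 1 ler01 (continuous_subspaceT cD).
move=> /(_ _)/wrap[t ht|/(_ 1)].
  apply: (is_derive_eq (derD (fd t) (derN (is_derive_integral_from0 ld (cd t))))); ring.
rewrite integral_from0_0 subr0 int01_from0// ler01 lexx => /(_ isT) <-; ring.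
Qed.

Lemma continuous_eq01 f g : continuous f -> continuous g ->
  (forall t, 0 < t < 1 -> f t = g t) -> forall t, 0 <= t <= 1 -> f t = g t.
Proof.
move=> cf cg fg t /andP[t0 t1]; apply/eqP; rewrite -subr_eq0; apply/negPn/negP => ft.
have cd : continuous (fun t => `|f t - g t|) by cont.
have := cd t; move=> /cvgr_gt /(_ 0); rewrite normr_gt0 => /(_ ft) [e /= e0 he].
pose s := Num.min 1 e.
have [s0 s1 se] : [/\ 0 < s, s <= 1 & s <= e] by rewrite /s lt_min ltr01 e0 !ge_min !lexx orbT.
(* A point moved from t towards the midpoint 1/2 by at most e/2, hence interior and inside the
   neighbourhood where f - g does not vanish. *)
have hz : 0 < t + s * (1 / 2 - t) < 1 by apply/andP; split; nra.
have := he (t + s * (1 / 2 - t)); rewrite /ball /= => /(_ _)/wrap[|].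
  rewrite (_ : t - _ = s * (t - 1 / 2)); last by ring.
  rewrite normrM (gtr0_norm s0).
  have : `|t - 1 / 2| <= 1 / 2 by rewrite ler_norml; lra.
  nra.
by rewrite fg// subrr normr0 ltxx.
Qed.

End UnitInterval.

(** * Weak derivatives and the fundamental theorem of calculus *)

Section WeakDerivatives.
Context {R : realType}.
Notation mu := (@lebesgue_measure R).
Notation int01 f := (\int[mu]_(t in `]0, 1[) (f t)).
Implicit Types (f g h u v phi psi : R -> R) (a b c M s t x y : R).

Definition primitive01 f : R -> R := integral_from0 (extend0 f).

Lemma ae_sub (P Q : R -> Prop) : (forall t, P t -> Q t) ->
  {ae mu, forall t, P t} -> {ae mu, forall t, Q t}.
Proof. by apply: filterS; exact: (ae_filter_ringOfSetsType mu). Qed.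

Lemma loc_integrable_extend0 f : L01 f -> loc_integrable (extend0 f).
Proof.
move=> lf a b.
have h : mu.-integrable setT (EFin \o extend0 f).
  have := (@integrable_mkcond _ _ _ mu (`]0, 1[%classic : set R) (EFin \o f) _).1 lf.
  by rewrite restrict_EFin; apply.
exact: (integrableS _ _ (@subsetT _ _) h).
Qed.

Lemma eq_ae_int01 f g : L01 f -> L01 g ->
  {ae mu, forall t, 0 < t < 1 -> f t = g t} -> int01 f = int01 g.
Proof.
move=> lf lg fg; rewrite /Rintegral; congr fine; apply: ae_eq_integral => //.
- by case/integrableP: lf.
- by case/integrableP: lg.
- by apply: ae_sub fg => t h /=; rewrite in_itv/= => /h ->.
Qed.

Lemma continuous_primitive01 f : L01 f -> continuous (primitive01 f).
Proof. by move=> lf; apply: continuous_integral_from0; exact: loc_integrable_extend0. Qed.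

Lemma primitive01_0 f : primitive01 f 0 = 0.
Proof. exact: integral_from0_0. Qed.

Definition cut01 s t f : R -> R := fun x => if s < x <= t then f x else 0.

Lemma int01_cut s t f : L01 f -> 0 <= s -> s <= t -> t <= 1 ->
  int01 (cut01 s t f) = primitive01 f t - primitive01 f s.
Proof.
move=> lf s0 st t1; have le := loc_integrable_extend0 lf.
rewrite /primitive01 integral_from0B// -Rintegral_itv_obnd_cbnd; last first.
  by apply: (integrableS _ _ _ (le s t)) => //; apply: subset_itvr; rewrite bnd_simp.
rewrite Rintegral_mkcond [RHS]Rintegral_mkcond; apply: eq_Rintegral => x _.
rewrite /extend0 !patchE /cut01 !mem_setE !in_itv /=.
by case: ifP => h1; case: ifP => h2 //; case: ifP => h3 //; move: h1 h2 h3; lra.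
Qed.

Lemma dominated_int01 (fn : nat -> R -> R) f g :
  (forall n, measurable_fun (`]0, 1[ : set R) (fn n)) -> L01 g ->
  (forall t, 0 < t < 1 -> fn n t @[n --> \oo] --> f t) ->
  (forall n t, 0 < t < 1 -> `|fn n t| <= g t) ->
  L01 f /\ int01 (fn n) @[n --> \oo] --> int01 f.
Proof.
move=> mf lg cf fg.
have mlim : measurable_fun (`]0, 1[ : set R) f.
  by apply: (measurable_fun_cvg mf) => x /=; rewrite in_itv; exact: cf.
have cfE : {ae mu, forall x, (`]0, 1[%classic : set R) x -> (EFin \o fn n) x @[n --> \oo] --> (EFin \o f) x}.
  apply: aeW => x /=; rewrite in_itv => hx; apply: cvg_EFin; last exact: cf.
  by apply: nearW.
have fgE : {ae mu, forall x n, (`]0, 1[%classic : set R) x -> (`|(EFin \o fn n) x| <= (EFin \o g) x)%E}.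
  apply: aeW => x n /=; rewrite in_itv => hx; rewrite lee_fin; exact: fg.
have mfE n : measurable_fun (`]0, 1[%classic : set R) (EFin \o fn n) by apply/measurable_EFinP.
have mE : measurable_fun (`]0, 1[%classic : set R) (EFin \o f) by apply/measurable_EFinP.
have [l _ c] := @dominated_convergence _ _ _ mu _ (measurable_itv _) _ _ _ mfE mE cfE lg fgE.
split => //; apply: fine_cvg; rewrite /Rintegral fineK //.
exact: integrable_fin_num.
Qed.

(** Equal to 6 x (1 - x) on [0, 1] and 0 elsewhere, written with an absolute value so that
    continuity is syntactic; the factor 3 gives it mass one. Its primitive is the C^1 step 3 x^2 - 2
    x^3. *)
Definition hump x : R := 3 * (x * (1 - x) + `|x * (1 - x)|).
Definition smoothstep : R -> R := integral_from0 hump.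

Lemma continuous_hump : continuous hump.
Proof. by rewrite /hump; cont. Qed.

Lemma hump_ge0 x : 0 <= hump x.
Proof. by rewrite /hump; have := ler_norm (- (x * (1 - x))); rewrite normrN; lra. Qed.

Lemma hump_in x : 0 <= x <= 1 -> hump x = 6 * x - 6 * x ^+ 2.
Proof. by move=> hx; rewrite /hump ger0_norm; [ring|nra]. Qed.

Lemma hump_out x : x <= 0 \/ 1 <= x -> hump x = 0.
Proof. by move=> hx; rewrite /hump ler0_norm; [ring|case: hx => hx; nra]. Qed.

Lemma is_derive_smoothstep x : is_derive x (1 : R) smoothstep (hump x).
Proof.
have cb := continuous_hump.
by apply: is_derive_integral_from0; [exact: continuous_loc_integrable|exact: cb].
Qed.

Lemma continuous_smoothstep : continuous smoothstep.
Proof. exact: is_derive_continuous is_derive_smoothstep. Qed.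

Lemma smoothstep0 : smoothstep 0 = 0.
Proof. exact: integral_from0_0. Qed.

Lemma smoothstep_le0 x : x <= 0 -> smoothstep x = 0.
Proof.
move=> x0; have c := continuous_subspaceT continuous_smoothstep.
rewrite -smoothstep0; symmetry; apply: (der0_constant x0 (c _)); last by rewrite x0 lexx.
by move=> t ht; apply: (is_derive_eq (is_derive_smoothstep t)); apply: hump_out; left; lra.
Qed.

Lemma smoothstep_in x : 0 <= x <= 1 -> smoothstep x = 3 * x ^+ 2 - 2 * x ^+ 3.
Proof.
move=> hx; have c := continuous_smoothstep.
have cD : continuous (fun x => smoothstep x - (3 * x ^+ 2 - 2 * x ^+ 3)) by cont.
have := der0_constant ler01 (continuous_subspaceT cD).
move=> /(_ _)/wrap[t ht|/(_ x hx)].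
  have dp : is_derive t (1 : R) (fun x => 3 * x ^+ 2 - 2 * x ^+ 3) (6 * t - 6 * t ^+ 2).
    have d2 : is_derive t (1 : R) (fun x => x ^+ 2) (2%:R * t ^+ 2.-1 * 1) by apply: derX; apply: derI.
    have d3 : is_derive t (1 : R) (fun x => x ^+ 3) (3%:R * t ^+ 3.-1 * 1) by apply: derX; apply: derI.
    apply: (is_derive_eq (derD (derM (derC 3 t) d2) (derN (derM (derC 2 t) d3)))).
    by rewrite /= expr1; ring.
  apply: (is_derive_eq (derD (is_derive_smoothstep t) (derN dp))).
  by rewrite hump_in; [ring|lra].
rewrite smoothstep0 => h; move: h; rewrite expr0n /= expr0n /= !mulr0; lra.
Qed.

Lemma smoothstep_ge1 x : 1 <= x -> smoothstep x = 1.
Proof.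
move=> x1; have c := continuous_subspaceT continuous_smoothstep.
have <- : smoothstep 1 = 1 by rewrite smoothstep_in ?lexx ?ler01// !expr1n; ring.
apply: (der0_constant x1 (c _)); last by rewrite x1 lexx.
by move=> t ht; apply: (is_derive_eq (is_derive_smoothstep t)); apply: hump_out; right; lra.
Qed.

Lemma smoothstep_01 x : 0 <= smoothstep x <= 1.
Proof.
have [x0|x0] := leP x 0; first by rewrite smoothstep_le0// lexx ler01.
have [x1|x1] := leP 1 x; first by rewrite smoothstep_ge1// lexx ler01.
rewrite smoothstep_in; last by lra.
have -> : 3 * x ^+ 2 - 2 * x ^+ 3 = x ^+ 2 * (3 - 2 * x) by ring.
have h : 1 - x ^+ 2 * (3 - 2 * x) = (1 - x) ^+ 2 * (1 + 2 * x) by ring.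
apply/andP; split; first by rewrite mulr_ge0 ?sqr_ge0//; lra.
by rewrite -subr_ge0 h mulr_ge0 ?sqr_ge0//; lra.
Qed.

Definition ramp (n : nat) s x : R := smoothstep (n%:R * (x - s)).
(** Converges pointwise to the indicator of ]s, t], the reason for the half-open interval in
    [cut01]; its derivative is a difference of two approximate identities. *)
Definition window n s t x : R := ramp n s x - ramp n t x.

Lemma is_derive_ramp n s x :
  is_derive x (1 : R) (ramp n s) (n%:R * hump (n%:R * (x - s))).
Proof.
have d : is_derive x (1 : R) (fun x => n%:R * (x - s)) n%:R.
  apply: (is_derive_eq (derM (derC n%:R x) (derD (derI x) (derN (derC s x))))); ring.
by apply: (is_derive_eq (der_comp (is_derive_smoothstep _) d)); rewrite mulrC.
Qed.

Lemma continuous_ramp n s : continuous (ramp n s).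
Proof. exact: is_derive_continuous (is_derive_ramp n s). Qed.

Lemma continuous_window n s t : continuous (window n s t).
Proof.
have c1 := @continuous_ramp n s; have c2 := @continuous_ramp n t.
by rewrite /window; cont.
Qed.

Lemma norm_window n s t x : `|window n s t x| <= 1.
Proof.
rewrite /window /ramp; have := smoothstep_01 (n%:R * (x - s)).
have := smoothstep_01 (n%:R * (x - t)); rewrite ler_norml; lra.
Qed.

Lemma ramp_cvg s x : ramp n s x @[n --> \oo] --> ((s < x)%R%:R : R).
Proof.
apply: cvg_near_cst; have [xs|sx] := leP x s.
  by apply: nearW => n; rewrite /ramp smoothstep_le0// mulr_ge0_le0// subr_le0.
near=> n; rewrite /ramp smoothstep_ge1//.
rewrite -ler_pdivrMr ?subr_gt0//; near: n; exact: nbhs_infty_ger.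
Unshelve. all: by end_near. Qed.

Lemma window_cvg s t x : s <= t -> window n s t x @[n --> \oo] --> ((s < x <= t)%R%:R : R).
Proof.
move=> st; have h := @cvgB _ _ _ _ _ _ _ _ _ (@ramp_cvg s x) (@ramp_cvg t x).
suff : ((s < x <= t)%R%:R : R) = (s < x)%R%:R - (t < x)%R%:R by move=> ->; exact: h.
have [xt|tx] := leP x t; first by rewrite andbT subr0.
by rewrite (le_lt_trans st tx) /= subrr.
Qed.

Lemma int01_window f s t : L01 f -> 0 <= s -> s <= t -> t <= 1 ->
  int01 (fun x => f x * window n s t x) @[n --> \oo] --> primitive01 f t - primitive01 f s.
Proof.
move=> lf s0 st t1; rewrite -int01_cut//.
have /(_ _ _ _ _)/wrap[||||[_ h]] := @dominated_int01 (fun n x => f x * window n s t x) (cut01 s t f) (fun x => `|f x|); last exact: h.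
- move=> n; apply: measurable_funM; first exact: L01_measurable.
  by apply: measurable01_continuous; exact: continuous_window.
- exact: L01_norm.
- move=> x _; have -> : cut01 s t f x = f x * (s < x <= t)%R%:R.
    by rewrite /cut01; case: ifP => _; rewrite ?mulr1 ?mulr0.
  by apply: cvgM; [exact: cvg_cst|exact: window_cvg].
- move=> n x _; rewrite normrM ler_piMr//; exact: norm_window.
Qed.

(* n * hump (n * (x - s)) is an approximate identity at s. *)
Lemma int01_ramp_derivative f s : continuous f -> 0 < s < 1 ->
  int01 (fun x => f x * (n%:R * hump (n%:R * (x - s)))) @[n --> \oo] --> f s.
Proof.
move=> cf hs; apply/cvgrPdist_le => e e0.
have /cvgrPdist_le /(_ e e0) [d /= d0 hd] := cf s.
near=> n.
have n0 : 0 < n%:R :> R by rewrite ltr0n; near: n; exact: nbhs_infty_gt.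
have nd : 1 < n%:R * d.
  by rewrite -ltr_pdivrMr//; near: n; exact: nbhs_infty_gtr.
(* The kernel lives on [s, s + 1/n]; this inequality keeps it inside the unit interval, so that its
   integral is exactly 1. *)
have n1 : 1 <= n%:R * (1 - s).
  by rewrite -ler_pdivrMr; [near: n; exact: nbhs_infty_ger|lra].
pose k x := n%:R * hump (n%:R * (x - s)).
have k0 x : 0 <= k x by rewrite mulr_ge0 ?hump_ge0 ?ler0n.
have ck : continuous k.
  have cb := continuous_hump.
  by rewrite /k; apply: contM; [cont|apply: (@cont_comp _ hump) => //; cont].
have Ik : int01 k = 1.
  rewrite (int01_derivative (is_derive_ramp n s) ck) /ramp smoothstep_ge1// smoothstep_le0 ?subr0//.
  by rewrite sub0r mulrN oppr_le0 mulr_ge0//; lra.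
have -> : f s - int01 (fun x => f x * k x) = int01 (fun x => (f s - f x) * k x).
  have {1}-> : f s = int01 (fun x => f s * k x) by rewrite int01Z ?Ik ?mulr1//; exact: L01_continuous.
  rewrite -int01B; [|by apply: L01_continuous; cont|by apply: L01_continuous; cont].
  by apply: eq_int01 => x _; ring.
have le1 : L01 (fun x => `|(f s - f x) * k x|) by apply: L01_continuous; cont.
rewrite (le_trans (le_normr_Rintegral _ _))//; first by apply: L01_continuous; cont.
rewrite [leRHS](_ : e = int01 (fun x => e * k x)); last first.
  by rewrite int01Z ?Ik ?mulr1//; exact: L01_continuous.
apply: le_int01 => //; first by apply: L01_continuous; cont.
move=> x _; rewrite normrM (ger0_norm (k0 x)).
have [xs|xs] := leP (n%:R * (x - s)) 0; first by rewrite /k hump_out ?mulr0//; left.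
have [xs1|xs1] := leP 1 (n%:R * (x - s)); first by rewrite /k hump_out ?mulr0//; right.
apply: ler_wpM2r => //; apply: hd; rewrite /ball /=.
have : 0 < x - s by rewrite -(pmulr_rgt0 _ n0).
rewrite distrC ltr_norml => xs0; rewrite (lt_trans _ xs0) ?oppr_lt0//=.
by rewrite -(ltr_pM2l n0) (lt_trans xs1).
Unshelve. all: by end_near. Qed.

Lemma test_function_window n s t : 0 < s -> s <= t -> t + n.+1%:R^-1 < 1 ->
  test_function (window n.+1 s t).
Proof.
move=> s0 st t1.
have d x : is_derive x (1 : R) (window n.+1 s t)
    (n.+1%:R * hump (n.+1%:R * (x - s)) - n.+1%:R * hump (n.+1%:R * (x - t))).
  exact: derD (is_derive_ramp _ _ _) (derN (is_derive_ramp _ _ _)).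
split; first by move=> x; exact: ex_derive.
  have -> : derive1 (window n.+1 s t) = fun x => n.+1%:R * hump (n.+1%:R * (x - s)) - n.+1%:R * hump (n.+1%:R * (x - t)).
    by apply/funext => x; rewrite derive1E; exact: derive_val.
  have cb := continuous_hump.
  have c1 a : continuous (fun x => n.+1%:R * hump (n.+1%:R * (x - a))).
    by apply: contM; [cont|apply: (@cont_comp _ hump) => //; cont].
  have c2 := c1 s; have c3 := c1 t; by cont.
have n0 : 0 < n.+1%:R :> R by rewrite ltr0n.
exists s, (t + n.+1%:R^-1); split => // x hx.
have [xs|sx] := leP x s.
  rewrite /window /ramp !smoothstep_le0 ?subrr//; rewrite mulr_ge0_le0// subr_le0//.
  exact: le_trans st.
have [xt|xt] := leP x (t + n.+1%:R^-1); first by exfalso; apply: hx; rewrite (ltW sx).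
have h a : a <= t -> 1 <= n.+1%:R * (x - a).
  move=> hat; have : n.+1%:R * n.+1%:R^-1 = 1 :> R by rewrite mulfV ?lt0r_neq0.
  have : n.+1%:R^-1 <= x - a.
    by rewrite lerBrDl (le_trans _ (ltW xt))// lerD2r.
  by move=> h1 h2; rewrite -(ler_pM2l n0) h2 in h1.
by rewrite /window /ramp !smoothstep_ge1 ?subrr// h.
Qed.

(** Testing with windows: the derivative side tends to u t - u s because windows differentiate to
    approximate identities, the other side to the increment of the primitive. Endpoints follow by
    continuity. *)
Lemma weak_derivative_FTC u v : continuous u -> L01 v -> weak_derivative u v ->
  forall t, 0 <= t <= 1 -> u t = u 0 + primitive01 v t.
Proof.
move=> cu lv w.
have cv := continuous_primitive01 lv.
have step s t : 0 < s -> s <= t -> t < 1 -> u t - u s = primitive01 v t - primitive01 v s.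
  move=> s0 st t1.
  have c1 := int01_window lv (ltW s0) st (ltW t1).
  have hs : 0 < s < 1 by lra.
  have ht : 0 < t < 1 by lra.
  have c2 := @cvgB _ _ _ _ _ _ _ _ _ (int01_ramp_derivative cu ht) (int01_ramp_derivative cu hs).
  apply: (cvg_unique _ (c2 _)) => //; apply: cvg_trans c1; apply: near_eq_cvg.
  near=> n.
  have [m nm] : exists m, n = m.+1.
    by exists n.-1; rewrite prednK//; near: n; exact: nbhs_infty_gt.
  have n0 : 0 < n%:R :> R by rewrite nm ltr0n.
  have tn : t + n%:R^-1 < 1.
    rewrite -ltrBrDl -div1r ltr_pdivrMr// -ltr_pdivrMl ?subr_gt0//.
    rewrite mulr1; near: n; exact: nbhs_infty_gtr.
  have tf : test_function (window n s t) by rewrite nm in tn *; exact: test_function_window.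
  have cb := continuous_hump.
  have c3 a : continuous (fun x => u x * (n%:R * hump (n%:R * (x - a)))).
    apply: contM => //; apply: contM; first by cont.
    by apply: (@cont_comp _ hump) => //; cont.
  rewrite /= -[LHS]opprK -(w _ tf) -opprB; congr (- _).
  rewrite !fctE -int01B; [|exact: L01_continuous|exact: L01_continuous].
  apply: eq_int01 => x _; rewrite derive1E.
  have d : is_derive x (1 : R) (window n s t)
     (n%:R * hump (n%:R * (x - s)) - n%:R * hump (n%:R * (x - t))).
    exact: derD (is_derive_ramp _ _ _) (derN (is_derive_ramp _ _ _)).
  by rewrite (@derive_val _ _ _ _ _ _ _ d); ring.
have cD : continuous (fun t => u t - primitive01 v t) by cont.
have h : forall t, 0 <= t <= 1 -> u t - primitive01 v t = u (1/2) - primitive01 v (1/2).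
  apply: (continuous_eq01 cD); first by cont.
  move=> t /andP[t0 t1]; have [ht|ht] := leP t (1/2).
    have := step t (1/2) t0 ht; lra.
  have := step (1/2) t; lra.
move=> t ht; have := h t ht; have := h 0; rewrite primitive01_0; lra.
Unshelve. all: by end_near. Qed.

(** Lebesgue differentiation: almost everywhere f is the derivative of its primitive. *)
Lemma primitive01_0_ae f : L01 f -> (forall t, 0 <= t <= 1 -> primitive01 f t = 0) ->
  {ae mu, forall t, 0 < t < 1 -> f t = 0}.
Proof.
move=> lf hF; have le := loc_integrable_extend0 lf.
have loc : locally_integrable setT (extend0 f) by exact: integrable_locally_restrict.
have := @FTC1 _ (extend0 f) (BLeft 0) (le 0) loc; apply: ae_sub => t /= h ht.
have [d <-] : derivable (fun x => \int[mu]_(t in `[0, x]) extend0 f t) t 1 /\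
    derive1 (fun x => \int[mu]_(t in `[0, x]) extend0 f t) t = f t.
  have [|d e] := h; first by rewrite lte_fin; case/andP: ht.
  by split => //; rewrite e /extend0 patchE mem_set//= in_itv.
have dz : is_derive t (1 : R) (fun x => \int[mu]_(t in `[0, x]) extend0 f t) 0.
  apply: (der_eq_oo ht _ (derC 0 t)) => x hx.
  by have := hF x; rewrite /primitive01 /integral_from0; case: ifP => [_ -> //|]; lra.
by rewrite derive1E derive_val.
Qed.

(** Test functions need not vanish at the ends. Constants give the mean zero of g, and the usual
    free constant disappears: h equals the primitive of g that starts at 0. *)
Lemma du_bois_reymond h g : L01 h -> continuous g ->
  (forall phi dphi, (forall t, is_derive t (1 : R) phi (dphi t)) -> continuous dphi ->
     int01 (fun t => h t * dphi t) + int01 (fun t => g t * phi t) = 0) ->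
  int01 g = 0 /\ {ae mu, forall t, 0 < t < 1 -> h t = integral_from0 g t}.
Proof.
move=> lh cg H.
have g0 : int01 g = 0.
  have := H (fun=> 1) (fun=> 0) (fun t => derC 1 t) (@contC _ 0).
  rewrite (_ : int01 (fun t => h t * 0) = 0) ?add0r; last first.
    by rewrite -[RHS](@int01_cst R 0); apply: eq_int01 => t _; rewrite mulr0.
  by move=> h0; rewrite -[RHS]h0; apply: eq_int01 => t _; rewrite mulr1.
split => //.
have lg := continuous_loc_integrable cg.
pose G := integral_from0 g.
have dG t : is_derive t (1 : R) G (g t) by apply: is_derive_integral_from0 => //; exact: cg.
have cG : continuous G := is_derive_continuous dG.
have lhG : L01 (fun t => h t - G t) by apply: L01B => //; exact: L01_continuous.
(* Integrating (G phi)' with phi the primitive of psi leaves no boundary term, since G vanishes at 0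
   and, by the mean zero of g, at 1. *)
have key psi : continuous psi -> int01 (fun t => (h t - G t) * psi t) = 0.
  move=> cp; pose phi := integral_from0 psi.
  have lp := continuous_loc_integrable cp.
  have dp t : is_derive t (1 : R) phi (psi t) by apply: is_derive_integral_from0 => //; exact: cp.
  have cphi := is_derive_continuous dp.
  have := H phi psi dp cp.
  have cgp : continuous (fun t => g t * phi t + G t * psi t) by cont.
  have := int01_derivative (fun t => derM (dG t) (dp t)) cgp.
  rewrite /= /G -int01_from0// g0 integral_from0_0 !mul0r subr0 -/G.
  rewrite int01D; [|by apply: L01_continuous; cont|by apply: L01_continuous; cont].
  have -> : int01 (fun t => (h t - G t) * psi t) = int01 (fun t => h t * psi t) - int01 (fun t => G t * psi t).
    rewrite -int01B; [|exact: L01M|by apply: L01_continuous; cont].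
    by apply: eq_int01 => t _; rewrite mulrBl.
  lra.
have hF t : 0 <= t <= 1 -> primitive01 (fun t => h t - G t) t = 0.
  move=> /andP[t0 t1]; have := int01_window lhG (lexx 0) t0 t1.
  rewrite primitive01_0 subr0 => c.
  have z : int01 (fun x => (h x - G x) * window n 0 t x) @[n --> \oo] --> (0 : R).
    by apply: cvg_near_cst; apply: nearW => n; apply: key; exact: continuous_window.
  exact: (cvg_unique _ c z).
by apply: ae_sub (primitive01_0_ae lhG hF) => t ht h1; apply/eqP; rewrite -subr_eq0; apply/eqP; exact: ht.
Qed.

End WeakDerivatives.

(** * The space L^p on the unit interval *)

Section LebesgueSpace01.
Context {R : realType}.
Variable p : R.
Hypothesis hp : 1 < p.
Notation mu := (@lebesgue_measure R).
Notation int01 f := (\int[mu]_(t in `]0, 1[) (f t)).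
Implicit Types (f g h u v phi psi : R -> R) (a b c M s t x y : R).

Let p0 : 0 < p. Proof. by have := hp; lra. Qed.

Lemma powR_extend0 f : (fun x => `|extend0 f x| `^ p) = (fun x => `|f x| `^ p) \_ `]0, 1[.
Proof.
apply/funext => x; rewrite /extend0 !patchE; case: ifP => // _.
by rewrite normr0 powR0// gt_eqF.
Qed.

Lemma measurable_powR_norm f (D : set R) : measurable_fun D f ->
  measurable_fun D (fun x => `|f x| `^ p).
Proof.
move=> mf; apply: (measurableT_comp (measurable_powR p)).
by apply: (measurableT_comp (@normr_measurable R setT)).
Qed.

Lemma Lp01P f : Lp01 p f <->
  measurable_fun (`]0, 1[ : set R) f /\ L01 (fun x => `|f x| `^ p).
Proof.
split=> [lf|[mf lf]].
  split.
    apply/(measurable_restrictT f) => //.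
    by move: lf; rewrite /Lp01 inE => /andP[/[!inE]].
  have := Lfun_integrable (ltW hp) lf; rewrite -/(EFin \o (fun x => `|extend0 f x| `^ p)) powR_extend0 => h.
  have := (@integrable_mkcond _ _ _ mu (`]0, 1[%classic : set R) (EFin \o (fun x => `|f x| `^ p)) (measurable_itv _)).2.
  by rewrite restrict_EFin; apply.
rewrite /Lp01 inE; apply/andP; split; rewrite inE/=.
  by apply/(measurable_restrictT f).
rewrite /finite_norm unlock poweR_lty//=.
have h : mu.-integrable setT (EFin \o (fun x => `|extend0 f x| `^ p)).
  rewrite powR_extend0 -restrict_EFin.
  exact: (@integrable_mkcond _ _ _ mu (`]0, 1[%classic : set R) (EFin \o (fun x => `|f x| `^ p)) (measurable_itv _)).1.
exact: integrable_lty h.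
Qed.

Lemma Lpnorm01E f : Lp01 p f -> Lpnorm01 p f = (int01 (fun x => `|f x| `^ p) `^ p^-1)%:E.
Proof.
move=> /Lp01P[mf lf]; rewrite /Lpnorm01 unlock.
have -> : (\int[mu]_x ((`|(EFin \o extend0 f) x| `^ p)%E))%E = (int01 (fun x => `|f x| `^ p))%:E.
  rewrite /Rintegral fineK; last exact: integrable_fin_num.
  rewrite [RHS]integral_mkcond; apply: eq_integral => x _.
  rewrite -/(EFin \o (fun x => `|f x| `^ p)) restrict_EFin -powR_extend0.
  by [].
by rewrite poweR_EFin.
Qed.

Lemma Lp01_L01 f : Lp01 p f -> L01 f.
Proof.
move=> /Lp01P[mf lf]; apply: (L01_dom mf (L01D (L01_continuous (@contC _ 1)) lf)).
move=> t _; have [h|h] := leP `|f t| 1; first by rewrite (le_trans h)// lerDl powR_ge0.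
rewrite -[leLHS](powRr1 (normr_ge0 _)) (@le_trans _ _ (`|f t| `^ p))// ?lerDr//.
by apply: ler_powR; exact: ltW.
Qed.

Lemma Lp01D f g : Lp01 p f -> Lp01 p g -> Lp01 p (fun t => f t + g t).
Proof.
move=> lf lg; rewrite /Lp01.
have -> : extend0 (fun t => f t + g t) = extend0 f + extend0 g.
  apply/funext => x; rewrite /extend0 patchE /GRing.add /= !patchE.
  by case: ifP => //; rewrite add0r.
have p1 : (1 <= p%:E)%E by rewrite lee_fin ltW.
by have [_ h] := Lfun_addr_closed mu p1; exact: h.
Qed.

Lemma Lp01_dom f g c : measurable_fun (`]0, 1[ : set R) f -> Lp01 p g -> 0 <= c ->
  (forall t, 0 < t < 1 -> `|f t| <= c * `|g t|) ->
  Lp01 p f /\ (Lpnorm01 p f <= (c * (int01 (fun x => `|g x| `^ p) `^ p^-1))%:E)%E.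
Proof.
move=> mf lg c0 fg; have [mg lgp] := (Lp01P g).1 lg.
have b t : 0 < t < 1 -> `|f t| `^ p <= c `^ p * `|g t| `^ p.
  move=> ht; rewrite -powRM//; apply: ge0_ler_powR; rewrite ?nnegrE ?mulr_ge0//; first exact: ltW.
  exact: fg.
have lf : Lp01 p f.
  apply/Lp01P; split => //; apply: (L01_dom (measurable_powR_norm mf) (L01Z (c `^ p) lgp)).
  by move=> t ht; rewrite ger0_norm ?powR_ge0//; exact: b.
split => //; rewrite Lpnorm01E// lee_fin.
have [_ lfp] := (Lp01P f).1 lf.
have I0 : 0 <= int01 (fun x => `|g x| `^ p) by apply: Rintegral_ge0 => x _; rewrite powR_ge0.
have -> : c * int01 (fun x => `|g x| `^ p) `^ p^-1 = (c `^ p * int01 (fun x => `|g x| `^ p)) `^ p^-1.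
  by rewrite powRM ?powR_ge0// -powRrM mulfV ?gt_eqF// powRr1.
apply: ge0_ler_powR; rewrite ?nnegrE.
- by rewrite invr_ge0 ltW.
- by apply: Rintegral_ge0 => x _; rewrite powR_ge0.
- by rewrite mulr_ge0 ?powR_ge0.
by rewrite -int01Z//; apply: le_int01 => //; exact: L01Z.
Qed.

Lemma Lp01M f g : Lp01 p f -> continuous g -> Lp01 p (fun t => g t * f t).
Proof.
move=> lf cg; have [M M0 hM] := continuous_bounded01 cg.
have [mf _] := (Lp01P f).1 lf.
have [] := @Lp01_dom (fun t => g t * f t) f M _ lf (ltW M0) _ => //.
- by apply: measurable_funM => //; exact: measurable01_continuous.
- by move=> t ht; rewrite normrM ler_wpM2r// hM//; lra.
Qed.

Lemma Lp01_continuous f : continuous f -> Lp01 p f.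
Proof.
move=> cf; apply/Lp01P; split; first exact: measurable01_continuous.
apply: L01_continuous; apply: (@cont_comp _ (fun x => `|x| `^ p)) => //.
exact: continuous_powR_nonneg.
Qed.

Lemma Lp01N f : Lp01 p f -> Lp01 p (fun t => - f t).
Proof.
move=> lf; have := Lp01M lf (@contC R (-1)); congr Lp01; apply/funext => x; ring.
Qed.

Lemma Lp01B f g : Lp01 p f -> Lp01 p g -> Lp01 p (fun t => f t - g t).
Proof. by move=> lf lg; apply: Lp01D => //; exact: Lp01N. Qed.

Lemma eq_Lp01 f g : (forall t, 0 < t < 1 -> f t = g t) -> Lp01 p f -> Lp01 p g.
Proof.
move=> fg; rewrite /Lp01; have -> : extend0 f = extend0 g => //.
apply/funext => x; rewrite /extend0 !patchE.
by case: ifPn => //; rewrite inE/= in_itv/= => /fg.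
Qed.

End LebesgueSpace01.

Section WeakCalculus.
Context {R : realType}.
Notation mu := (@lebesgue_measure R).
Notation int01 f := (\int[mu]_(t in `]0, 1[) (f t)).
Implicit Types (f g h u v phi psi : R -> R) (a b c M s t x y : R).

Lemma test_function_continuous phi : test_function phi -> continuous phi.
Proof.
by move=> [d _ _] x; apply: differentiable_continuous; apply/derivable1_diffP.
Qed.

Lemma test_function_derive phi x : test_function phi -> is_derive x (1 : R) phi (derive1 phi x).
Proof. by move=> [d _ _]; rewrite derive1E; apply/derivableP. Qed.

Lemma eq_weak_derivative u v f g : (forall t, 0 < t < 1 -> u t = f t) ->
  (forall t, 0 < t < 1 -> v t = g t) -> weak_derivative u v -> weak_derivative f g.
Proof.
move=> uf vg w phi tp; have := w phi tp.
rewrite (@eq_int01 _ (fun x => u x * _) (fun x => f x * derive1 phi x)); last by move=> t ht; rewrite uf.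
by rewrite (@eq_int01 _ (fun x => v x * _) (fun x => g x * phi x))// => t ht; rewrite vg.
Qed.

Lemma weak_derivativeD u v f g : continuous u -> L01 v -> continuous f -> L01 g ->
  weak_derivative u v -> weak_derivative f g ->
  weak_derivative (fun t => u t + f t) (fun t => v t + g t).
Proof.
move=> cu lv cf lg wu wf phi tp.
have cp := test_function_continuous tp; have [_ cdp _] := tp.
have E1 : int01 (fun x => (u x + f x) * derive1 phi x) =
    int01 (fun x => u x * derive1 phi x) + int01 (fun x => f x * derive1 phi x).
  rewrite -int01D; [|by apply: L01_continuous; cont|by apply: L01_continuous; cont].
  by apply: eq_int01 => x _; rewrite mulrDl.
have E2 : int01 (fun x => (v x + g x) * phi x) =
    int01 (fun x => v x * phi x) + int01 (fun x => g x * phi x).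
  rewrite -int01D; [|exact: L01M|exact: L01M].
  by apply: eq_int01 => x _; rewrite mulrDl.
by rewrite E1 E2 wu// wf// opprD.
Qed.

(** The product of c with a test function is again a test function, so the rule is the definition
    applied to c phi. *)
Lemma weak_derivative_mul u v (c dc : R -> R) : continuous u -> L01 v ->
  (forall t, is_derive t (1 : R) c (dc t)) -> continuous dc ->
  weak_derivative u v ->
  weak_derivative (fun t => c t * u t) (fun t => dc t * u t + c t * v t).
Proof.
move=> cu lv dcc cdc w phi tp.
have cp := test_function_continuous tp; have [_ cdp [a [b [a0 b1 supp]]]] := tp.
have cc := is_derive_continuous dcc.
have dphi x := test_function_derive x tp.
pose psi x := c x * phi x.
have dpsi x : is_derive x (1 : R) psi (dc x * phi x + c x * derive1 phi x).
  exact: derM (dcc x) (dphi x).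
have dE : derive1 psi = fun x => dc x * phi x + c x * derive1 phi x.
  by apply/funext => x; rewrite derive1E; exact: derive_val.
have tpsi : test_function psi.
  split; [by move=> x; exact: ex_derive|by rewrite dE; cont|].
  by exists a, b; split => // x hx; rewrite /psi supp// mulr0.
have := w psi tpsi; rewrite dE.
have cpsi : continuous psi by rewrite /psi; cont.
have -> : int01 (fun x => u x * (dc x * phi x + c x * derive1 phi x)) =
   int01 (fun x => dc x * u x * phi x) + int01 (fun x => c x * u x * derive1 phi x).
  rewrite -int01D; [|by apply: L01_continuous; cont|by apply: L01_continuous; cont].
  by apply: eq_int01 => x _; ring.
have -> : int01 (fun x => (dc x * u x + c x * v x) * phi x) =
   int01 (fun x => dc x * u x * phi x) + int01 (fun x => v x * psi x).
  rewrite -int01D; [|by apply: L01_continuous; cont|exact: L01M].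
  by apply: eq_int01 => x _; rewrite /psi; ring.
lra.
Qed.

Lemma weak_derivative_primitive f a : continuous f ->
  weak_derivative (fun t => a + integral_from0 f t) f.
Proof.
move=> cf phi tp.
have cp := test_function_continuous tp; have [_ cdp [l [r [l0 r1 supp]]]] := tp.
have dF t : is_derive t (1 : R) (fun t => a + integral_from0 f t) (f t).
  have d : is_derive t (1 : R) (integral_from0 f) (f t).
    by apply: is_derive_integral_from0; [exact: continuous_loc_integrable|exact: cf].
  by apply: (is_derive_eq (derD (derC a t) d)); rewrite add0r.
have cF := is_derive_continuous dF.
have cI : continuous (fun t => f t * phi t + (a + integral_from0 f t) * derive1 phi t) by cont.
have := int01_derivative (fun t => derM (dF t) (test_function_derive t tp)) cI.
rewrite (supp 1) ?(supp 0); [|lra|lra].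
rewrite !mulr0 subrr int01D; [|by apply: L01_continuous; cont|by apply: L01_continuous; cont].
by move=> /eqP; rewrite addrC addr_eq0 => /eqP.
Qed.

End WeakCalculus.

(** * Variations rotating the velocity *)

Section CurveData.
Context {R : realType}.
Variable p : R.
Hypothesis hp : 1 < p.
Notation mu := (@lebesgue_measure R).
Notation int01 f := (\int[mu]_(t in `]0, 1[) (f t)).
Implicit Types (f g h phi psi : R -> R) (a b M s t x y : R) (u w : W2p p) (gamma eta : curve p).

(* The projection of t onto [0, 1], written so that its continuity is syntactic. *)
Definition clamp (t : R) : R := (1 + `|t| - `|t - 1|) / 2.

Lemma clamp_in t : 0 <= t <= 1 -> clamp t = t.
Proof. by move=> ht; rewrite /clamp ger0_norm ?ler0_norm; [field|lra|lra]. Qed.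

Lemma clamp01 t : 0 <= clamp t <= 1.
Proof.
rewrite /clamp; have [h|h] := leP 0 t; have [h'|h'] := leP 0 (t - 1).
- rewrite (ger0_norm h) (ger0_norm h'); lra.
- rewrite (ger0_norm h) (ltr0_norm h'); lra.
- exfalso; lra.
- rewrite (ltr0_norm h) (ltr0_norm h'); lra.
Qed.

Lemma clamp_continuous : continuous clamp.
Proof. by rewrite /clamp; cont. Qed.

Lemma continuous_clamp f : {within `[0, 1], continuous f} -> continuous (fun t => f (clamp t)).
Proof.
move=> /subspace_continuousP cf t.
have m s : (`[0, 1]%classic : set R) (clamp s) by rewrite /= in_itv; exact: clamp01.
apply: (@cvg_comp _ _ _ clamp f _ (within `[0, 1]%classic (nbhs (clamp t))) _ _ (cf _ (m t))) => B /= hB.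
have h2 : nbhs t [set s | (`[0, 1]%classic : set R) (clamp s) -> B (clamp s)] := clamp_continuous hB.
by apply: filterS h2 => s /=; apply; exact: m.
Qed.

(** The representative of u' extended by its end values, which is continuous on the whole line. *)
Definition D1 u t : R := wder1 u (clamp t).

Lemma D1E u t : 0 <= t <= 1 -> D1 u t = wder1 u t.
Proof. by move=> ht; rewrite /D1 clamp_in. Qed.

Lemma D1_continuous u : continuous (D1 u).
Proof. apply: continuous_clamp; exact: wder1_continuous. Qed.

Lemma D1_weak u : weak_derivative (D1 u) (wder2 u).
Proof.
apply: (eq_weak_derivative _ _ (wder2_weak u)) => // t ht; rewrite D1E//; lra.
Qed.

Lemma wder2_L01 u : L01 (wder2 u).
Proof. by apply: (Lp01_L01 hp); exact: wder2_Lp. Qed.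

Lemma primitive01_continuous f t : 0 <= t <= 1 -> continuous f ->
  primitive01 f t = integral_from0 f t.
Proof.
move=> /andP[t0 t1] cf; rewrite /primitive01 /integral_from0 t0.
have le := loc_integrable_extend0 (L01_continuous cf).
rewrite -!Rintegral_oo_cc//; last exact: continuous_loc_integrable.
apply: eq_Rintegral => x; rewrite inE /= in_itv /= => hx.
by rewrite /extend0 patchE mem_set//= in_itv/=; lra.
Qed.

Lemma wfun_FTC u t : 0 <= t <= 1 -> wfun u t = wfun u 0 + integral_from0 (D1 u) t.
Proof.
move=> ht; have c := continuous_clamp (@wfun_continuous _ _ u).
have w : weak_derivative (fun t => wfun u (clamp t)) (D1 u).
  apply: (eq_weak_derivative _ _ (wder1_weak u)) => x hx; rewrite /D1 clamp_in//; lra.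
have := weak_derivative_FTC c (L01_continuous (@D1_continuous u)) w ht.
rewrite primitive01_continuous//; last exact: D1_continuous.
by rewrite !clamp_in// lexx ler01.
Qed.

Lemma W2p_primitive (a : R) f g : continuous f -> Lp01 p g -> weak_derivative f g ->
  exists u : W2p p, [/\ wfun u = (fun t => a + integral_from0 f t), wder1 u = f & wder2 u = g].
Proof.
move=> cf lg w; have l := continuous_loc_integrable cf.
have c0 : continuous (fun t => a + integral_from0 f t).
  by have := continuous_integral_from0 l => c; cont.
by exists (MkW2p (continuous_subspaceT c0) (continuous_subspaceT cf) lg (weak_derivative_primitive a cf) w).
Qed.

(** The velocity is multiplied by the matrix with rows (c, -s) and (s, c). The pair (c, s) need not
    be a rotation: (0, phi) gives the derivative of the family of rotations at e = 0. P is the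
    starting point. *)
Record twisted gamma (P : R * R) (c dc s ds : R -> R) eta : Prop := Twisted {
  tw_x : wfun eta.1 = fun t => P.1 + integral_from0 (fun t => c t * D1 gamma.1 t - s t * D1 gamma.2 t) t;
  tw_y : wfun eta.2 = fun t => P.2 + integral_from0 (fun t => s t * D1 gamma.1 t + c t * D1 gamma.2 t) t;
  tw_x1 : wder1 eta.1 = fun t => c t * D1 gamma.1 t - s t * D1 gamma.2 t;
  tw_y1 : wder1 eta.2 = fun t => s t * D1 gamma.1 t + c t * D1 gamma.2 t;
  tw_x2 : wder2 eta.1 = fun t => dc t * D1 gamma.1 t + c t * wder2 gamma.1 t -
                                 (ds t * D1 gamma.2 t + s t * wder2 gamma.2 t);
  tw_y2 : wder2 eta.2 = fun t => ds t * D1 gamma.1 t + s t * wder2 gamma.1 t +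
                                 (dc t * D1 gamma.2 t + c t * wder2 gamma.2 t) }.

Lemma twist_exists gamma P (c dc s ds : R -> R) :
  (forall t, is_derive t (1 : R) c (dc t)) -> continuous dc ->
  (forall t, is_derive t (1 : R) s (ds t)) -> continuous ds ->
  exists eta, twisted gamma P c dc s ds eta.
Proof.
move=> hc cdc hs cds.
have cc := is_derive_continuous hc; have cs := is_derive_continuous hs.
have cu := @D1_continuous gamma.1; have cv := @D1_continuous gamma.2.
have lu := wder2_Lp gamma.1; have lv := wder2_Lp gamma.2.
have wm (z : W2p p) (k dk : R -> R) : (forall t, is_derive t (1 : R) k (dk t)) -> continuous dk ->
   weak_derivative (fun t => k t * D1 z t) (fun t => dk t * D1 z t + k t * wder2 z t).
  move=> hk cdk; apply: weak_derivative_mul => //; [exact: D1_continuous|exact: wder2_L01|exact: D1_weak].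
have lm (z : W2p p) (k dk : R -> R) : (forall t, is_derive t (1 : R) k (dk t)) -> continuous dk ->
   Lp01 p (fun t => dk t * D1 z t + k t * wder2 z t).
  move=> hk cdk; have ck := is_derive_continuous hk; have cz := @D1_continuous z.
  apply: Lp01D => //; first by apply: Lp01_continuous => //; cont.
  by apply: Lp01M => //; exact: wder2_Lp.
have hsN t : is_derive t (1 : R) (fun t => - s t) (- ds t) by apply: derN.
have cdsN : continuous (fun t => - ds t) by cont.
have [|||e1 [x0 x1 x2]] := @W2p_primitive P.1 (fun t => c t * D1 gamma.1 t - s t * D1 gamma.2 t)
   (fun t => dc t * D1 gamma.1 t + c t * wder2 gamma.1 t - (ds t * D1 gamma.2 t + s t * wder2 gamma.2 t)).
- by cont.
- by apply: Lp01B => //; apply: lm.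
- have w1 := wm gamma.1 _ _ hc cdc; have w2 := wm gamma.2 _ _ hsN cdsN.
  have := weak_derivativeD _ _ _ _ w1 w2; move=> /(_ _ _ _ _)/wrap[||||h].
  + by cont.
  + by apply: (Lp01_L01 hp); exact: lm.
  + by cont.
  + by apply: (Lp01_L01 hp); exact: lm.
  apply: (eq_weak_derivative _ _ h) => t _; ring.
have [|||e2 [y0 y1 y2]] := @W2p_primitive P.2 (fun t => s t * D1 gamma.1 t + c t * D1 gamma.2 t)
   (fun t => ds t * D1 gamma.1 t + s t * wder2 gamma.1 t + (dc t * D1 gamma.2 t + c t * wder2 gamma.2 t)).
- by cont.
- by apply: Lp01D => //; apply: lm.
- have w1 := wm gamma.1 _ _ hs cds; have w2 := wm gamma.2 _ _ hc cdc.
  have := weak_derivativeD _ _ _ _ w1 w2; apply; [by cont|by apply: (Lp01_L01 hp); exact: lm|by cont|].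
  by apply: (Lp01_L01 hp); exact: lm.
by exists (e1, e2); split.
Qed.

Lemma enorm_rotate (c s x y : R) : c ^+ 2 + s ^+ 2 = 1 ->
  enorm (c * x - s * y, s * x + c * y) = enorm (x, y).
Proof.
move=> cs; rewrite /enorm /=; congr Num.sqrt.
have -> : (c * x - s * y) ^+ 2 + (s * x + c * y) ^+ 2 = (c ^+ 2 + s ^+ 2) * (x ^+ 2 + y ^+ 2) by ring.
by rewrite cs mul1r.
Qed.

Lemma enorm_gt0 (v : R * R) : v != 0 -> 0 < enorm v.
Proof.
move=> v0; rewrite sqrtr_gt0; have [x0|x0] := eqVneq v.1 0.
  rewrite x0 expr0n add0r exprn_even_gt0//=; apply: contra_neq v0 => y0.
  by case: v x0 y0 => a b /= -> ->.
by rewrite ltr_pwDl ?sqr_ge0// exprn_even_gt0.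
Qed.

Lemma enorm_sqr (v : R * R) : enorm v ^+ 2 = v.1 ^+ 2 + v.2 ^+ 2.
Proof. by rewrite sqr_sqrtr// addr_ge0 ?sqr_ge0. Qed.

Lemma vel_D1 gamma t : 0 <= t <= 1 -> vel gamma t = (D1 gamma.1 t, D1 gamma.2 t).
Proof. by move=> ht; rewrite /vel !D1E. Qed.

Definition rotated gamma phi dphi P eta : Prop :=
  twisted gamma P (fun t => cos (phi t)) (fun t => - sin (phi t) * dphi t)
    (fun t => sin (phi t)) (fun t => cos (phi t) * dphi t) eta.

Lemma rotated_speed gamma phi dphi P eta t : rotated gamma phi dphi P eta -> 0 <= t <= 1 ->
  enorm (vel eta t) = enorm (vel gamma t).
Proof.
move=> [_ _ x1 y1 _ _] ht; rewrite (vel_D1 gamma ht) /vel x1 y1.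
by apply: enorm_rotate; rewrite cos2Dsin2.
Qed.

(** Exact, without remainder: a rotation preserves the cross product of velocity and acceleration,
    and differentiating the angle adds dphi times the squared speed. *)
Lemma rotated_curvature gamma phi dphi P eta t : immersed gamma ->
  rotated gamma phi dphi P eta -> 0 <= t <= 1 ->
  curvature eta t = curvature gamma t + dphi t / enorm (vel gamma t).
Proof.
move=> im tw ht; have sp := rotated_speed tw ht.
have [_ _ x1 y1 x2 y2] := tw.
rewrite /curvature sp; have v0 := enorm_gt0 (im t ht).
have v2 := enorm_sqr (vel gamma t).
rewrite /vel /acc /= x1 y1 x2 y2 -/(vel gamma t) -!D1E//.
rewrite /vel /= -!D1E// in v2.
set e := enorm _ in v0 v2 *.
have cs := cos2Dsin2 (phi t).
have -> : dphi t / e = dphi t * (cos (phi t) ^+ 2 + sin (phi t) ^+ 2) * (D1 gamma.1 t ^+ 2 + D1 gamma.2 t ^+ 2) / e ^+ 3.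
  have -> : D1 gamma.1 t ^+ 2 + D1 gamma.2 t ^+ 2 = e ^+ 2 by rewrite /e vel_D1// v2.
  by rewrite cs; field; rewrite gt_eqF.
have -> : D1 gamma.1 t * wder2 gamma.2 t - D1 gamma.2 t * wder2 gamma.1 t =
  (cos (phi t) ^+ 2 + sin (phi t) ^+ 2) * (D1 gamma.1 t * wder2 gamma.2 t - D1 gamma.2 t * wder2 gamma.1 t).
  by rewrite cs mul1r.
by rewrite -mulrDl; congr (_ / _); ring.
Qed.

Lemma spow_le (k x y : R) : 0 < k -> x <= y -> spow k x <= spow k y.
Proof.
move=> k0 xy.
have pos (a b : R) : 0 <= a -> a <= b -> spow k a <= spow k b.
  move=> a0 ab; have [|b0] := eqVneq b 0.
    by move=> b0; have -> : a = 0 by [lra]; rewrite b0.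
  have b0' : 0 < b by rewrite lt_def b0 (le_trans a0).
  rewrite (spow_pos _ b0'); have [->|az] := eqVneq a 0; first by rewrite spow0 powR_ge0.
  rewrite spow_pos ?lt_def ?az//; apply: ge0_ler_powR; rewrite ?nnegrE//; lra.
have nonneg (a : R) : 0 <= a -> 0 <= spow k a by move=> a0; rewrite -(spow0 k); exact: pos.
have [x0|x0] := leP 0 x; first exact: pos.
have [y0|y0] := leP 0 y.
  rewrite (@le_trans _ _ 0)//; last exact: nonneg.
  by rewrite -[x]opprK spowN oppr_le0; apply: nonneg; lra.
by rewrite -[x]opprK -[y]opprK !(spowN _ (- _)) lerN2; apply: pos; lra.
Qed.

(* Replaces differentiation of the energy under the integral sign: a tangent-line
   bound from below on both sides of e = 0 forces the first variation to vanish. *)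
Lemma powR_norm_convex (k d : R) :
  `|k| `^ p + p * spow (p - 1) k * d <= `|k + d| `^ p.
Proof.
have cf : continuous (fun t : R => `|t| `^ p).
  by apply: is_derive_continuous => x; exact: is_derive_powR_norm.
have p1 : 0 < p - 1 by have := hp; lra.
have pp : 0 < p by have := hp; lra.
have [d0|d0|->] := ltgtP d 0; last by rewrite mulr0 !addr0.
- have [|||c hc] := @MVT _ (fun t : R => `|t| `^ p) (fun t => p * spow (p - 1) t) (k + d) k.
  + lra.
  + by move=> x _; exact: is_derive_powR_norm.
  + exact: continuous_subspaceT.
  have : spow (p - 1) c <= spow (p - 1) k.
    by apply: spow_le => //; move: hc; rewrite in_itv/= => /andP[_ /ltW].
  rewrite -(ler_pM2l pp); nra.
- have [|||c hc] := @MVT _ (fun t : R => `|t| `^ p) (fun t => p * spow (p - 1) t) k (k + d).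
  + lra.
  + by move=> x _; exact: is_derive_powR_norm.
  + exact: continuous_subspaceT.
  have : spow (p - 1) k <= spow (p - 1) c.
    by apply: spow_le => //; move: hc; rewrite in_itv/= => /andP[/ltW].
  rewrite -(ler_pM2l pp); nra.
Qed.

Lemma speed_continuous gamma : continuous (fun t => enorm (vel gamma (clamp t))).
Proof.
have cu := @D1_continuous gamma.1; have cv := @D1_continuous gamma.2.
have -> : (fun t => enorm (vel gamma (clamp t))) = fun t => Num.sqrt (D1 gamma.1 t ^+ 2 + D1 gamma.2 t ^+ 2) by [].
by apply: cont_sqrt; cont.
Qed.

Lemma curvature_Lp gamma : immersed gamma -> Lp01 p (curvature gamma).
Proof.
move=> im; have cu := @D1_continuous gamma.1; have cv := @D1_continuous gamma.2.
have cs := @speed_continuous gamma.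
have ci : continuous (fun t => (enorm (vel gamma (clamp t)) ^+ 3)^-1).
  apply: contV; first by cont.
  by move=> t; rewrite expf_neq0// gt_eqF// enorm_gt0// im// clamp01.
have l : Lp01 p (fun t => D1 gamma.1 t * wder2 gamma.2 t - D1 gamma.2 t * wder2 gamma.1 t).
  by apply: Lp01B => //; apply: Lp01M => //; exact: wder2_Lp.
apply: (eq_Lp01 _ (Lp01M hp l ci)) => t ht.
have ht' := oo01W ht.
by rewrite clamp_in// /curvature /= !D1E// mulrC.
Qed.

Lemma curvature_spow_L01 gamma : immersed gamma ->
  L01 (fun t => spow (p - 1) (curvature gamma t)).
Proof.
move=> im; have p1 : 0 < p - 1 by have := hp; lra.
have [mk lk] := (Lp01P hp _).1 (curvature_Lp im).
apply: (L01_dom _ (L01D (L01_continuous (@contC _ 1)) lk)).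
  apply: (measurableT_comp _ mk); apply: continuous_measurable_fun; exact: continuous_spow.
move=> t _; rewrite normr_spow ?gt_eqF//.
have [h|h] := leP `|curvature gamma t| 1.
  rewrite (@le_trans _ _ 1) ?lerDl ?powR_ge0//.
  have e1 : (1 : R) `^ (p - 1) = 1 by rewrite powR1.
  by rewrite -[leRHS]e1; apply: ge0_ler_powR; rewrite ?nnegrE//; exact: ltW.
rewrite (@le_trans _ _ (`|curvature gamma t| `^ p)) ?lerDr//.
by apply: ler_powR; [exact: ltW|lra].
Qed.

(** The tangent-line inequality is applied pointwise to the exact change of curvature; the weight by
    the speed cancels the division in dphi / speed. *)
Lemma rotated_bending gamma phi dphi P eta : immersed gamma -> continuous dphi ->
  rotated gamma phi dphi P eta ->
  bending gamma + p * int01 (fun t => spow (p - 1) (curvature gamma t) * dphi t) <= bending eta.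
Proof.
move=> im cd tw.
have imE : immersed eta.
  move=> t ht; have := enorm_gt0 (im t ht); rewrite -(rotated_speed tw ht).
  by apply: contraTneq => ->; rewrite /enorm /= expr0n /= addr0 sqrtr0 ltxx.
have cs := @speed_continuous gamma.
have [_ lk] := (Lp01P hp _).1 (curvature_Lp im).
have [_ lkE] := (Lp01P hp _).1 (curvature_Lp imE).
have lW := L01M (curvature_spow_L01 im) cd.
have l1 : L01 (fun t => `|curvature gamma t| `^ p * enorm (vel gamma t)).
  by apply: (eq_L01 _ (L01M lk cs)) => t ht; rewrite clamp_in//; lra.
have l2 : L01 (fun t => `|curvature eta t| `^ p * enorm (vel eta t)).
  apply: (eq_L01 _ (L01M lkE (@speed_continuous eta))) => t ht; rewrite clamp_in//; lra.
rewrite /bending -int01Z// -int01D//; last exact: L01Z.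
apply: le_int01 => //; first by apply: L01D => //; exact: L01Z.
move=> t ht; have ht' := oo01W ht.
rewrite (rotated_speed tw ht') (rotated_curvature im tw ht').
have v0 := enorm_gt0 (im t ht').
have := powR_norm_convex (curvature gamma t) (dphi t / enorm (vel gamma t)).
rewrite -(ler_pM2r v0); apply: le_trans.
rewrite le_eqVlt; apply/orP; left; apply/eqP; field.
by rewrite gt_eqF.
Qed.

End CurveData.

(** * Correcting the angle so that the endpoint is kept *)

Section FixedPoint.
Context {R : realType}.
Implicit Types (f g : R -> R) (a b e x y m K : R).

Lemma norm_derive_lipschitz f df m K x y : (forall t, is_derive t (1 : R) f (df t)) ->
  (forall t, `|t| <= m -> `|df t| <= K) -> `|x| <= m -> `|y| <= m ->
  `|f x - f y| <= K * `|x - y|.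
Proof.
move=> fd dK; have cf := is_derive_continuous fd.
have h a b : `|a| <= m -> `|b| <= m -> a <= b -> `|f b - f a| <= K * `|b - a|.
  move=> am bm ab.
  have [c hc ->] := @MVT_segment _ f df a b ab (fun t _ => fd t) (continuous_subspaceT cf).
  rewrite normrM ler_wpM2r//; apply: dK.
  by move: hc am bm; rewrite in_itv /= !ler_norml; lra.
by move=> xm ym; have [xy|/ltW yx] := leP x y; [rewrite distrC (distrC x)|]; exact: h.
Qed.

Lemma cos_lipschitz m x y : `|x| <= m -> `|y| <= m ->
  `|cos x - cos y| <= m * `|x - y|.
Proof.
have sinle (t : R) : `|sin t| <= `|t|.
  have := @norm_derive_lipschitz sin cos `|t| 1 t 0; rewrite sin0 !subr0 mul1r normr0.
  by apply=> // z _; rewrite ler_norml cos_geN1 cos_le1.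
apply: (@norm_derive_lipschitz cos (fun t => - sin t)) => t tm.
by rewrite normrN (le_trans (sinle t)).
Qed.

Lemma sinB_lipschitz m x y : `|x| <= m -> `|y| <= m ->
  `|(sin x - x) - (sin y - y)| <= m * `|x - y|.
Proof.
have c (t : R) : `|t| <= 2 -> `|cos t - 1| <= `|t|.
  move=> t2; have := @norm_derive_lipschitz cos (fun t => - sin t) 2 1 t 0.
  rewrite cos0 subr0 mul1r normr0; apply=> // z _.
  by rewrite normrN ler_norml sin_geN1 sin_le1.
apply: (@norm_derive_lipschitz (fun t => sin t - t) (fun t => cos t - 1)) => t tm.
(* The derivative bound is run on [-2, 2]; beyond it |cos t - 1| <= 2 suffices. *)
apply: le_trans tm; have [t2|t2] := leP `|t| 2; first exact: c.
rewrite (le_trans _ (ltW t2))// ler_norml.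
have := cos_geN1 t; have := cos_le1 t; lra.
Qed.

(** The intermediate value theorem for x - f x, which is nonpositive at - e and nonnegative at e;
    the Lipschitz bound only serves continuity, so K is arbitrary. *)
Lemma lipschitz_fixed f e K : 0 <= e -> 0 <= K ->
  (forall x y, `|x| <= e -> `|y| <= e -> `|f x - f y| <= K * `|x - y|) ->
  (forall x, `|x| <= e -> `|f x| <= e) -> exists2 x, `|x| <= e & f x = x.
Proof.
move=> e0 K0 lf fe.
have cl : {within `[- e, e], continuous f}.
  apply/subspace_continuousP => x /=; rewrite in_itv /= -ler_norml => xe.
  apply/cvgrPdist_le => d d0; near=> y.
  have ye : `|y| <= e by rewrite ler_norml; near: y; rewrite near_withinE; apply: nearW => z; rewrite /= in_itv.
  rewrite (le_trans (lf _ _ xe ye))//.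
  have xy : `|x - y| <= d / (K + 1).
    near: y; rewrite near_withinE.
    have : \forall z \near x, `|x - z| <= d / (K + 1) by have /cvgrPdist_le := @contI R x; apply; rewrite divr_gt0//; lra.
    by apply: filterS => z h _.
  rewrite (le_trans (ler_wpM2l K0 xy))// mulrCA ler_piMr// ?(ltW d0)//.
  rewrite ler_pdivrMr; lra.
have cg : {within `[- e, e], continuous (fun x => x - f x)}.
  apply: (@within_continuousB _ _ _ _ (fun x => x) f) => //; apply: continuous_subspaceT; exact: contI.
have ee : - e <= e by lra.
have [|x xe /eqP] := @IVT _ (fun x => x - f x) (- e) e 0 ee cg.
  have h1 := fe (- e); have h2 := fe e; move: h1 h2; rewrite normrN (ger0_norm e0) lexx.
  move=> /(_ isT) + /(_ isT); rewrite !ler_norml => h1 h2.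
  by rewrite ge_min le_max; apply/andP; split; apply/orP; [left|right]; lra.
rewrite subr_eq0 => /eqP fx; exists x => //.
by rewrite ler_norml; move: xe; rewrite in_itv.
Unshelve. all: by end_near. Qed.

(* Solving for y first keeps everything one-dimensional, so that the intermediate
   value theorem replaces a fixed point theorem in the plane. *)
Lemma contraction_fixed2 (S T : R -> R -> R) e : 0 <= e ->
  (forall x y x' y', `|x| <= e -> `|y| <= e -> `|x'| <= e -> `|y'| <= e ->
     `|S x y - S x' y'| <= (`|x - x'| + `|y - y'|) / 4 /\
     `|T x y - T x' y'| <= (`|x - x'| + `|y - y'|) / 4) ->
  (forall x y, `|x| <= e -> `|y| <= e -> `|S x y| <= e /\ `|T x y| <= e) ->
  exists x y, [/\ `|x| <= e, `|y| <= e, S x y = x & T x y = y].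
Proof.
move=> e0 lip bd.
have /choice[g hg] : forall x, exists y, `|x| <= e -> `|y| <= e /\ T x y = y.
  move=> x; have [xe|] := boolP (`|x| <= e); last by exists 0.
  have q0 : 0 <= 4^-1 :> R by [].
  have [||y ye Ty] := @lipschitz_fixed (T x) e 4^-1 e0 q0.
  - move=> y y' hy hy'; have [_] := lip x y x y' xe hy xe hy'.
    by rewrite subrr normr0 add0r mulrC.
  - by move=> y hy; have [] := bd x y xe hy.
  by exists y.
(* From |g x - g x'| <= (|x - x'| + |g x - g x'|)/4 the second term is absorbed, which leaves the
   factor 1/3. *)
have glip x x' : `|x| <= e -> `|x'| <= e -> `|g x - g x'| <= `|x - x'|.
  move=> hx hx'; have [gx Tx] := hg x hx; have [gx' Tx'] := hg x' hx'.
  have [_] := lip x (g x) x' (g x') hx gx hx' gx'; rewrite Tx Tx'.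
  have := normr_ge0 (x - x'); lra.
have [||x xe Sx] := @lipschitz_fixed (fun x => S x (g x)) e 1 e0 ler01.
- move=> x x' hx hx'; have [gx Tx] := hg x hx; have [gx' Tx'] := hg x' hx'.
  have [+ _] := lip x (g x) x' (g x') hx gx hx' gx'; have := glip x x' hx hx'.
  have := normr_ge0 (x - x'); lra.
- by move=> x hx; have [gx Tx] := hg x hx; have [] := bd x (g x) hx gx.
by exists x, (g x); have [? ?] := hg x xe.
Qed.

End FixedPoint.

Section Closing.
Context {R : realType}.
Notation mu := (@lebesgue_measure R).
Notation int01 f := (\int[mu]_(t in `]0, 1[) (f t)).
Variables u v f0 f1 f2 : R -> R.
Hypotheses (cu : continuous u) (cv : continuous v) (c0 : continuous f0)
  (c1 : continuous f1) (c2 : continuous f2).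
Hypotheses (f0u : int01 (fun t => f0 t * u t) = 0) (f0v : int01 (fun t => f0 t * v t) = 0)
  (f1u : int01 (fun t => f1 t * u t) = 1) (f1v : int01 (fun t => f1 t * v t) = 0)
  (f2u : int01 (fun t => f2 t * u t) = 0) (f2v : int01 (fun t => f2 t * v t) = 1).

Definition angle (e a b t : R) : R := e * f0 t + a * f1 t + b * f2 t.

Lemma continuous_angle e a b : continuous (angle e a b).
Proof. by have := c0; have := c1; have := c2 => h2 h1 h0; rewrite /angle; cont. Qed.

Lemma int01_angle_u e a b : int01 (fun t => angle e a b t * u t) = a.
Proof.
have := cu; have := c0; have := c1; have := c2 => h2 h1 h0 hu.
have -> : int01 (fun t => angle e a b t * u t) =
   int01 (fun t => e * (f0 t * u t) + a * (f1 t * u t) + b * (f2 t * u t)).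
  by apply: eq_int01 => t _; rewrite /angle; ring.
rewrite !int01D ?int01Z ?f0u ?f1u ?f2u; try by apply: L01_continuous; cont.
ring.
Qed.

Lemma int01_angle_v e a b : int01 (fun t => angle e a b t * v t) = b.
Proof.
have := cv; have := c0; have := c1; have := c2 => h2 h1 h0 hv.
have -> : int01 (fun t => angle e a b t * v t) =
   int01 (fun t => e * (f0 t * v t) + a * (f1 t * v t) + b * (f2 t * v t)).
  by apply: eq_int01 => t _; rewrite /angle; ring.
rewrite !int01D ?int01Z ?f0v ?f1v ?f2v; try by apply: L01_continuous; cont.
ring.
Qed.

(** By duality the linear part of the endpoint condition returns b and a themselves, so the
    condition is a fixed-point equation whose right side is quadratic in the angle, hence of order
    e^2. *)
Lemma closing_angle : exists C e0 : R, [/\ 0 < C, 0 < e0 & forall e : R, `|e| <= e0 ->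
  exists a b, [/\ `|a| <= C * e ^+ 2, `|b| <= C * e ^+ 2,
    int01 (fun t => cos (angle e a b t) * u t - sin (angle e a b t) * v t) = int01 u &
    int01 (fun t => sin (angle e a b t) * u t + cos (angle e a b t) * v t) = int01 v]].
Proof.
have [Mu Mu0 hMu] := continuous_bounded01 cu.
have [Mv Mv0 hMv] := continuous_bounded01 cv.
have [M0 M00 hM0] := continuous_bounded01 c0.
have [M1 M10 hM1] := continuous_bounded01 c1.
have [M2 M20 hM2] := continuous_bounded01 c2.
pose V := Mu + Mv; pose M := M0 + M1 + M2.
have V0 : 0 < V by rewrite /V; lra.
have M0' : 0 < M by rewrite /M; lra.
(* V bounds the velocity and M |e| the angle when |a|, |b| <= |e|. The right sides then have size C
   e^2 and Lipschitz constant C |e|, and e0 = 1/(4 C) makes the latter at most 1/4. *)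
pose C := V * M ^+ 2.
have C0 : 0 < C by rewrite /C mulr_gt0 ?exprn_gt0.
pose e0 := (4 * C)^-1.
have e00 : 0 < e0 by rewrite invr_gt0; lra.
exists C, e0; split => // e he.
have eC : C * `|e| <= 4^-1.
  have := ler_wpM2l (ltW C0) he; rewrite /e0 invfM mulrCA mulfV ?mulr1//; lra.
have ang a b t : `|a| <= `|e| -> `|b| <= `|e| -> 0 <= t <= 1 -> `|angle e a b t| <= M * `|e|.
  move=> ha hb ht; rewrite /angle /M.
  have := hM0 t ht; have := hM1 t ht; have := hM2 t ht => h2 h1 h0.
  rewrite (le_trans (ler_normD _ _))// (_ : (M0 + M1 + M2) * `|e| = (`|e| * M0 + `|e| * M1) + `|e| * M2); last by ring.
  apply: lerD; last by rewrite normrM ler_pM.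
  by rewrite (le_trans (ler_normD _ _))// !normrM lerD// ler_pM.
have angB a b a' b' t : 0 <= t <= 1 ->
    `|angle e a b t - angle e a' b' t| <= M * (`|a - a'| + `|b - b'|).
  move=> ht; have := hM1 t ht; have := hM2 t ht => h2 h1.
  have -> : angle e a b t - angle e a' b' t = (a - a') * f1 t + (b - b') * f2 t by rewrite /angle; ring.
  rewrite (le_trans (ler_normD _ _))// !normrM mulrDr mulrC (mulrC _ `|f2 t|).
  by apply: lerD; apply: ler_wpM2r => //; rewrite /M; lra.
(* The two endpoint conditions with the linear term of the sine removed; the removed terms are a and
   b by [int01_angle_u] and [int01_angle_v]. *)
pose S a b := - int01 (fun t => (sin (angle e a b t) - angle e a b t) * u t + (cos (angle e a b t) - 1) * v t).
pose T a b := int01 (fun t => (cos (angle e a b t) - 1) * u t - (sin (angle e a b t) - angle e a b t) * v t).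
have cang := continuous_angle.
have lS a b : L01 (fun t => (sin (angle e a b t) - angle e a b t) * u t + (cos (angle e a b t) - 1) * v t).
  by apply: L01_continuous; have ca := cang e a b; have cu' := cu; have cv' := cv; cont.
have lT a b : L01 (fun t => (cos (angle e a b t) - 1) * u t - (sin (angle e a b t) - angle e a b t) * v t).
  by apply: L01_continuous; have ca := cang e a b; have cu' := cu; have cv' := cv; cont.
have comb x y m t : 0 < t < 1 -> `|x| <= m -> `|y| <= m -> 
    `|x * u t + y * v t| <= V * m /\ `|x * u t - y * v t| <= V * m.
  move=> ht xm ym; have ht' := oo01W ht.
  have h : `|x * u t| + `|y * v t| <= V * m.
    rewrite !normrM /V mulrDl (mulrC Mu) (mulrC Mv).
    by apply: lerD; apply: ler_pM => //; [exact: hMu|exact: hMv].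
  split; apply: le_trans h; first exact: ler_normD.
  by rewrite (le_trans (ler_normB _ _)).
have ee : 0 <= `|e| by [].
have m0 : 0 <= M * `|e| by rewrite mulr_ge0// ltW.
have lipST x y x' y' : `|x| <= `|e| -> `|y| <= `|e| -> `|x'| <= `|e| -> `|y'| <= `|e| ->
     `|S x y - S x' y'| <= (C * `|e|) * (`|x - x'| + `|y - y'|) /\
     `|T x y - T x' y'| <= (C * `|e|) * (`|x - x'| + `|y - y'|).
  move=> hx hy hx' hy'.
  pose d := `|x - x'| + `|y - y'|.
  have hc t : 0 <= t <= 1 -> `|(cos (angle e x y t) - 1) - (cos (angle e x' y' t) - 1)| <= M * `|e| * (M * d).
    move=> ht; rewrite opprB addrA subrK.
    rewrite (le_trans (cos_lipschitz (ang _ _ _ hx hy ht) (ang _ _ _ hx' hy' ht)))//.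
    by rewrite ler_wpM2l// angB.
  have hs t : 0 <= t <= 1 -> `|(sin (angle e x y t) - angle e x y t) - (sin (angle e x' y' t) - angle e x' y' t)| <= M * `|e| * (M * d).
    move=> ht; rewrite (le_trans (sinB_lipschitz (ang _ _ _ hx hy ht) (ang _ _ _ hx' hy' ht)))//.
    by rewrite ler_wpM2l// angB.
  have E : C * `|e| * d = V * (M * `|e| * (M * d)) by rewrite /C; ring.
  rewrite -/d E; split.
    rewrite /S -opprD normrN -int01N// -int01D//; last exact: L01N.
    apply: norm_int01_le; first by apply: L01D => //; exact: L01N.
    move=> t ht; have ht' := oo01W ht.
    have [h _] := comb _ _ _ t ht (hs t ht') (hc t ht').
    by apply: le_trans h; rewrite le_eqVlt; apply/orP; left; apply/eqP; congr `|_|; ring.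
  rewrite /T -int01B//; apply: norm_int01_le; first exact: L01B.
  move=> t ht; have ht' := oo01W ht.
  have [_ h] := comb _ _ _ t ht (hc t ht') (hs t ht').
  by apply: le_trans h; rewrite le_eqVlt; apply/orP; left; apply/eqP; congr `|_|; ring.
have bdST x y : `|x| <= `|e| -> `|y| <= `|e| -> `|S x y| <= C * e ^+ 2 /\ `|T x y| <= C * e ^+ 2.
  move=> hx hy; have := normr0 R => n0.
  have hc t : 0 <= t <= 1 -> `|cos (angle e x y t) - 1| <= (M * `|e|) ^+ 2.
    move=> ht; have h := ang _ _ _ hx hy ht.
    have := @cos_lipschitz _ (M * `|e|) (angle e x y t) 0 h; rewrite n0 => /(_ m0).
    by rewrite cos0 subr0 => /le_trans; apply; rewrite expr2 ler_wpM2l.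
  have hs t : 0 <= t <= 1 -> `|sin (angle e x y t) - angle e x y t| <= (M * `|e|) ^+ 2.
    move=> ht; have h := ang _ _ _ hx hy ht.
    have := @sinB_lipschitz _ (M * `|e|) (angle e x y t) 0 h; rewrite n0 => /(_ m0).
    by rewrite sin0 !subr0 => /le_trans; apply; rewrite expr2 ler_wpM2l.
  have E : C * e ^+ 2 = V * (M * `|e|) ^+ 2 by rewrite exprMn -normrX (ger0_norm (sqr_ge0 e)) /C; ring.
  rewrite E /S normrN; split; (apply: norm_int01_le; first by []) => t ht; have ht' := oo01W ht.
    by have [h _] := comb _ _ _ t ht (hs t ht') (hc t ht').
  by have [_ h] := comb _ _ _ t ht (hc t ht') (hs t ht').
have Ce : C * e ^+ 2 <= `|e|.
  have -> : e ^+ 2 = `|e| * `|e| by rewrite -expr2 -normrX (ger0_norm (sqr_ge0 e)).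
  rewrite mulrA; nra.
have [|||a [b [ha hb Sa Tb]]] := @contraction_fixed2 _ S T `|e|.
- by [].
- move=> x y x' y' hx hy hx' hy'; have [h1 h2] := lipST x y x' y' hx hy hx' hy'.
  have d0 : 0 <= `|x - x'| + `|y - y'| by rewrite addr_ge0.
  by split; [apply: (le_trans h1)|apply: (le_trans h2)]; rewrite mulrC ler_wpM2l.
- move=> x y hx hy; have [h1 h2] := bdST x y hx hy.
  by split; [apply: (le_trans h1)|apply: (le_trans h2)].
have [h1 h2] := bdST a b ha hb; rewrite Sa Tb in h1 h2.
exists a, b; split => //.
  apply/eqP; rewrite -subr_eq0; apply/eqP.
  have cA := cang e a b; have cu' := cu; have cv' := cv.
  rewrite -int01B; [|by apply: L01_continuous; cont|by apply: L01_continuous].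
  have lA : L01 (fun t => angle e a b t * v t) by apply: L01_continuous; cont.
  have hb0 : T a b - b = 0 by rewrite Tb subrr.
  rewrite -[RHS]hb0 /T -[X in _ - X](int01_angle_v e a b) -int01B//.
  by apply: eq_int01 => t _; ring.
apply/eqP; rewrite -subr_eq0; apply/eqP.
have cA := cang e a b; have cu' := cu; have cv' := cv.
rewrite -int01B; [|by apply: L01_continuous; cont|by apply: L01_continuous].
have lA : L01 (fun t => angle e a b t * u t) by apply: L01_continuous; cont.
have Sa' : int01 (fun t => (sin (angle e a b t) - angle e a b t) * u t + (cos (angle e a b t) - 1) * v t) = - a.
  by apply/eqP; rewrite -eqr_oppLR; apply/eqP; exact: Sa.
rewrite -[RHS](addNr a) -Sa' -[X in _ + X](int01_angle_u e a b) -int01D//.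
by apply: eq_int01 => t _; ring.
Qed.

End Closing.

(** * Difference quotients of the rotated curves *)

Section Variations.
Context {R : realType}.
Variable p : R.
Hypothesis hp : 1 < p.
Notation mu := (@lebesgue_measure R).
Notation int01 f := (\int[mu]_(t in `]0, 1[) (f t)).
Implicit Types (f g h phi psi : R -> R) (a b e K M s t x y : R) (u w : W2p p) (gamma eta : curve p).

Lemma is_derive0_small f e : is_derive (0 : R) (1 : R) f 0 -> 0 < e ->
  exists2 d : R, 0 < d & forall x, `|x| < d -> `|f x - f 0| <= e * `|x|.
Proof.
move=> df e0.
have c : h^-1 *: (f (h *: 1 + 0) - f 0) @[h --> 0^'] --> (0 : R).
  have := @ex_derive _ _ _ _ _ _ _ df; rewrite /derivable => h.
  have E : 'D_1 f 0 = 0 by apply: derive_val.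
  have hc : h^-1 *: (f (h *: 1 + 0) - f 0) @[h --> 0^'] --> 'D_1 f 0 by exact: h.
  by rewrite E in hc.
have /cvgrPdist_le /(_ e e0) [d /= d0 hd] := c.
exists d => // x xd; have [->|x0] := eqVneq x 0; first by rewrite subrr normr0 mulr0.
have := hd x; rewrite /ball_ /= !sub0r normrN => /(_ xd x0).
rewrite normrN /GRing.scale /= mulr1 addr0 normrM normfV.
by rewrite ler_pdivrMl ?normr_gt0// mulrC.
Qed.

(** A lower bound valid for both signs of e suffices: moving in the direction of the sign of a would
    make f grow linearly, against a zero derivative. *)
Lemma derive0_slope f a K d : is_derive (0 : R) (1 : R) f 0 -> 0 <= K -> 0 < d ->
  (forall e, `|e| <= d -> f 0 + e * a - K * e ^+ 2 <= f e) -> a = 0.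
Proof.
move=> df K0 d0 H; apply/eqP/negPn/negP => a0.
have aa : 0 < `|a| by rewrite normr_gt0.
have [d1 d10 hd1] := is_derive0_small df (divr_gt0 aa (ltr0n _ 3)).
(* At this size the derivative error and the term K x^2 each cost at most a third of |a| x. *)
pose x := Num.min (d1 / 2) (Num.min d (`|a| / (3 * (K + 1)))).
have [x0 xd1 xd xa] : [/\ 0 < x, x <= d1 / 2, x <= d & x <= `|a| / (3 * (K + 1))].
  rewrite /x !lt_min !ge_min !lexx !orbT d0 !divr_gt0//; lra.
have xK : x * (K + 1) * 3 <= `|a|.
  by move: xa; rewrite ler_pdivlMr; [rewrite mulrA mulrAC mulrC; lra|lra].
pose y := x * Num.sg a.
have ya : y * a = x * `|a| by rewrite /y -mulrA -normrEsg.
have yx : `|y| = x by rewrite /y normrM normr_sg a0 mulr1 gtr0_norm.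
have y2 : y ^+ 2 = x ^+ 2 by rewrite -yx -normrX ger0_norm// sqr_ge0.
have := H y; rewrite yx ya y2 => /(_ xd) h1.
have := hd1 y; rewrite yx => /(_ _)/wrap[|h2]; first by lra.
have := ler_norm (f y - f 0); nra.
Qed.

Lemma integral_from0_lin f g a b t : continuous f -> continuous g ->
  integral_from0 (fun t => a * f t + b * g t) t = a * integral_from0 f t + b * integral_from0 g t.
Proof.
move=> cf cg; have lf := continuous_loc_integrable cf; have lg := continuous_loc_integrable cg.
have h (x y : R) : \int[mu]_(z in `[x, y]) (a * f z + b * g z) =
   a * \int[mu]_(z in `[x, y]) f z + b * \int[mu]_(z in `[x, y]) g z.
  rewrite RintegralD// ?RintegralZl//; apply: continuous_loc_integrable; cont.
rewrite /integral_from0; case: ifP => _; rewrite h//; ring.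
Qed.

Lemma norm_integral_from0_le f g t : continuous f -> continuous g ->
  (forall t, 0 <= t <= 1 -> `|f t| <= g t) -> 0 <= t <= 1 ->
  `|integral_from0 f t| <= int01 g.
Proof.
move=> cf cg fg /andP[t0 t1].
have lf := continuous_loc_integrable cf; have lg := continuous_loc_integrable cg.
have d h : continuous h -> forall x, is_derive x (1 : R) (integral_from0 h) (h x).
  by move=> ch x; apply: is_derive_integral_from0; [exact: continuous_loc_integrable|exact: ch].
have cI h : continuous h -> continuous (integral_from0 h).
  by move=> ch; exact: continuous_integral_from0 (continuous_loc_integrable ch).
have g0 s : 0 <= s <= 1 -> 0 <= g s by move=> hs; rewrite (le_trans _ (fg s hs)).
have up (h : R -> R) : continuous h -> (forall s, 0 <= s <= 1 -> h s <= g s) ->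
    integral_from0 h t <= integral_from0 g t.
  move=> ch hg; rewrite -subr_ge0.
  have cIg := cI g cg; have cIh := cI h ch.
  have cD : continuous (fun x => integral_from0 g x - integral_from0 h x) by cont.
  have := @der_nonneg_le _ (fun x => integral_from0 g x - integral_from0 h x)
     (fun x => g x - h x) 0 t t0 (continuous_subspaceT cD).
  rewrite !integral_from0_0 subrr; apply => x hx.
    exact: derD (d g cg x) (derN (d h ch x)).
  rewrite subr_ge0; apply: hg; lra.
have gt1 : integral_from0 g t <= integral_from0 g 1.
  apply: (@der_nonneg_le _ (integral_from0 g) g t 1 t1 (continuous_subspaceT (cI g cg))) => x hx.
    exact: d.
  apply: g0; lra.
rewrite int01_from0//; apply: le_trans gt1; rewrite ler_norml; apply/andP; split; last first.
  by apply: up => // s hs; rewrite (le_trans _ (fg s hs)) ?ler_norm.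
rewrite lerNl.
have -> : - integral_from0 f t = integral_from0 (fun s => (-1) * f s + 0 * f s) t.
  by rewrite integral_from0_lin//; ring.
apply: up; first by cont.
move=> s hs; rewrite mul0r addr0 mulN1r (le_trans _ (fg s hs))// -normrN ler_norm//.
Qed.

Lemma wder_Lp u (i : 'I_3) : Lp01 p (wder u i).
Proof.
rewrite /wder; case: i => -[|[|[|//]]] /= _.
- apply: (@eq_Lp01 _ _ (fun t => wfun u (clamp t))).
    by move=> t ht; rewrite clamp_in//; lra.
  by apply: (Lp01_continuous hp); apply: continuous_clamp; exact: wfun_continuous.
- apply: (@eq_Lp01 _ _ (D1 u)).
    by move=> t ht; rewrite D1E//; lra.
  by apply: (Lp01_continuous hp); exact: D1_continuous.
- exact: wder2_Lp.
Qed.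

Lemma quotient_error_ge0 e (u w h : W2p p) : (0 <= quotient_error e u w h)%E.
Proof. by apply: sume_ge0 => i _; exact: Lnorm_ge0. Qed.

Lemma quotient_error_le e (u w h : W2p p) g K : Lp01 p g -> 0 <= K ->
  (forall (i : 'I_3) t, 0 < t < 1 -> `|(wder u i t - wder w i t) / e - wder h i t| <= K * `|g t|) ->
  (quotient_error e u w h <= (3 * (K * int01 (fun x => (`|g x| `^ p)%R) `^ p^-1))%:E)%E.
Proof.
move=> lg K0 H; rewrite /quotient_error.
set N := K * _; have -> : 3 * N = N + (N + N) by ring.
have b (i : 'I_3) : (Lpnorm01 p (fun t => (wder u i t - wder w i t) / e - wder h i t)%R <= N%:E)%E.
  apply: (Lp01_dom hp _ lg K0 (H i)).2.
  suff /(Lp01P hp)[] : Lp01 p (fun t => (wder u i t - wder w i t) / e - wder h i t) by [].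
  apply: Lp01B => //; last exact: wder_Lp.
  have l : Lp01 p (fun t => wder u i t - wder w i t) by apply: Lp01B => //; exact: wder_Lp.
  by apply: (eq_Lp01 _ (Lp01M hp l (@contC R e^-1))) => t _; rewrite mulrC.
rewrite !big_ord_recl big_ord0 adde0 !EFinD; apply: leeD; first exact: b.
by apply: leeD; exact: b.
Qed.

(** One L^p majorant for the three derivative orders: the integral controls the position, the next
    two terms the velocity, the last two the second derivative. *)
Definition dominating gamma t : R :=
  int01 (fun t => `|D1 gamma.1 t| + `|D1 gamma.2 t|) + (`|D1 gamma.1 t| + `|D1 gamma.2 t|) +
  (`|wder2 gamma.1 t| + `|wder2 gamma.2 t|).

Lemma Lp01_norm f : Lp01 p f -> Lp01 p (fun t => `|f t|).
Proof.
move=> /(Lp01P hp)[mf lf]; apply/(Lp01P hp); split.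
  by apply: (measurableT_comp (@normr_measurable R setT)).
by apply: eq_L01 lf => t _; rewrite normr_id.
Qed.

Lemma dominating_Lp gamma : Lp01 p (dominating gamma).
Proof.
have cu := @D1_continuous _ _ gamma.1; have cv := @D1_continuous _ _ gamma.2.
apply: (Lp01D hp); first by apply: (Lp01_continuous hp); cont.
by apply: (Lp01D hp); apply: Lp01_norm; exact: wder2_Lp.
Qed.

(* The coefficients of the rotated curve agree to second order in e with
   (1, 0) + e (0, phi), so the difference quotients converge at rate |e|. *)
Lemma variation_error gamma (c dc s ds phi dphi : R -> R) ze eta e K : e != 0 -> 0 <= K ->
  continuous c -> continuous s -> continuous phi ->
  (forall t, 0 <= t <= 1 -> [/\ `|c t - 1| <= K * e ^+ 2, `|s t - e * phi t| <= K * e ^+ 2,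
     `|dc t| <= K * e ^+ 2 & `|ds t - e * dphi t| <= K * e ^+ 2]) ->
  twisted gamma (cpos gamma 0) c dc s ds ze ->
  twisted gamma (0, 0) (fun=> 0) (fun=> 0) phi dphi eta ->
  let M := 3 * (K * `|e| * int01 (fun x => (`|dominating gamma x| `^ p)%R) `^ p^-1) in
  (quotient_error e ze.1 gamma.1 eta.1 <= M%:E)%E /\
  (quotient_error e ze.2 gamma.2 eta.2 <= M%:E)%E.
Proof.
move=> e0 K0 cc cs cphi hb [zx zy zx1 zy1 zx2 zy2] [nx ny nx1 ny1 nx2 ny2].
have cu := @D1_continuous _ _ gamma.1; have cv := @D1_continuous _ _ gamma.2.
(* Errors of the difference quotients of the coefficients; each is O(|e|), and every component of
   the quotient error is linear in them. *)
pose A t := (c t - 1) / e; pose B t := s t / e - phi t.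
pose A2 t := dc t / e; pose B2 t := ds t / e - dphi t.
have cA : continuous A by rewrite /A; cont.
have cB : continuous B by rewrite /B; cont.
have q x : `|x| <= K * e ^+ 2 -> `|x / e| <= K * `|e|.
  rewrite normrM normfV ler_pdivrMr ?normr_gt0// -mulrA -expr2 -normrX (ger0_norm (sqr_ge0 e)).
  by [].
have hAB t : 0 <= t <= 1 -> [/\ `|A t| <= K * `|e|, `|B t| <= K * `|e|,
    `|A2 t| <= K * `|e| & `|B2 t| <= K * `|e|].
  move=> /hb[/q h1 /q h2 /q h3 /q h4]; split => //.
    by rewrite /B (_ : _ - _ = (s t - e * phi t) / e)//; field.
  by rewrite /B2 (_ : _ - _ = (ds t - e * dphi t) / e)//; field.
have Ke : 0 <= K * `|e| by rewrite mulr_ge0.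
pose V := int01 (fun t => `|D1 gamma.1 t| + `|D1 gamma.2 t|).
have V0 : 0 <= V by apply: Rintegral_ge0 => t _; rewrite addr_ge0.
have dom0 t : 0 <= dominating gamma t by rewrite /dominating -/V !addr_ge0.
have two x y (a b : R) : `|a| <= K * `|e| -> `|b| <= K * `|e| -> `|a * x + b * y| <= K * `|e| * (`|x| + `|y|).
  move=> ha hb'; rewrite (le_trans (ler_normD _ _))// !normrM mulrDr.
  by apply: lerD; apply: ler_wpM2r.
have twoI t : 0 <= t <= 1 -> forall (a b : R -> R), continuous a -> continuous b ->
    (forall t, 0 <= t <= 1 -> `|a t| <= K * `|e|) -> (forall t, 0 <= t <= 1 -> `|b t| <= K * `|e|) ->
   `|integral_from0 (fun t => a t * D1 gamma.1 t + b t * D1 gamma.2 t) t| <= K * `|e| * V.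
  move=> ht a b ca cb ha hb'.
  have cn : continuous (fun t => `|D1 gamma.1 t| + `|D1 gamma.2 t|) by cont.
  rewrite /V -int01Z; last exact: L01_continuous.
  by apply: norm_integral_from0_le => //; [cont|cont|move=> z hz; apply: two; [exact: ha|exact: hb']].
have fin x t y : `|x| <= y -> y <= K * `|e| * dominating gamma t -> `|x| <= K * `|e| * `|dominating gamma t|.
  by move=> xy yt; rewrite (ger0_norm (dom0 t)) (le_trans xy).
have leV t : K * `|e| * V <= K * `|e| * dominating gamma t.
  by rewrite ler_wpM2l// /dominating -/V -addrA lerDl !addr_ge0.
have le1 t : K * `|e| * (`|D1 gamma.1 t| + `|D1 gamma.2 t|) <= K * `|e| * dominating gamma t.
  rewrite ler_wpM2l// /dominating -/V.
  have := normr_ge0 (wder2 gamma.1 t); have := normr_ge0 (wder2 gamma.2 t); lra.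
have le2 t : K * `|e| * (`|D1 gamma.1 t| + `|D1 gamma.2 t|) + K * `|e| * (`|wder2 gamma.1 t| + `|wder2 gamma.2 t|) <= K * `|e| * dominating gamma t.
  by rewrite -mulrDr ler_wpM2l// /dominating -/V; have := V0; lra.
split; apply: quotient_error_le => //; try exact: dominating_Lp.
- move=> i t ht; have ht' := oo01W ht.
  have [a1 b1 a2 b2] := hAB t ht'.
  rewrite /wder; case: i => -[|[|[|//]]] /= _.
  + apply: fin (leV t).
    rewrite zx nx (wfun_FTC gamma.1 ht') /cpos /= add0r.
    have -> : integral_from0 (fun t => c t * D1 gamma.1 t - s t * D1 gamma.2 t) t =
      integral_from0 (D1 gamma.1) t + e * integral_from0 (fun t => A t * D1 gamma.1 t + (- B t) * D1 gamma.2 t) t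
       + e * integral_from0 (fun t => 0 * D1 gamma.1 t - phi t * D1 gamma.2 t) t.
      have c1 : continuous (fun t => A t * D1 gamma.1 t + (- B t) * D1 gamma.2 t) by cont.
      have c2 : continuous (fun t => 0 * D1 gamma.1 t - phi t * D1 gamma.2 t) by cont.
      have c3 : continuous (fun t => e * (A t * D1 gamma.1 t + (- B t) * D1 gamma.2 t) + e * (0 * D1 gamma.1 t - phi t * D1 gamma.2 t)) by cont.
      rewrite -[X in X + _ + _]mul1r -addrA -integral_from0_lin// -[X in _ + X]mul1r -integral_from0_lin//.
      congr integral_from0; apply/funext => z; rewrite /A /B; field => //.
    set I1 := integral_from0 _ t; set I2 := integral_from0 _ t; set I3 := integral_from0 _ t.
    have -> : (wfun gamma.1 0 + (I1 + e * I2 + e * I3) - (wfun gamma.1 0 + I1)) / e - I3 = I2 by field.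
    apply: twoI => //; first by cont.
      by move=> z /hAB[].
    by move=> z /hAB[_ + _ _]; rewrite normrN.
  + apply: fin (le1 t); rewrite zx1 nx1 -D1E//.
    have -> : (c t * D1 gamma.1 t - s t * D1 gamma.2 t - D1 gamma.1 t) / e - (0 * D1 gamma.1 t - phi t * D1 gamma.2 t) =
      A t * D1 gamma.1 t + (- B t) * D1 gamma.2 t by rewrite /A /B; field.
    by apply: two; rewrite ?normrN.
  + apply: fin (le2 t); rewrite zx2 nx2.
    rewrite (_ : _ - _ = (A2 t * D1 gamma.1 t + (- B2 t) * D1 gamma.2 t) + (A t * wder2 gamma.1 t + (- B t) * wder2 gamma.2 t)); last first.
      by rewrite /A /B /A2 /B2; field.
    by rewrite (le_trans (ler_normD _ _))// lerD//; apply: two; rewrite ?normrN.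
- move=> i t ht; have ht' := oo01W ht.
  have [a1 b1 a2 b2] := hAB t ht'.
  rewrite /wder; case: i => -[|[|[|//]]] /= _.
  + apply: fin (leV t).
    rewrite zy ny (wfun_FTC gamma.2 ht') /cpos /= add0r.
    have -> : integral_from0 (fun t => s t * D1 gamma.1 t + c t * D1 gamma.2 t) t =
      integral_from0 (D1 gamma.2) t + e * integral_from0 (fun t => B t * D1 gamma.1 t + A t * D1 gamma.2 t) t
       + e * integral_from0 (fun t => phi t * D1 gamma.1 t + 0 * D1 gamma.2 t) t.
      have c1 : continuous (fun t => B t * D1 gamma.1 t + A t * D1 gamma.2 t) by cont.
      have c2 : continuous (fun t => phi t * D1 gamma.1 t + 0 * D1 gamma.2 t) by cont.
      have c3 : continuous (fun t => e * (B t * D1 gamma.1 t + A t * D1 gamma.2 t) + e * (phi t * D1 gamma.1 t + 0 * D1 gamma.2 t)) by cont.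
      rewrite -[X in X + _ + _]mul1r -addrA -integral_from0_lin// -[X in _ + X]mul1r -integral_from0_lin//.
      congr integral_from0; apply/funext => z; rewrite /A /B; field => //.
    set I1 := integral_from0 _ t; set I2 := integral_from0 _ t; set I3 := integral_from0 _ t.
    have -> : (wfun gamma.2 0 + (I1 + e * I2 + e * I3) - (wfun gamma.2 0 + I1)) / e - I3 = I2 by field.
    by apply: twoI => // z /hAB[].
  + apply: fin (le1 t); rewrite zy1 ny1 -D1E//.
    have -> : (s t * D1 gamma.1 t + c t * D1 gamma.2 t - D1 gamma.2 t) / e - (phi t * D1 gamma.1 t + 0 * D1 gamma.2 t) =
      B t * D1 gamma.1 t + A t * D1 gamma.2 t by rewrite /A /B; field.
    exact: two.
  + apply: fin (le2 t); rewrite zy2 ny2.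
    rewrite (_ : _ - _ = (B2 t * D1 gamma.1 t + A2 t * D1 gamma.2 t) + (B t * wder2 gamma.1 t + A t * wder2 gamma.2 t)); last first.
      by rewrite /A /B /A2 /B2; field.
    by rewrite (le_trans (ler_normD _ _))// lerD//; apply: two.
Qed.

End Variations.

(** * Vanishing of the first variation *)

Section EulerLagrange.
Context {R : realType}.
Variable p : R.
Hypothesis hp : 1 < p.
Notation mu := (@lebesgue_measure R).
Notation int01 f := (\int[mu]_(t in `]0, 1[) (f t)).
Implicit Types (f g h phi psi : R -> R) (a b e K M s t x y : R) (gamma eta : curve p).
Variables (P0 P1 : R * R) (L : R) (gamma : curve p).
Hypothesis adm : admissible P0 P1 L gamma.
Hypothesis crit : critical_point P0 P1 L gamma.

Notation u := (D1 gamma.1).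
Notation v := (D1 gamma.2).
Notation W := (fun t => spow (p - 1) (curvature gamma t)).

Definition C1 phi dphi : Prop :=
  (forall t : R, is_derive t (1 : R) phi (dphi t)) /\ continuous dphi.

Lemma C1_continuous phi dphi : C1 phi dphi -> continuous phi.
Proof. by move=> [d _]; exact: is_derive_continuous d. Qed.

(** In K, the term 9 M^2 bounds the quadratic errors, 27 M^3 the product of cos A - 1 with dA, and 2
    C M the deviation of the angle from e f. *)
Lemma rotation_estimates (A dA f df e M C : R)
    (K := 9 * M ^+ 2 + 27 * M ^+ 3 + 2 * C * M) : 0 <= M -> 0 <= C -> `|e| <= 1 ->
  `|A| <= 3 * M * `|e| -> `|A - e * f| <= 2 * C * M * e ^+ 2 ->
  `|dA| <= 3 * M * `|e| -> `|dA - e * df| <= 2 * C * M * e ^+ 2 ->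
  [/\ `|cos A - 1| <= K * e ^+ 2, `|sin A - e * f| <= K * e ^+ 2,
     `|- sin A * dA| <= K * e ^+ 2 & `|cos A * dA - e * df| <= K * e ^+ 2].
Proof.
move=> M0 C0 e1 A1 A2 B1 B2.
have k1 : 0 <= 9 * M ^+ 2 by rewrite mulr_ge0 ?exprn_ge0.
have k2 : 0 <= 27 * M ^+ 3 by rewrite mulr_ge0 ?exprn_ge0.
have k3 : 0 <= 2 * C * M by rewrite !mulr_ge0.
have sq : e ^+ 2 = `|e| ^+ 2 by rewrite -normrX ger0_norm// sqr_ge0.
have n0 : `|0 : R| <= `|A| by rewrite normr0.
have cl := cos_lipschitz (lexx `|A|) n0; rewrite cos0 subr0 -expr2 in cl.
have sl := sinB_lipschitz (lexx `|A|) n0; rewrite sin0 !subr0 -expr2 in sl.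
have aa : `|A| ^+ 2 <= 9 * M ^+ 2 * e ^+ 2.
  rewrite sq (_ : 9 * M ^+ 2 * `|e| ^+ 2 = (3 * M * `|e|) ^+ 2); last by ring.
  by rewrite ler_sqr ?nnegrE// !mulr_ge0.
have ab : `|A| * `|dA| <= 9 * M ^+ 2 * e ^+ 2.
  rewrite sq (_ : 9 * M ^+ 2 * `|e| ^+ 2 = (3 * M * `|e|) * (3 * M * `|e|)); last by ring.
  exact: ler_pM.
have e2 := sqr_ge0 e.
have KE x y z : x <= 9 * M ^+ 2 * e ^+ 2 -> y <= 27 * M ^+ 3 * e ^+ 2 -> z <= 2 * C * M * e ^+ 2 ->
  x + y + z <= K * e ^+ 2.
  by move=> hx hy hz; rewrite /K mulrDl mulrDl; apply: lerD => //; apply: lerD.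
have z2 := mulr_ge0 k2 e2; have z3 := mulr_ge0 k3 e2; have z1 := mulr_ge0 k1 e2.
split.
- by rewrite (le_trans cl)// -[leLHS]addr0 -[leLHS]addr0; apply: KE.
- have -> : sin A - e * f = (sin A - A) + 0 + (A - e * f) by ring.
  rewrite (le_trans (ler_normD _ _))// addr0 -[X in X + _]addr0; apply: KE => //.
  exact: le_trans sl aa.
- rewrite normrM normrN -[leLHS]addr0 -[leLHS]addr0; apply: KE => //.
  apply: le_trans ab; rewrite ler_wpM2r//.
  have := @norm_derive_lipschitz _ sin cos `|A| 1 A 0.
  rewrite sin0 !subr0 mul1r; apply=> // z _; rewrite ler_norml cos_geN1 cos_le1//.
- have -> : cos A * dA - e * df = 0 + (cos A - 1) * dA + (dA - e * df) by ring.
  rewrite (le_trans (ler_normD _ _))// add0r -[X in X + _]add0r; apply: KE => //.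
  rewrite normrM; apply: (@le_trans _ _ (9 * M ^+ 2 * e ^+ 2 * (3 * M * `|e|))).
    by apply: ler_pM => //; exact: le_trans cl aa.
  have -> : 9 * M ^+ 2 * e ^+ 2 * (3 * M * `|e|) = 27 * M ^+ 3 * e ^+ 2 * `|e| by ring.
  by rewrite ler_piMr.
Qed.

Lemma C1_lin phi dphi psi dpsi a b : C1 phi dphi -> C1 psi dpsi ->
  C1 (fun t => a * phi t + b * psi t) (fun t => a * dphi t + b * dpsi t).
Proof.
move=> [d1 c1] [d2 c2]; split; last by cont.
move=> t; apply: (is_derive_eq (derD (derM (derC a t) (d1 t)) (derM (derC b t) (d2 t)))).
ring.
Qed.

Lemma angle_estimates f0 f1 f2 a b e C M t : 0 < C -> C * `|e| <= 1 ->
  `|a| <= C * e ^+ 2 -> `|b| <= C * e ^+ 2 ->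
  `|f0 t| <= M -> `|f1 t| <= M -> `|f2 t| <= M ->
  `|angle f0 f1 f2 e a b t| <= 3 * M * `|e| /\
  `|angle f0 f1 f2 e a b t - e * f0 t| <= 2 * C * M * e ^+ 2.
Proof.
move=> C0 Ce ha hb m0 m1 m2; have mm : 0 <= M by rewrite (le_trans _ m0).
have Cee : C * e ^+ 2 <= `|e|.
  have -> : C * e ^+ 2 = C * `|e| * `|e| by rewrite -mulrA -expr2 -normrX ger0_norm// sqr_ge0.
  by rewrite ler_piMl.
have q1 : `|a * f1 t| <= C * e ^+ 2 * M by rewrite normrM ler_pM.
have q2 : `|b * f2 t| <= C * e ^+ 2 * M by rewrite normrM ler_pM.
have q0 : `|e * f0 t| <= `|e| * M by rewrite normrM ler_wpM2l.
have q3 : C * e ^+ 2 * M <= `|e| * M by rewrite ler_wpM2r.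
split.
  rewrite /angle (le_trans (ler_normD _ _))//.
  have := ler_normD (e * f0 t) (a * f1 t); lra.
rewrite (_ : _ - _ = a * f1 t + b * f2 t); last by rewrite /angle; ring.
rewrite (le_trans (ler_normD _ _))//; lra.
Qed.

Lemma bounded01_3 f0 f1 f2 : continuous f0 -> continuous f1 -> continuous f2 ->
  exists M, [/\ 0 < M, forall t, 0 <= t <= 1 -> `|f0 t| <= M,
    forall t, 0 <= t <= 1 -> `|f1 t| <= M & forall t, 0 <= t <= 1 -> `|f2 t| <= M].
Proof.
move=> /continuous_bounded01[M0 M00 h0] /continuous_bounded01[M1 M10 h1].
move=> /continuous_bounded01[M2 M20 h2].
exists (Num.max M0 (Num.max M1 M2)); split; first by rewrite lt_max M00.
- by move=> t /h0; rewrite le_max => ->.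
- by move=> t /h1; rewrite !le_max => ->; rewrite orbT.
- by move=> t /h2; rewrite !le_max => ->; rewrite !orbT.
Qed.

Lemma rotation_family u v phi dphi psi1 dpsi1 psi2 dpsi2 : continuous u -> continuous v ->
  C1 phi dphi -> C1 psi1 dpsi1 -> C1 psi2 dpsi2 ->
  int01 (fun t => phi t * u t) = 0 -> int01 (fun t => phi t * v t) = 0 ->
  int01 (fun t => psi1 t * u t) = 1 -> int01 (fun t => psi1 t * v t) = 0 ->
  int01 (fun t => psi2 t * u t) = 0 -> int01 (fun t => psi2 t * v t) = 1 ->
  exists C K e0 : R, [/\ 0 < C, 0 <= K, 0 < e0 & forall e, `|e| <= e0 -> exists a b,
    [/\ `|a| <= C * e ^+ 2, `|b| <= C * e ^+ 2,
     int01 (fun t => cos (angle phi psi1 psi2 e a b t) * u t - sin (angle phi psi1 psi2 e a b t) * v t) = int01 u,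
     int01 (fun t => sin (angle phi psi1 psi2 e a b t) * u t + cos (angle phi psi1 psi2 e a b t) * v t) = int01 v &
     forall t, 0 <= t <= 1 ->
      [/\ `|cos (angle phi psi1 psi2 e a b t) - 1| <= K * e ^+ 2,
        `|sin (angle phi psi1 psi2 e a b t) - e * phi t| <= K * e ^+ 2,
        `|- sin (angle phi psi1 psi2 e a b t) * angle dphi dpsi1 dpsi2 e a b t| <= K * e ^+ 2 &
        `|cos (angle phi psi1 psi2 e a b t) * angle dphi dpsi1 dpsi2 e a b t - e * dphi t| <= K * e ^+ 2]]].
Proof.
move=> cu cv hphi h1 h2 pu pv p1u p1v p2u p2v.
have cphi := C1_continuous hphi; have c1 := C1_continuous h1; have c2 := C1_continuous h2.
have [C [e0 [C0 e00 close]]] := closing_angle cu cv cphi c1 c2 pu pv p1u p1v p2u p2v.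
have [M [M0 hM0 hM1 hM2]] := bounded01_3 cphi c1 c2.
have [N [N0 hN0 hN1 hN2]] := bounded01_3 hphi.2 h1.2 h2.2.
pose B := Num.max M N.
have [MB NB] : M <= B /\ N <= B by rewrite /B !le_max !lexx orbT.
have B0 : 0 <= B by rewrite (le_trans _ MB) ?ltW.
pose K := 9 * B ^+ 2 + 27 * B ^+ 3 + 2 * C * B.
have K0 : 0 <= K by rewrite !addr_ge0 ?mulr_ge0 ?exprn_ge0// ltW.
pose e1 := Num.min e0 (Num.min 1 C^-1).
have [e10 e1e0 e11 e1C] : [/\ 0 < e1, e1 <= e0, e1 <= 1 & e1 <= C^-1].
  by rewrite /e1 !lt_min !ge_min !lexx !orbT e00 ltr01 invr_gt0 C0.
exists C, K, e1; split => // e he.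
have [a [b [ha hb E1 E2]]] := close e (le_trans he e1e0).
exists a, b; split => // t ht.
have Ce : C * `|e| <= 1 by rewrite mulrC -ler_pdivlMr// div1r (le_trans he).
have [A1 A2] := angle_estimates C0 Ce ha hb (le_trans (hM0 t ht) MB) (le_trans (hM1 t ht) MB) (le_trans (hM2 t ht) MB).
have [D1 D2] := angle_estimates C0 Ce ha hb (le_trans (hN0 t ht) NB) (le_trans (hN1 t ht) NB) (le_trans (hN2 t ht) NB).
exact: rotation_estimates B0 (ltW C0) (le_trans he e11) A1 A2 D1 D2.
Qed.

Lemma slope_lower_bound (k C e I0 I1 I2 a b J : R) : 0 < k ->
  `|a| <= C * e ^+ 2 -> `|b| <= C * e ^+ 2 ->
  J + e * (k * I0) - k * C * (`|I1| + `|I2|) * e ^+ 2 <= J + k * (e * I0 + a * I1 + b * I2).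
Proof.
move=> k0 ha hb.
have q1 : `|a * I1| <= C * e ^+ 2 * `|I1| by rewrite normrM ler_wpM2r.
have q2 : `|b * I2| <= C * e ^+ 2 * `|I2| by rewrite normrM ler_wpM2r.
have q : - (C * e ^+ 2 * (`|I1| + `|I2|)) <= a * I1 + b * I2.
  by move: q1 q2; rewrite !ler_norml mulrDr => /andP[? _] /andP[? _]; lra.
by rewrite -addrA lerD2l; have := ler_wpM2l (ltW k0) q; lra.
Qed.

Lemma cpos_end (i : 'I_2) (w := if i == 0 then gamma.1 else gamma.2) :
  wfun w 1 = wfun w 0 + int01 (D1 w).
Proof.
rewrite wfun_FTC ?ler01 ?lexx// int01_from0//; apply: continuous_loc_integrable.
exact: D1_continuous.
Qed.

(** The corrected rotations form an admissible differentiable family; criticality gives derivative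
    zero for the energy, while convexity gives slope p times the integral of W dphi from below.
    Corrections a, b of order e^2 do not reach the slope. *)
Lemma variation_family phi dphi psi1 dpsi1 psi2 dpsi2 :
  C1 phi dphi -> C1 psi1 dpsi1 -> C1 psi2 dpsi2 ->
  int01 (fun t => phi t * u t) = 0 -> int01 (fun t => phi t * v t) = 0 ->
  int01 (fun t => psi1 t * u t) = 1 -> int01 (fun t => psi1 t * v t) = 0 ->
  int01 (fun t => psi2 t * u t) = 0 -> int01 (fun t => psi2 t * v t) = 1 ->
  int01 (fun t => W t * dphi t) = 0.
Proof.
move=> hphi h1 h2 pu pv p1u p1v p2u p2v.
have cu : continuous u := @D1_continuous _ _ gamma.1.
have cv : continuous v := @D1_continuous _ _ gamma.2.
have cphi := C1_continuous hphi; have c1 := C1_continuous h1; have c2 := C1_continuous h2.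
have [C [K [e0 [C0 K0 e00 close]]]] := rotation_family cu cv hphi h1 h2 pu pv p1u p1v p2u p2v.
have [im g0 g1 gL] := adm.
pose ang := angle phi psi1 psi2; pose dang := angle dphi dpsi1 dpsi2.
have dA e a b t : is_derive t (1 : R) (ang e a b) (dang e a b t).
  have [d0 _] := hphi; have [d1 _] := h1; have [d2 _] := h2.
  apply: (is_derive_eq (derD (derD (derM (derC e t) (d0 t)) (derM (derC a t) (d1 t))) (derM (derC b t) (d2 t)))).
  by rewrite /dang /angle; ring.
have cdang e a b : continuous (dang e a b).
  by have [_ cd0] := hphi; have [_ cd1] := h1; have [_ cd2] := h2; rewrite /dang /angle; cont.
have cang e a b : continuous (ang e a b) by exact: is_derive_continuous (dA e a b).
(* The family is a choice of curve for each e separately, with gamma itself at e = 0 and outside the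
   radius e0; no regularity in e beyond the estimates is needed. *)
have /choice[G hG] : forall e, exists ze : curve p, (e = 0 -> ze = gamma) /\
   (e != 0 -> `|e| <= e0 -> exists a b, [/\ `|a| <= C * e ^+ 2, `|b| <= C * e ^+ 2,
       admissible P0 P1 L ze, rotated gamma (ang e a b) (dang e a b) (cpos gamma 0) ze &
       forall t, 0 <= t <= 1 -> [/\ `|cos (ang e a b t) - 1| <= K * e ^+ 2,
         `|sin (ang e a b t) - e * phi t| <= K * e ^+ 2,
         `|- sin (ang e a b t) * dang e a b t| <= K * e ^+ 2 &
         `|cos (ang e a b t) * dang e a b t - e * dphi t| <= K * e ^+ 2]]).
  move=> e; have [e00'|en0] := eqVneq e 0; first by exists gamma.
  have [he|he] := leP `|e| e0; last by exists gamma.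
  have [a [b [ha hb E1 E2 est]]] := close e he.
  have dc t : is_derive t (1 : R) (fun t => cos (ang e a b t)) (- sin (ang e a b t) * dang e a b t).
    exact: der_cos.
  have ds t : is_derive t (1 : R) (fun t => sin (ang e a b t)) (cos (ang e a b t) * dang e a b t).
    exact: der_sin.
  have cA := cang e a b; have cdA := cdang e a b.
  have cdc : continuous (fun t => - sin (ang e a b t) * dang e a b t) by cont.
  have cds : continuous (fun t => cos (ang e a b t) * dang e a b t) by cont.
  have [ze tw] := twist_exists hp gamma (cpos gamma 0) dc cdc ds cds.
  exists ze; split=> [e0'|_ _]; first by rewrite e0' eqxx in en0.
  exists a, b; split => //.
  have sp t : 0 <= t <= 1 -> enorm (vel ze t) = enorm (vel gamma t) by exact: rotated_speed tw.
  have [zx zy _ _ _ _] := tw.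
  split.
  - move=> t ht; have := enorm_gt0 (im t ht); rewrite -sp//.
    by apply: contraTneq => ->; rewrite /enorm /= expr0n /= addr0 sqrtr0 ltxx.
  - by rewrite -g0 /cpos zx zy !integral_from0_0 !addr0.
  - rewrite -g1 /cpos zx zy /= -!int01_from0; try by apply: continuous_loc_integrable; cont.
    by rewrite E1 E2 -(cpos_end 0) -(cpos_end 1).
  - rewrite -gL; apply: eq_int01 => t /oo01W; exact: sp.
have G0 : G 0 = gamma by have [h _] := hG 0; exact: h.
have Gadm : \forall e \near (0 : R), admissible P0 P1 L (G e).
  have : \forall e \near (0 : R), `|e| <= e0.
    have /cvgrPdist_le /(_ e0 e00) := @contI R 0.
    by apply: filterS => z; rewrite sub0r normrN.
  apply: filterS => e he; have [->|en] := eqVneq e 0; first by rewrite G0.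
  by have [_ /(_ en he)[a [b []]]] := hG e.
have d1z t : is_derive t (1 : R) (fun=> 0 : R) ((fun=> 0) t) by exact: derC.
(* The derivative of the rotation by e phi at e = 0 has coefficients (0, phi); the base point is (0,
   0) because all curves of the family start at the same point. *)
have [eta tw0] := twist_exists hp gamma (0, 0) d1z (@contC _ 0) hphi.1 hphi.2.
have errs e : e != 0 -> `|e| <= e0 ->
   (quotient_error e (G e).1 gamma.1 eta.1 <= (3 * (K * `|e| * int01 (fun x => (`|dominating gamma x| `^ p)%R) `^ p^-1))%:E)%E /\
   (quotient_error e (G e).2 gamma.2 eta.2 <= (3 * (K * `|e| * int01 (fun x => (`|dominating gamma x| `^ p)%R) `^ p^-1))%:E)%E.
  move=> en he; have [_ /(_ en he)[a [b [_ _ _ tw est]]]] := hG e.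
  have cA := cang e a b.
  by apply: (variation_error hp en K0 _ _ cphi est tw tw0); cont.
have fam : family_derivative G eta.
  pose N := 3 * (K * int01 (fun x => (`|dominating gamma x| `^ p)%R) `^ p^-1).
  rewrite /family_derivative G0.
  apply: (@squeeze_cvge _ _ _ _ (fun=> 0%E) _ (fun e => (`|e| * (N + N))%:E)).
  - have h1' : \forall e \near 0^', e != 0 :> R by exact: nbhs_dnbhs_neq.
    have h2' : \forall e \near (0 : R)^', `|e| <= e0.
      apply: nbhs_dnbhs; have /cvgrPdist_le /(_ e0 e00) := @contI R 0.
      by apply: filterS => z; rewrite sub0r normrN.
    apply: filterS2 h1' h2' => e en he; have [q1 q2] := errs e en he.
    apply/andP; split; first by apply: adde_ge0; exact: quotient_error_ge0.
    rewrite mulrDr EFinD; apply: leeD.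
      by apply: (le_trans q1); rewrite lee_fin /N le_eqVlt; apply/orP; left; apply/eqP; ring.
    by apply: (le_trans q2); rewrite lee_fin /N le_eqVlt; apply/orP; left; apply/eqP; ring.
  - exact: cvg_cst.
  - apply: cvg_EFin; first exact: nearW.
    have cN : continuous (fun e : R => `|e| * (N + N)) by cont.
    have := cN 0; rewrite /continuous_at normr0 mul0r => h.
    by apply: cvg_trans h; apply: cvg_app; exact: nbhs_dnbhs.
have db := crit G0 Gadm fam.
pose I0 := int01 (fun t => W t * dphi t).
pose I1 := int01 (fun t => W t * dpsi1 t).
pose I2 := int01 (fun t => W t * dpsi2 t).
have lW := curvature_spow_L01 hp im.
have p0 : 0 < p := lt_trans ltr01 hp.
suff /eqP : p * I0 = 0 by rewrite mulf_eq0 gt_eqF//= => /eqP.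
apply: (@derive0_slope _ (fun e => bending (G e)) _ (p * C * (`|I1| + `|I2|)) e0 db) => //.
  by rewrite !mulr_ge0// ?addr_ge0//; apply: ltW.
move=> e he; have [->|en] := eqVneq e 0; first by rewrite mul0r expr0n mulr0 addr0 subr0.
have [_ /(_ en he)[a [b [ha hb _ tw _]]]] := hG e.
rewrite G0; apply: le_trans (rotated_bending hp im (cdang e a b) tw).
have -> : int01 (fun t => W t * dang e a b t) = e * I0 + a * I1 + b * I2.
  have l0 : L01 (fun t => W t * dphi t) by apply: L01M => //; exact: hphi.2.
  have l1 : L01 (fun t => W t * dpsi1 t) by apply: L01M => //; exact: h1.2.
  have l2 : L01 (fun t => W t * dpsi2 t) by apply: L01M => //; exact: h2.2.
  rewrite /I0 /I1 /I2 -(int01Z e l0) -(int01Z a l1) -(int01Z b l2).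
  have m0 := L01Z e l0; have m1 := L01Z a l1; have m2 := L01Z b l2.
  rewrite -(int01D m0 m1) -(int01D (L01D m0 m1) m2).
  by apply: eq_int01 => t _; rewrite /dang /angle; ring.
exact: slope_lower_bound.
Qed.

End EulerLagrange.

(** * Lagrange multipliers for the endpoint condition *)

Section Multipliers.
Context {R : realType}.
Variable p : R.
Hypothesis hp : 1 < p.
Notation mu := (@lebesgue_measure R).
Notation int01 f := (\int[mu]_(t in `]0, 1[) (f t)).
Implicit Types (f g h phi psi : R -> R) (a b e K M s t x y : R) (gamma eta : curve p).

Lemma integral_from0_zero f : continuous f ->
  (forall t, 0 <= t <= 1 -> integral_from0 f t = 0) -> forall t, 0 <= t <= 1 -> f t = 0.
Proof.
move=> cf If; apply: (continuous_eq01 cf (@contC R 0)) => t ht.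
have d1 : is_derive t (1 : R) (integral_from0 f) (f t).
  by apply: is_derive_integral_from0; [exact: continuous_loc_integrable|exact: cf].
have d2 : is_derive t (1 : R) (integral_from0 f) 0.
  by apply: (der_eq_oo ht _ (derC 0 t)) => z hz; rewrite If//; lra.
rewrite -(@derive_val _ _ _ _ _ _ _ d1); exact: (@derive_val _ _ _ _ _ _ _ d2).
Qed.

Lemma fundamental_lemma f : continuous f ->
  (forall phi dphi, C1 phi dphi -> int01 (fun t => phi t * f t) = 0) ->
  forall t, 0 <= t <= 1 -> f t = 0.
Proof.
move=> cf H; apply: integral_from0_zero => // t /andP[t0 t1].
rewrite -primitive01_continuous ?t0//.
have lf := L01_continuous cf.
have := int01_window lf (lexx 0) t0 t1; rewrite primitive01_0 subr0 => c.
have z : int01 (fun x => f x * window n 0 t x) @[n --> \oo] --> (0 : R).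
  apply: cvg_near_cst; apply: nearW => n.
  have cb := @continuous_hump R.
  have c3 a : continuous (fun x => n%:R * hump (n%:R * (x - a))).
    by apply: contM; [cont|apply: (@cont_comp _ hump) => //; cont].
  have c4 := c3 0; have c5 := c3 t.
  have hw : C1 (window n 0 t) (fun x => n%:R * hump (n%:R * (x - 0)) - n%:R * hump (n%:R * (x - t))).
    split; last by cont.
    by move=> x; exact: derD (is_derive_ramp _ _ _) (derN (is_derive_ramp _ _ _)).
  by rewrite -[RHS](H _ _ hw); apply: eq_int01 => x _; rewrite mulrC.
exact: (cvg_unique _ c z).
Qed.

(** The pair of functionals phi -> (int phi u, int phi v) has rank two or not. If not, a fixed
    linear combination of u and v is orthogonal to all C^1 functions and hence zero. *)
Lemma dual_variations (u v : R -> R) : continuous u -> continuous v ->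
  (exists n1 n2 : R, (n1 != 0) || (n2 != 0) /\ forall t, 0 <= t <= 1 -> n1 * u t + n2 * v t = 0) \/
  (exists psi1 dpsi1 psi2 dpsi2, [/\ C1 psi1 dpsi1, C1 psi2 dpsi2 & [/\
    int01 (fun t => psi1 t * u t) = 1, int01 (fun t => psi1 t * v t) = 0,
    int01 (fun t => psi2 t * u t) = 0 & int01 (fun t => psi2 t * v t) = 1]]).
Proof.
move=> cu cv.
pose lu f := int01 (fun t => f t * u t); pose lv f := int01 (fun t => f t * v t).
have lin f g (z : R -> R) a b : continuous f -> continuous g -> continuous z ->
    int01 (fun t => (a * f t + b * g t) * z t) = a * int01 (fun t => f t * z t) + b * int01 (fun t => g t * z t).
  move=> cf cg cz; have l1 : L01 (fun t => f t * z t) by apply: L01_continuous; cont.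
  have l2 : L01 (fun t => g t * z t) by apply: L01_continuous; cont.
  rewrite -(int01Z a l1) -(int01Z b l2) -(int01D (L01Z a l1) (L01Z b l2)).
  by apply: eq_int01 => t _; ring.
have [[f [df [hf nz]]]|nex] := pselect (exists f df, C1 f df /\ (lu f != 0) || (lv f != 0)); last first.
  left; exists 1, 0; rewrite oner_neq0; split => // t ht; rewrite mul1r mul0r addr0.
  apply: (fundamental_lemma cu) ht => phi dphi hphi.
  apply/eqP/negPn/negP => h; apply: nex; exists phi, dphi; split => //.
  by rewrite /lu h.
have cf := C1_continuous hf.
have [[g [dg [hg det]]]|nex] := pselect (exists g dg, C1 g dg /\ lu f * lv g - lv f * lu g != 0); last first.
  left; exists (- lv f), (lu f); rewrite oppr_eq0 orbC; split => // t ht.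
  have cF : continuous (fun t => - lv f * u t + lu f * v t) by cont.
  apply: (fundamental_lemma cF) ht => phi dphi hphi.
  have cphi := C1_continuous hphi.
  have -> : int01 (fun t => phi t * (- lv f * u t + lu f * v t)) = lu f * lv phi - lv f * lu phi.
    have l1 : L01 (fun t => phi t * u t) by apply: L01_continuous; cont.
    have l2 : L01 (fun t => phi t * v t) by apply: L01_continuous; cont.
    rewrite /(lv phi) /(lu phi) -(int01Z (lu f) l2) -(int01Z (lv f) l1) -(int01B (L01Z (lu f) l2) (L01Z (lv f) l1)).
    by apply: eq_int01 => z _; ring.
  by apply/eqP/negPn/negP => h; apply: nex; exists phi, dphi.
right; have cg := C1_continuous hg.
set D := lu f * lv g - lv f * lu g in det.
(* Cramer's rule for the two-by-two system with determinant D. *)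
exists (fun t => (lv g / D) * f t + (- lv f / D) * g t), (fun t => (lv g / D) * df t + (- lv f / D) * dg t).
exists (fun t => (- lu g / D) * f t + (lu f / D) * g t), (fun t => (- lu g / D) * df t + (lu f / D) * dg t).
split; [exact: C1_lin|exact: C1_lin|].
split; rewrite lin// -/(lu f) -/(lv f) -/(lu g) -/(lv g).
- have -> : lv g / D * lu f + - lv f / D * lu g = D / D by rewrite {3}/D; ring.
  by rewrite mulfV.
- by ring.
- by ring.
- have -> : - lu g / D * lv f + lu f / D * lv g = D / D by rewrite {3}/D; ring.
  by rewrite mulfV.
Qed.

Variables (P0 P1 : R * R) (L : R) (gamma : curve p).
Hypothesis adm : admissible P0 P1 L gamma.

Notation u := (D1 gamma.1).
Notation v := (D1 gamma.2).

Lemma endpoints : P1.1 - P0.1 = int01 u /\ P1.2 - P0.2 = int01 v.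
Proof.
have [_ <- <- _] := adm; have := cpos_end gamma 0; have := cpos_end gamma 1.
by rewrite /cpos /= => -> ->; rewrite !(addrC (_ 0)) !addrK.
Qed.

(** The velocity stays on one line and, being nonzero and continuous, keeps its direction; length
    and chord then agree. Under |P0 - P1| < L this case is impossible. *)
Lemma straight_chord n1 n2 : (n1 != 0) || (n2 != 0) ->
  (forall t, 0 <= t <= 1 -> n1 * u t + n2 * v t = 0) -> enorm (P0 - P1) = L.
Proof.
move=> n0 nz; have [im _ _ gL] := adm.
have cu : continuous u := @D1_continuous _ _ gamma.1.
have cv : continuous v := @D1_continuous _ _ gamma.2.
pose N := n1 ^+ 2 + n2 ^+ 2.
have N0 : 0 < N.
  case/orP: n0 => h; first by rewrite ltr_pwDl ?sqr_ge0// exprn_even_gt0.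
  by rewrite ltr_wpDl ?sqr_ge0// exprn_even_gt0.
(* The coordinate of the velocity along (- n2, n1), normalized by N. *)
pose l t := (- n2 * u t + n1 * v t) / N.
have cl : continuous l by rewrite /l; cont.
have uE t : 0 <= t <= 1 -> u t = - n2 * l t.
  move=> ht; have -> : - n2 * l t = u t - n1 * (n1 * u t + n2 * v t) / N.
    by rewrite /l /N; field; rewrite gt_eqF.
  by rewrite nz// mulr0 mul0r subr0.
have vE t : 0 <= t <= 1 -> v t = n1 * l t.
  move=> ht; have -> : n1 * l t = v t - n2 * (n1 * u t + n2 * v t) / N.
    by rewrite /l /N; field; rewrite gt_eqF.
  by rewrite nz// mulr0 mul0r subr0.
have l0 t : 0 < t < 1 -> l t != 0.
  move=> ht; have ht' := oo01W ht.
  apply: contraNneq (im t ht') => h; rewrite vel_D1// uE// vE// h !mulr0.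
  exact/eqP.
have sp t : 0 < t < 1 -> enorm (vel gamma t) = Num.sqrt N * `|l t|.
  move=> ht; have ht' := oo01W ht.
  rewrite vel_D1// /enorm /= uE// vE//.
  have -> : (- n2 * l t) ^+ 2 + (n1 * l t) ^+ 2 = N * l t ^+ 2 by rewrite /N; ring.
  by rewrite sqrtrM ?ltW// sqrtr_sqr.
have Lint : L = Num.sqrt N * `|int01 l|.
  have ll := L01_continuous cl.
  have h : `|int01 l| = int01 (fun t => `|l t|).
    have [pos|neg] := ivt_const_sign cl l0.
      rewrite ger0_norm; last by apply: Rintegral_ge0 => t; rewrite /= in_itv /= => /pos/ltW.
      by apply: eq_int01 => t /pos h; rewrite gtr0_norm.
    have -> : int01 l = - int01 (fun t => `|l t|).
      rewrite -int01N; last exact: L01_norm.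
      by apply: eq_int01 => t /neg h; rewrite ltr0_norm// opprK.
    by rewrite normrN ger0_norm//; apply: Rintegral_ge0 => t _.
  rewrite h -int01Z; last exact: L01_norm.
  by rewrite -gL; apply: eq_int01 => t ht; rewrite sp.
have [e1 e2] := endpoints.
have I1 : P1.1 - P0.1 = - n2 * int01 l.
  by rewrite e1 -int01Z; [apply: eq_int01 => t ht; rewrite uE//; lra|exact: L01_continuous].
have I2 : P1.2 - P0.2 = n1 * int01 l.
  by rewrite e2 -int01Z; [apply: eq_int01 => t ht; rewrite vE//; lra|exact: L01_continuous].
rewrite Lint /enorm /=.
have -> : (P0.1 - P1.1) ^+ 2 + (P0.2 - P1.2) ^+ 2 = N * int01 l ^+ 2.
  rewrite -sqrrN opprB I1 -[X in _ + X]sqrrN opprB I2 /N; ring.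
by rewrite sqrtrM ?ltW// sqrtr_sqr.
Qed.

Hypothesis crit : critical_point P0 P1 L gamma.
Hypothesis short : enorm (P0 - P1) < L.

(** The values m1, m2 on the dual functions are the multipliers. The du Bois-Reymond lemma gives the
    affine form without constant term, and its mean-zero conclusion is the vanishing at P1. *)
Theorem euler_lagrange : exists a b : R,
  {ae mu, forall t, 0 < t < 1 -> spow (p - 1) (curvature gamma t) =
     a * (wfun gamma.1 t - P0.1) + b * (wfun gamma.2 t - P0.2)} /\
  a * (P1.1 - P0.1) + b * (P1.2 - P0.2) = 0.
Proof.
have cu : continuous u := @D1_continuous _ _ gamma.1.
have cv : continuous v := @D1_continuous _ _ gamma.2.
have [im g0 _ _] := adm.
have [[n1 [n2 [n0 nz]]]|[f1 [df1 [f2 [df2 [h1 h2 [f1u f1v f2u f2v]]]]]]] := dual_variations cu cv.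
  by move: short; rewrite (straight_chord n0 nz) ltxx.
pose W t := spow (p - 1) (curvature gamma t).
have lW : L01 W := curvature_spow_L01 hp im.
pose m1 := int01 (fun t => W t * df1 t); pose m2 := int01 (fun t => W t * df2 t).
have c1 := C1_continuous h1; have c2 := C1_continuous h2.
have key phi dphi : C1 phi dphi -> int01 (fun t => W t * dphi t) =
   m1 * int01 (fun t => phi t * u t) + m2 * int01 (fun t => phi t * v t).
  move=> hphi; have cphi := C1_continuous hphi.
  set A := int01 (fun t => phi t * u t); set B := int01 (fun t => phi t * v t).
  (* Subtracting the dual combination puts an arbitrary phi into the kernel of both endpoint
     functionals. *)
  pose psi t := 1 * phi t + (-1) * (A * f1 t + B * f2 t).
  pose dpsi t := 1 * dphi t + (-1) * (A * df1 t + B * df2 t).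
  have hpsi : C1 psi dpsi by apply: C1_lin => //; apply: C1_lin.
  have val (z : R -> R) : continuous z -> int01 (fun t => psi t * z t) = int01 (fun t => phi t * z t)
     - A * int01 (fun t => f1 t * z t) - B * int01 (fun t => f2 t * z t).
    move=> cz; have l0 : L01 (fun t => phi t * z t) by apply: L01_continuous; cont.
    have l1 : L01 (fun t => f1 t * z t) by apply: L01_continuous; cont.
    have l2 : L01 (fun t => f2 t * z t) by apply: L01_continuous; cont.
    rewrite -(int01Z A l1) -(int01Z B l2) -(int01B l0 (L01Z A l1)) -(int01B (L01B l0 (L01Z A l1)) (L01Z B l2)).
    by apply: eq_int01 => t _; rewrite /psi; ring.
  have := variation_family hp adm crit hpsi h1 h2 _ _ f1u f1v f2u f2v.
  rewrite (val u cu) (val v cv) f1u f1v f2u f2v => /(_ _ _)/wrap[||].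
  - by rewrite /A; ring.
  - by rewrite /B; ring.
  have l0 : L01 (fun t => W t * dphi t) by apply: L01M => //; exact: hphi.2.
  have l1 : L01 (fun t => W t * df1 t) by apply: L01M => //; exact: h1.2.
  have l2 : L01 (fun t => W t * df2 t) by apply: L01M => //; exact: h2.2.
  have -> : int01 (fun t => spow (p - 1) (curvature gamma t) * dpsi t) = int01 (fun t => W t * dphi t) - A * m1 - B * m2.
    rewrite -(int01Z A l1) -(int01Z B l2) -(int01B l0 (L01Z A l1)) -(int01B (L01B l0 (L01Z A l1)) (L01Z B l2)).
    by apply: eq_int01 => t _; rewrite /dpsi /W; ring.
  lra.
pose g t := (- m1) * u t + (- m2) * v t.
have cg : continuous g by rewrite /g; cont.
have [|gz ae] := du_bois_reymond lW cg.
  move=> phi dphi hd cd; have hphi : C1 phi dphi by split.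
  have cphi := C1_continuous hphi.
  have lu : L01 (fun t => phi t * u t) by apply: L01_continuous; cont.
  have lv : L01 (fun t => phi t * v t) by apply: L01_continuous; cont.
  have -> : int01 (fun t => g t * phi t) = (- m1) * int01 (fun t => phi t * u t) + (- m2) * int01 (fun t => phi t * v t).
    rewrite -(int01Z (- m1) lu) -(int01Z (- m2) lv) -(int01D (L01Z (- m1) lu) (L01Z (- m2) lv)).
    by apply: eq_int01 => t _; rewrite /g; ring.
  rewrite (key phi dphi)//; ring.
have gI t : 0 <= t <= 1 -> integral_from0 g t =
   (- m1) * (wfun gamma.1 t - P0.1) + (- m2) * (wfun gamma.2 t - P0.2).
  move=> ht; have e1 := wfun_FTC gamma.1 ht; have e2 := wfun_FTC gamma.2 ht.
  have [p1 p2] : wfun gamma.1 0 = P0.1 /\ wfun gamma.2 0 = P0.2 by rewrite -g0.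
  rewrite e1 e2 p1 p2 [LHS](integral_from0_lin _ _ t cu cv).
  by set X := integral_from0 _ _; set Y := integral_from0 _ _; ring.
exists (- m1), (- m2); split.
  by apply: ae_sub ae => t h ht; rewrite -/(W t) h// gI//; lra.
have := gI 1; rewrite ler01 lexx => /(_ isT).
rewrite -int01_from0; last exact: continuous_loc_integrable.
by rewrite gz; have [_ _ <- _] := adm.
Qed.

End Multipliers.

(** * Reduction of critical points to the elastica system *)

Section TangentAngle.
Context {R : realType}.
Variable p : R.
Hypothesis hp : 1 < p.
Notation mu := (@lebesgue_measure R).
Notation int01 f := (\int[mu]_(t in `]0, 1[) (f t)).
Implicit Types (f g h phi psi u v : R -> R) (a b c e K M s t x y : R) (gamma eta : curve p).

Lemma weak_derivative_ae u v w : L01 v -> L01 w ->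
  {ae mu, forall t, 0 < t < 1 -> v t = w t} -> weak_derivative u v -> weak_derivative u w.
Proof.
move=> lv lw vw d phi tp; have cp := test_function_continuous tp.
rewrite d//; congr (- _); apply: eq_ae_int01; [exact: L01M|exact: L01M|].
by apply: ae_sub vw => t h /h ->.
Qed.

Lemma primitive01_increment f g M a c : L01 f -> L01 g -> 0 <= a -> a <= c -> c <= 1 ->
  (forall t, a <= t <= c -> `|f t| <= M * `|g t|) ->
  `|primitive01 f c - primitive01 f a| <=
  M * (primitive01 (fun t => `|g t|) c - primitive01 (fun t => `|g t|) a).
Proof.
move=> lf lg a0 ac c1 fg.
have lgn := L01_norm lg.
have ef := loc_integrable_extend0 lf; have eg := loc_integrable_extend0 lgn.
rewrite /primitive01 !integral_from0B//.
rewrite (le_trans (le_normr_Rintegral _ (ef a c)))//.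
rewrite -RintegralZl//; apply: le_Rintegral => //.
- exact: (integrable_norm (ef a c)).
- exact: (integrableZl _ M (eg a c)).
move=> t; rewrite /= in_itv /= => ht; rewrite /extend0 !patchE.
by case: ifP => _; rewrite ?normr0 ?mulr0//; exact: fg.
Qed.

(* r is only integrable, so the estimate is run to the right of the last zero of d,
   where the primitive of |r| increases by less than 1/2. *)
Lemma gronwall01 d r : continuous d -> L01 r ->
  (forall t, 0 <= t <= 1 -> d t = primitive01 (fun t => r t * d t) t) ->
  forall t, 0 <= t <= 1 -> d t = 0.
Proof.
move=> cd lr dE t /andP[t0 t1]; apply/eqP/negPn/negP => dt.
have d0 : d 0 = 0 by rewrite dE ?primitive01_0// lexx ler01.
have [a [/andP[a0 at_] da nz]] := last_zero cd t0 dt d0.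
pose F := primitive01 (fun t => `|r t|).
have cF : continuous F := continuous_primitive01 (L01_norm lr).
have lrd : L01 (fun t => r t * d t) by exact: L01M.
have [e e0 he] : exists2 e, 0 < e & forall x, a <= x < a + e -> F x - F a <= 1 / 2.
  have := cF a; move/cvgrPdist_le => /(_ (1/2)) [//|e /= e0 he]; exists e => // x hx.
  have := he x; rewrite /ball_ /= distrC => /(_ _)/wrap[|h].
    by rewrite ger0_norm; lra.
  by rewrite (le_trans (ler_norm _))// distrC.
pose b := Num.min (a + e / 2) t.
have [ab bt be] : [/\ a < b, b <= t & b < a + e].
  rewrite /b lt_min at_ ge_min lexx orbT gt_min; split => //; [lra|apply/orP; left; lra].
have cn : continuous (fun t => `|d t|) by cont.
(* At a maximum of |d| on [a, b] the integral equation gives |d c| <= |d c|/2, so d vanishes on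
   [a, b], against the choice of a. *)
have [c /[!in_itv]/= hc hmax] := EVT_max (ltW ab) (continuous_subspaceT cn).
have c1 : c <= 1 by lra.
have hcc : 0 <= c <= 1 by lra.
have haa : 0 <= a <= 1 by lra.
have := @primitive01_increment (fun t => r t * d t) r `|d c| a c lrd lr a0 _ c1.
move=> /(_ _ _)/wrap[|x hx|].
- by case/andP: hc.
- by rewrite normrM mulrC ler_wpM2r// hmax// in_itv /=; lra.
rewrite -(dE c hcc) -(dE a haa) da subr0 -/F => h.
have h2 : F c - F a <= 1 / 2 by apply: he; lra.
have dc : `|d c| = 0.
  by apply/eqP; rewrite eq_le normr_ge0 andbT; have := normr_ge0 (d c); nra.
have := nz b; rewrite ab bt => /(_ isT); apply/negP; rewrite negbK -normr_eq0.
have bb : b \in `[a, b] by rewrite in_itv /= lexx ltW.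
by rewrite eq_le normr_ge0 andbT -dc; exact: hmax.
Qed.

Lemma polar_angle a b : a ^+ 2 + b ^+ 2 = 1 -> exists th : R, cos th = a /\ sin th = b.
Proof.
move=> ab; have a1 : -1 <= a <= 1 by rewrite -ler_norml -(expr_le1 (n := 2))// -normrX ger0_norm ?sqr_ge0//; nra.
have ca : cos (acos a) = a by rewrite acosK// in_itv.
have sa : sin (acos a) = `|b|.
  by rewrite sin_acos// -ab addrAC subrr add0r sqrtr_sqr.
have [b0|b0] := leP 0 b; first by exists (acos a); rewrite ca sa ger0_norm.
by exists (- acos a); rewrite cosN sinN ca sa ltr0_norm// opprK.
Qed.

Definition speed gamma t : R := enorm (D1 gamma.1 t, D1 gamma.2 t).

Lemma continuous_speed gamma : continuous (speed gamma).
Proof. exact: speed_continuous. Qed.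

Lemma speed_vel gamma t : 0 <= t <= 1 -> speed gamma t = enorm (vel gamma t).
Proof. by move=> ht; rewrite vel_D1. Qed.

Lemma speed_gt0 gamma t : immersed gamma -> 0 < speed gamma t.
Proof.
move=> im; have h := im (clamp t) (clamp01 t).
exact: enorm_gt0.
Qed.

(* With A the primitive of speed * k, the vector obtained by rotating the velocity by
   - A satisfies s' = r s with r scalar and integrable; hence its direction is fixed. *)
Lemma tangent_angle gamma k : immersed gamma -> continuous k ->
  {ae mu, forall t, 0 < t < 1 -> curvature gamma t = k t} ->
  exists th0 : R, forall t, 0 <= t <= 1 ->
    D1 gamma.1 t = speed gamma t * cos (th0 + integral_from0 (fun t => speed gamma t * k t) t) /\
    D1 gamma.2 t = speed gamma t * sin (th0 + integral_from0 (fun t => speed gamma t * k t) t).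
Proof.
move=> im ck ae.
set u := D1 gamma.1; set v := D1 gamma.2; set sp := speed gamma.
have cu : continuous u := @D1_continuous _ _ gamma.1.
have cv : continuous v := @D1_continuous _ _ gamma.2.
have csp : continuous sp := @continuous_speed gamma.
have sp0 t : 0 < sp t := speed_gt0 t im.
have sp2 t : sp t ^+ 2 = u t ^+ 2 + v t ^+ 2 by rewrite /sp /speed enorm_sqr.
pose u2 := wder2 gamma.1; pose v2 := wder2 gamma.2.
have lu2 : L01 u2 := wder2_L01 hp gamma.1.
have lv2 : L01 v2 := wder2_L01 hp gamma.2.
have csk : continuous (fun t => sp t * k t) by cont.
pose A := integral_from0 (fun t => sp t * k t); rewrite -/A.
have dA t : is_derive t (1 : R) A (sp t * k t).
  by apply: is_derive_integral_from0; [exact: continuous_loc_integrable|exact: csk].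
have cA : continuous A := is_derive_continuous dA.
have A0 : A 0 = 0 by rewrite /A integral_from0_0.
(* Coefficients of u and v in the determinant of the back-rotated velocity with the initial
   velocity; [d] below is this determinant and should vanish. *)
pose C t := cos (A t) * v 0 + sin (A t) * u 0.
pose D t := sin (A t) * v 0 - cos (A t) * u 0.
have dC t : is_derive t (1 : R) C (- (sp t * k t) * D t).
  apply: (is_derive_eq (derD (derM (der_cos (dA t)) (derC (v 0) t)) (derM (der_sin (dA t)) (derC (u 0) t)))).
  by rewrite /D; ring.
have dD t : is_derive t (1 : R) D (sp t * k t * C t).
  apply: (is_derive_eq (derD (derM (der_sin (dA t)) (derC (v 0) t)) (derN (derM (der_cos (dA t)) (derC (u 0) t))))).
  by rewrite /C; ring.
have cC : continuous C := is_derive_continuous dC.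
have cD : continuous D := is_derive_continuous dD.
have cdC : continuous (fun t => - (sp t * k t) * D t) by cont.
have cdD : continuous (fun t => sp t * k t * C t) by cont.
pose d t := C t * u t + D t * v t.
have cd : continuous d by rewrite /d; cont.
(* The logarithmic derivative of the speed. Rotating by - A removes the normal part of the
   acceleration, so only this scalar factor remains. *)
pose r t := u t / sp t ^+ 2 * u2 t + v t / sp t ^+ 2 * v2 t.
have ci : continuous (fun t => (sp t ^+ 2)^-1).
  by apply: contV => [|t]; [cont|rewrite expf_neq0// gt_eqF].
have lr : L01 r.
  have c1 : continuous (fun t => u t / sp t ^+ 2) by apply: contM.
  have c2 : continuous (fun t => v t / sp t ^+ 2) by apply: contM.
  by apply: L01D; apply: L01Mr.
have w1 := weak_derivative_mul cu lu2 dC cdC (@D1_weak _ _ gamma.1).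
have w2 := weak_derivative_mul cv lv2 dD cdD (@D1_weak _ _ gamma.2).
have l1 : L01 (fun t => - (sp t * k t) * D t * u t + C t * u2 t).
  by apply: L01D; [apply: L01_continuous; cont|exact: L01Mr].
have l2 : L01 (fun t => sp t * k t * C t * v t + D t * v2 t).
  by apply: L01D; [apply: L01_continuous; cont|exact: L01Mr].
have c1 : continuous (fun t => C t * u t) by cont.
have c2 : continuous (fun t => D t * v t) by cont.
have w := weak_derivativeD c1 l1 c2 l2 w1 w2.
have lrd : L01 (fun t => r t * d t) by exact: L01M.
have wd : weak_derivative d (fun t => r t * d t).
  apply: (weak_derivative_ae (L01D l1 l2) lrd _ w); apply: ae_sub ae => t h ht.
  have ht' := oo01W ht.
  have kE : k t * sp t ^+ 3 = u t * v2 t - v t * u2 t.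
    rewrite -h// /curvature -speed_vel// -/sp /= -!D1E// -/u -/v -/u2 -/v2.
    by rewrite mulfVK// expf_neq0// gt_eqF.
  have spn : sp t != 0 by rewrite gt_eqF.
  apply: (mulfI (expf_neq0 2 spn)).
  rewrite (_ : sp t ^+ 2 * (r t * d t) = (u t * u2 t + v t * v2 t) * d t); last first.
    by rewrite /r; field.
  transitivity (k t * sp t ^+ 3 * (C t * v t - D t * u t) + sp t ^+ 2 * (C t * u2 t + D t * v2 t)).
    by ring.
  by rewrite kE sp2 /d; ring.
have d0 t : 0 <= t <= 1 -> d t = 0.
  apply: (gronwall01 cd lr) => z hz.
  rewrite (weak_derivative_FTC cd lrd wd hz) /d /C /D A0 cos0 sin0; ring.
pose s1 t := cos (A t) * u t + sin (A t) * v t.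
pose s2 t := - sin (A t) * u t + cos (A t) * v t.
have cs t := cos2Dsin2 (A t).
have s12 t : s1 t ^+ 2 + s2 t ^+ 2 = sp t ^+ 2.
  rewrite (_ : _ + _ = (cos (A t) ^+ 2 + sin (A t) ^+ 2) * (u t ^+ 2 + v t ^+ 2)).
    by rewrite cs sp2 mul1r.
  by rewrite /s1 /s2; ring.
have det t : 0 <= t <= 1 -> s1 t * v 0 - s2 t * u 0 = 0.
  by move=> /d0 h; rewrite -[RHS]h /d /C /D /s1 /s2; ring.
(* The inner product with the initial velocity. Vanishing of the determinant gives parallel vectors
   only; positivity of c excludes opposite ones. *)
pose c t := s1 t * u 0 + s2 t * v 0.
have c2E t : 0 <= t <= 1 -> c t ^+ 2 = sp t ^+ 2 * sp 0 ^+ 2.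
  move=> ht; rewrite -s12 [X in _ * X]sp2.
  have -> : (s1 t ^+ 2 + s2 t ^+ 2) * (u 0 ^+ 2 + v 0 ^+ 2) = c t ^+ 2 + (s1 t * v 0 - s2 t * u 0) ^+ 2.
    by rewrite /c; ring.
  by rewrite det// expr0n addr0.
have cs1 : continuous s1 := contD (contM (cont_cos cA) cu) (contM (cont_sin cA) cv).
have cs2 : continuous s2 := contD (contM (contN (cont_sin cA)) cu) (contM (cont_cos cA) cv).
have cc : continuous c := contD (contM cs1 (@contC R (u 0))) (contM cs2 (@contC R (v 0))).
have cpos t : 0 <= t <= 1 -> 0 < c t.
  have c0 : 0 < c 0 by rewrite /c /s1 /s2 A0 cos0 sin0 mul1r !mul0r oppr0 mul0r mul1r addr0 add0r -!expr2 -sp2 exprn_gt0.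
  have cn z : 0 <= z <= 1 -> c z != 0.
    move=> hz; rewrite -sqrf_eq0 c2E// mulf_neq0// expf_neq0// gt_eqF//.
  move=> /andP[t0 t1]; rewrite lt_def cn ?t0//= leNgt; apply/negP => ct.
  have [|z /[!in_itv]/= hz cz] := @IVT _ c 0 t 0 t0 (continuous_subspaceT cc).
    by rewrite ge_min le_max (ltW ct) (ltW c0) orbT.
  have := cn z; rewrite cz eqxx => /(_ _)/wrap[|//]; lra.
have cE t : 0 <= t <= 1 -> c t = sp t * sp 0.
  move=> ht; apply/eqP; rewrite -(eqrXn2 (n := 2))// ?(ltW (cpos t ht))//.
    by rewrite c2E// exprMn.
  by rewrite mulr_ge0// ltW.
have sp00 := sp0 0.
have [th0 [th0c th0s]] : exists th : R, cos th = u 0 / sp 0 /\ sin th = v 0 / sp 0.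
  by apply: polar_angle; rewrite !expr_div_n -mulrDl -sp2 mulfV// expf_neq0// gt_eqF.
exists th0 => t ht.
have spn : sp 0 != 0 by rewrite gt_eqF.
have s1E : s1 t * sp 0 ^+ 2 = sp t * sp 0 * u 0.
  rewrite -cE// sp2; have := det t ht; rewrite /c.
  move=> h; apply/eqP; rewrite -subr_eq0; apply/eqP.
  transitivity (v 0 * (s1 t * v 0 - s2 t * u 0)); first by ring.
  by rewrite h mulr0.
have s2E : s2 t * sp 0 ^+ 2 = sp t * sp 0 * v 0.
  rewrite -cE// sp2; have := det t ht; rewrite /c.
  move=> h; apply/eqP; rewrite -subr_eq0; apply/eqP.
  transitivity (- u 0 * (s1 t * v 0 - s2 t * u 0)); first by ring.
  by rewrite h mulr0.
have s1E' : s1 t = sp t * cos th0.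
  by apply: (mulIf (expf_neq0 2 spn)); rewrite s1E th0c; field.
have s2E' : s2 t = sp t * sin th0.
  by apply: (mulIf (expf_neq0 2 spn)); rewrite s2E th0s; field.
rewrite cosD sinD; split.
  have -> : u t = (cos (A t) ^+ 2 + sin (A t) ^+ 2) * u t by rewrite cs mul1r.
  rewrite (_ : _ * u t = cos (A t) * s1 t - sin (A t) * s2 t); last by rewrite /s1 /s2; ring.
  by rewrite s1E' s2E'; ring.
have -> : v t = (cos (A t) ^+ 2 + sin (A t) ^+ 2) * v t by rewrite cs mul1r.
rewrite (_ : _ * v t = sin (A t) * s1 t + cos (A t) * s2 t); last by rewrite /s1 /s2; ring.
by rewrite s1E' s2E'; ring.
Qed.

End TangentAngle.

(** * Rotation, scaling and arclength parametrization *)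

Section Reduction.
Context {R : realType}.
Variable p : R.
Hypothesis hp : 1 < p.
Notation mu := (@lebesgue_measure R).
Notation int01 f := (\int[mu]_(t in `]0, 1[) (f t)).
Implicit Types (f g h : R -> R) (a b c e K M s t x y : R).

(** Used for the inverse of scaled arclength; the uniform lower bound m makes the primitive onto the
    whole line, so the inverse is differentiable everywhere. *)
Lemma primitive_inverse f m : continuous f -> 0 < m -> (forall t, m <= f t) ->
  exists g, [/\ forall t, g (integral_from0 f t) = t, forall s, integral_from0 f (g s) = s &
    forall s, is_derive s (1 : R) g (f (g s))^-1].
Proof.
move=> cf m0 fm; pose F := integral_from0 f.
have dF t : is_derive t (1 : R) F (f t).
  by apply: is_derive_integral_from0; [exact: continuous_loc_integrable|exact: cf].
have cF : continuous F := is_derive_continuous dF.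
have F0 : F 0 = 0 by rewrite /F integral_from0_0.
have f0 t : 0 < f t by exact: lt_le_trans (fm t).
have Fmono x y : x < y -> F x < F y.
  by move=> xy; apply: (@der_pos_lt _ F f x y xy (continuous_subspaceT cF)) => t _.
have Finj : injective F.
  by move=> x y xy; have [/Fmono|/Fmono|//] := ltgtP x y; rewrite xy ltxx.
have growth x y : x <= y -> m * (y - x) <= F y - F x.
  move=> xy; have cG : continuous (fun t => F t - m * t) by cont.
  have dG t : is_derive t (1 : R) (fun t => F t - m * t) (f t - m).
    by apply: (is_derive_eq (derD (dF t) (derN (derM (derC m t) (derI t))))); ring.
  have := @der_nonneg_le _ (fun t => F t - m * t) (fun t => f t - m) x y xy (continuous_subspaceT cG).
  move=> h; have : F x - m * x <= F y - m * y by apply: h => t _; rewrite ?subr_ge0.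
  lra.
have surj s : exists t, F t = s.
  have [s0|s0] := leP 0 s.
    have sm : 0 <= s / m by rewrite divr_ge0// ltW.
    have := growth 0 (s / m) sm; rewrite F0 !subr0 mulrCA mulfV ?gt_eqF// mulr1 => h.
    have [|t _ ht] := @IVT _ F 0 (s / m) s sm (continuous_subspaceT cF); last by exists t.
    by rewrite F0 ge_min le_max s0 h orbT.
  have sm : s / m <= 0 by rewrite pmulr_lle0 ?invr_gt0// ltW.
  have := growth (s / m) 0 sm; rewrite F0 !sub0r mulrN mulrCA mulfV ?gt_eqF// mulr1 lerN2 => h.
  have [|t _ ht] := @IVT _ F (s / m) 0 s sm (continuous_subspaceT cF); last by exists t.
  by rewrite F0 ge_min le_max h (ltW s0) orbT.
have [g hg] := choice surj.
have gK t : g (F t) = t by apply: Finj; rewrite hg.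
exists g; split => // s.
have h : is_derive (F (g s)) (1 : R) g (f (g s))^-1.
  apply: (@is_derive_inverse _ F g (f (g s)) (g s)).
  - exact: (@filterE _ (nbhs (g s)) (nbhs_filter (g s)) _ gK).
  - exact: (@filterE _ (nbhs (g s)) (nbhs_filter (g s)) _ cF).
  - by rewrite gt_eqF.
by rewrite hg in h.
Qed.

Variables (P0 P1 : R * R) (L : R) (gamma : curve p).
Hypothesis adm : admissible P0 P1 L gamma.
Hypothesis crit : critical_point P0 P1 L gamma.
Hypothesis short : enorm (P0 - P1) < L.

Lemma critical_elastica : exists (q La b : R) (S th x y : R -> R),
  [/\ 0 < q <= 1, 0 < La, change_of_parameter 0 (La * L) S, elastica p q (La * L) th x y &
   (forall t, 0 <= t <= 1 ->
     wfun gamma.1 t = P0.1 + La^-1 * (cos b * x (S t) - sin b * y (S t)) /\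
     wfun gamma.2 t = P0.2 + La^-1 * (sin b * x (S t) + cos b * y (S t))) /\
   x (La * L) ^+ 2 = La ^+ 2 * enorm (P0 - P1) ^+ 2].
Proof.
have [im g0 g1 gL] := adm.
have [al [be [ae end0]]] := euler_lagrange hp adm crit short.
set u := D1 gamma.1; set v := D1 gamma.2; set sp := speed gamma.
have cu : continuous u := @D1_continuous _ _ gamma.1.
have cv : continuous v := @D1_continuous _ _ gamma.2.
have csp : continuous sp := @continuous_speed _ _ gamma.
have sp0 t : 0 < sp t := speed_gt0 t im.
have p1 : 0 < p - 1 by have := hp; lra.
pose m := (p - 1)^-1; have m0 : 0 < m by rewrite invr_gt0.
pose P := p / (p - 1).
have P_gt0 : 0 < P by rewrite divr_gt0//; have := hp; lra.
have mP : m + 1 = P by rewrite /m /P; field; rewrite gt_eqF.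
have [x0 y0] : wfun gamma.1 0 = P0.1 /\ wfun gamma.2 0 = P0.2 by rewrite -g0.
have not_straight n1 n2 : (n1 != 0) || (n2 != 0) ->
    ~ (forall t, 0 <= t <= 1 -> n1 * u t + n2 * v t = 0).
  by move=> n0 /(straight_chord adm n0) h; move: short; rewrite h ltxx.
have kE c t : spow (p - 1) (curvature gamma t) = c -> curvature gamma t = spow m c.
  by move=> <-; rewrite spowK// gt_eqF.
pose N := al ^+ 2 + be ^+ 2.
(* If both multipliers vanished the curvature would be zero almost everywhere and the curve
   straight. *)
have N0 : 0 < N.
  rewrite lt_def addr_ge0 ?sqr_ge0// andbT; apply/negP => /eqP N0.
  have a0 : al = 0 by apply/eqP; rewrite -sqrf_eq0; move/eqP: N0; rewrite paddr_eq0 ?sqr_ge0// => /andP[].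
  have b0 : be = 0 by apply/eqP; rewrite -sqrf_eq0; move/eqP: N0; rewrite paddr_eq0 ?sqr_ge0// => /andP[].
  have ae0 : {ae mu, forall t, 0 < t < 1 -> curvature gamma t = (fun=> 0) t}.
    by apply: ae_sub ae => t h /h/kE; rewrite a0 b0 !mul0r addr0 spow0.
  have [th0 hth] := tangent_angle hp im (@contC R 0) ae0.
  apply: (not_straight (- sin th0) (cos th0)).
    rewrite oppr_eq0 -negb_and; apply/negP => /andP[/eqP s0 /eqP c0].
    by have := cos2Dsin2 th0; rewrite s0 c0 expr0n addr0 => /eqP; rewrite eq_sym oner_eq0.
  move=> t ht; have [ut vt] := hth t ht; rewrite /u /v ut vt.
  have -> : integral_from0 (fun t => speed gamma t * 0) t = 0.
    rewrite (@eq_integral_from0 _ _ (fun t => 0 * sp t + 0 * sp t)); last by move=> z _; ring.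
    by rewrite integral_from0_lin// !mul0r addr0.
  by rewrite addr0; ring.
pose c := Num.sqrt N; have c0 : 0 < c by rewrite sqrtr_gt0.
have cN : c ^+ 2 = N by rewrite sqr_sqrtr// ltW.
have cn : c != 0 by rewrite gt_eqF.
(* The rotation that turns the affine function into - c times the ordinate Y. *)
have [b [cb sb]] : exists b, cos b = - be / c /\ sin b = al / c.
  by apply: polar_angle; rewrite !expr_div_n sqrrN -mulrDl cN addrC mulfV// gt_eqF.
have csb := cos2Dsin2 b.
pose X t := cos b * integral_from0 u t + sin b * integral_from0 v t.
pose Y t := (- sin b) * integral_from0 u t + cos b * integral_from0 v t.
have dI f : continuous f -> forall t, is_derive t (1 : R) (integral_from0 f) (f t).
  by move=> cf t; apply: is_derive_integral_from0; [exact: continuous_loc_integrable|exact: cf].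
have dX t : is_derive t (1 : R) X (cos b * u t + sin b * v t).
  by apply: (is_derive_eq (derD (derM (derC (cos b) t) (dI u cu t)) (derM (derC (sin b) t) (dI v cv t)))); ring.
have dY t : is_derive t (1 : R) Y (- sin b * u t + cos b * v t).
  by apply: (is_derive_eq (derD (derM (derC (- sin b) t) (dI u cu t)) (derM (derC (cos b) t) (dI v cv t)))); ring.
have cX : continuous X := is_derive_continuous dX.
have cY : continuous Y := is_derive_continuous dY.
have wE t : 0 <= t <= 1 -> wfun gamma.1 t - P0.1 = integral_from0 u t /\ wfun gamma.2 t - P0.2 = integral_from0 v t.
  by move=> ht; rewrite (wfun_FTC gamma.1 ht) (wfun_FTC gamma.2 ht) x0 y0 !(addrC P0.1, addrC P0.2) !addrK.
have mult (A B : R) : al * A + be * B = - c * (- sin b * A + cos b * B).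
  by rewrite cb sb; field.
pose k t := spow m (- c * Y t).
have ck : continuous k by apply: (@cont_comp _ (spow m)); [exact: continuous_spow|cont].
have aek : {ae mu, forall t, 0 < t < 1 -> curvature gamma t = k t}.
  apply: ae_sub ae => t h ht; have ht' := oo01W ht.
  have [w1 w2] := wE t ht'.
  by rewrite (kE _ _ (h ht)) w1 w2 mult.
have [th0 hth] := tangent_angle hp im ck aek.
pose A := integral_from0 (fun t => sp t * k t).
have csk : continuous (fun t => sp t * k t) by cont.
have dA := dI _ csk; rewrite -/A in dA.
pose th t := th0 - b + A t.
have dth t : is_derive t (1 : R) th (sp t * k t).
  by apply: (is_derive_eq (derD (derC (th0 - b) t) (dA t))); ring.
have cth : continuous th := is_derive_continuous dth.
have thE t : th t = (th0 + A t) - b by rewrite /th; ring.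
have XE t : 0 <= t <= 1 -> cos b * u t + sin b * v t = sp t * cos (th t).
  by move=> ht; have [ut vt] := hth t ht; rewrite /u /v ut vt thE cosB -/A -/sp; ring.
have YE t : 0 <= t <= 1 -> - sin b * u t + cos b * v t = sp t * sin (th t).
  by move=> ht; have [ut vt] := hth t ht; rewrite /u /v ut vt thE sinB -/A -/sp; ring.
have Y0 : Y 0 = 0 by rewrite /Y !integral_from0_0; ring.
have X0 : X 0 = 0 by rewrite /X !integral_from0_0; ring.
have i1 : 0 <= (1 : R) <= 1 by rewrite ler01 lexx.
have [e1 e2] : P1.1 - P0.1 = integral_from0 u 1 /\ P1.2 - P0.2 = integral_from0 v 1.
  by have [<- <-] := wE 1 i1; rewrite -g1.
have Y1 : Y 1 = 0.
  move: end0; rewrite e1 e2 mult => /eqP; rewrite mulf_eq0 oppr_eq0 (negbTE cn) => /eqP; exact.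
have km t : k t = - (c `^ m * spow m (Y t)).
  by rewrite /k mulNr spowN spowM spow_pos.
pose q := `|sin (th 0 / 2)|.
have q1 : q <= 1 by rewrite /q ler_norml sin_geN1 sin_le1.
(* For q = 0 the conserved quantity E equals 1, the largest value of the cosine, which forces Y = 0
   and a straight curve. *)
have q0 : 0 < q.
  rewrite lt_def normr_ge0 andbT; apply/negP => /eqP/normr0_eq0 s0.
  have P1' : 1 < P by rewrite -mP; lra.
  pose E t := cos (th t) - c `^ m / P * `|Y t| `^ P.
  have dE t : 0 <= t <= 1 -> is_derive t (1 : R) E 0.
    move=> ht; have d1 : is_derive t (1 : R) (fun t => `|Y t| `^ P) (P * spow (P - 1) (Y t) * (- sin b * u t + cos b * v t)).
      exact: (@der_comp _ (fun z => `|z| `^ P) Y t _ _ (is_derive_powR_norm (Y t) P1') (dY t)).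
    apply: (is_derive_eq (derD (der_cos (dth t)) (derN (derM (derC (c `^ m / P) t) d1)))).
    rewrite YE// km -mP addrK mP; field; rewrite gt_eqF//.
  have cE : {within `[0, 1], continuous E}.
    apply: continuous_subspaceT; rewrite /E.
    have c1 : continuous (fun t => `|Y t| `^ P).
      by apply: (@cont_comp _ (fun z => `|z| `^ P)) => //; exact: continuous_powR_nonneg.
    by cont.
  have Ec : forall t, 0 <= t <= 1 -> E t = E 0.
    by apply: (der0_constant ler01 cE) => t /oo01W; exact: dE.
  have E0 : E 0 = 1.
    rewrite /E Y0 normr0 powR0 ?gt_eqF// mulr0 subr0.
    by rewrite cos_double s0 expr0n mulr0 subr0.
  have Yz t : 0 <= t <= 1 -> Y t = 0.
    move=> ht; have := Ec t ht; rewrite E0 /E => h.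
    have : c `^ m / P * `|Y t| `^ P <= 0 by have := cos_le1 (th t); lra.
    rewrite pmulr_rle0; last by rewrite divr_gt0// powR_gt0.
    move=> h2; apply/eqP; rewrite -normr_le0 leNgt; apply/negP => /(powR_gt0 P).
    by rewrite ltNge h2.
  apply: (not_straight (- sin b) (cos b)).
    rewrite oppr_eq0 -negb_and; apply/negP => /andP[/eqP s0' /eqP c0'].
    by have := csb; rewrite s0' c0' expr0n addr0 => /eqP; rewrite eq_sym oner_eq0.
  have cz : continuous (fun t => - sin b * u t + cos b * v t) by cont.
  apply: (continuous_eq01 cz (@contC R 0)) => t ht.
  have d0 : is_derive t (1 : R) Y 0 by apply: (der_eq_oo ht _ (derC 0 t)) => z /oo01W hz; rewrite Yz.
  rewrite -(@derive_val _ _ _ _ _ _ _ (dY t)); exact: (@derive_val _ _ _ _ _ _ _ d0).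
(* Scaling by La changes the coefficient in the angle equation by La^(m+1) = La^P; it becomes 2 q
   exactly when La^P = B. *)
pose B := c `^ m * (P * q) `^ m / (2 * q).
have Pq0 : 0 < P * q by rewrite mulr_gt0.
have B0 : 0 < B by rewrite divr_gt0 ?mulr_gt0 ?powR_gt0.
pose La := B `^ P^-1.
have La0 : 0 < La by rewrite powR_gt0.
have Lan : La != 0 by rewrite gt_eqF.
have LaP : La `^ m * La = B.
  have -> : La `^ m * La = La `^ P by rewrite -mP powRD ?powRr1 ?(ltW La0)// (gt_eqF La0) implybT.
  by rewrite /La -powRrM mulVf ?gt_eqF// powRr1// ltW.
(* The speed is constant beyond [0, 1], so its minimum there is a bound on the whole line. *)
have [mn mn0 hmn] : exists2 mn, 0 < mn & forall t, mn <= La * sp t.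
  have [z _ hz] := EVT_min (@ler01 R) (continuous_subspaceT csp).
  exists (La * sp z); first by rewrite mulr_gt0.
  move=> t; rewrite ler_pM2l//.
  have -> : sp t = sp (clamp t) by rewrite /sp /speed /D1 !(clamp_in (clamp01 t)).
  by apply: hz; rewrite in_itv; exact: clamp01.
have cLs : continuous (fun t => La * sp t) by cont.
have [g [gK Kg dg]] := primitive_inverse cLs mn0 hmn.
pose S := integral_from0 (fun t => La * sp t); rewrite -/S in gK Kg.
have dS := dI _ cLs; rewrite -/S in dS.
have cS : continuous S := is_derive_continuous dS.
have cg : continuous g := is_derive_continuous dg.
have S0 : S 0 = 0 by rewrite /S integral_from0_0.
have S1 : S 1 = La * L.
  rewrite /S -int01_from0; last exact: continuous_loc_integrable.
  rewrite int01Z; last exact: L01_continuous.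
  by congr (_ * _); rewrite -gL; apply: eq_int01 => t /oo01W ht; rewrite -speed_vel.
have Smono x y : x < y -> S x < S y.
  move=> xy; apply: (@der_pos_lt _ S (fun t => La * sp t) x y xy (continuous_subspaceT cS)) => t _.
  by rewrite mulr_gt0.
have Sle x y : x <= y -> S x <= S y by rewrite le_eqVlt => /predU1P[->|/Smono/ltW].
have gin s : 0 < s < La * L -> 0 < g s < 1.
  move=> /andP[h1 h2]; apply/andP; split; rewrite ltNge; apply/negP => /Sle.
    by rewrite Kg S0 leNgt h1.
  by rewrite Kg S1 leNgt h2.
exists q, La, b, S, (fun s => th (g s)), (fun s => La * X (g s)), (fun s => La * Y (g s)).
split; [by rewrite q0|by []| | |].
- exists (fun t => La * sp t); split => //.
  + exact: continuous_subspaceT.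
  + exact: continuous_subspaceT.
  + by move=> t _; rewrite mulr_gt0.
- split.
  + exact: (@cont_comp _ th g).
  + by have c1 := @cont_comp _ X g cX cg; cont.
  + by have c1 := @cont_comp _ Y g cY cg; cont.
  + move=> s /gin hs; have spn : sp (g s) != 0 by rewrite gt_eqF.
    apply: (is_derive_eq (@der_comp _ th g s _ _ (dth (g s)) (dg s))).
    have -> : La * Y (g s) / (P * q) = La / (P * q) * Y (g s) by ring.
    rewrite -/m spowM (spow_pos _ (divr_gt0 La0 Pq0)) km.
    have Pqm : (P * q) `^ m != 0 by rewrite gt_eqF// powR_gt0.
    have E2 : (La / (P * q)) `^ m = La `^ m / (P * q) `^ m.
      apply: (mulIf Pqm); rewrite -powRM ?(ltW Pq0) ?(ltW (divr_gt0 La0 Pq0))//.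
      by rewrite !divfK// gt_eqF.
    rewrite E2.
    have E1 : La `^ m = B / La by rewrite -LaP mulfK.
    rewrite E1 /B; field.
    by rewrite spn Lan Pqm gt_eqF.
  + move=> s /gin hs; have spn : sp (g s) != 0 by rewrite gt_eqF.
    apply: (is_derive_eq (derM (derC La s) (@der_comp _ X g s _ _ (dX (g s)) (dg s)))).
    by rewrite (XE _ (oo01W hs)); field; rewrite spn.
  + move=> s /gin hs; have spn : sp (g s) != 0 by rewrite gt_eqF.
    apply: (is_derive_eq (derM (derC La s) (@der_comp _ Y g s _ _ (dY (g s)) (dg s)))).
    by rewrite (YE _ (oo01W hs)); field; rewrite spn.
  + by rewrite -S0 gK X0 mulr0 .
  + by rewrite -S0 gK Y0 mulr0.
  + by rewrite -S1 gK Y1 mulr0.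
  + by rewrite -{1}S0 gK /q -normrX ger0_norm// sqr_ge0.
split.
  move=> t ht; rewrite gK; have [w1 w2] := wE t ht; split.
    rewrite -[LHS](subrK P0.1) w1 addrC; congr (_ + _).
    rewrite -[LHS]mul1r -csb /X /Y; field => //.
  rewrite -[LHS](subrK P0.2) w2 addrC; congr (_ + _).
  rewrite -[LHS]mul1r -csb /X /Y; field => //.
(* As Y vanishes at both ends, the whole chord lies along the rotated first axis. *)
rewrite -S1 gK exprMn; congr (_ * _).
have -> : enorm (P0 - P1) ^+ 2 = integral_from0 u 1 ^+ 2 + integral_from0 v 1 ^+ 2.
  rewrite -e1 -e2; transitivity ((P0.1 - P1.1) ^+ 2 + (P0.2 - P1.2) ^+ 2); last by ring.
  exact: enorm_sqr.
have := Y1; rewrite /Y => Y1'.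
have -> : integral_from0 u 1 ^+ 2 + integral_from0 v 1 ^+ 2 =
   (cos b ^+ 2 + sin b ^+ 2) * (integral_from0 u 1 ^+ 2 + integral_from0 v 1 ^+ 2) by rewrite csb mul1r.
have -> : (cos b ^+ 2 + sin b ^+ 2) * (integral_from0 u 1 ^+ 2 + integral_from0 v 1 ^+ 2) =
  X 1 ^+ 2 + (- sin b * integral_from0 u 1 + cos b * integral_from0 v 1) ^+ 2 by rewrite /X; ring.
by rewrite Y1' expr0n addr0.
Qed.

End Reduction.

(** * From solutions to arcs, loops and flat-cores *)

Section Assembly.
Context {R : realType}.
Variable p : R.
Hypothesis hp : 1 < p.
Implicit Types (q r L La b d : R) (S th x y : R -> R) (P : R * R).

(** The last parameter is F at amplitude pi/2 + (n - 1) pi, where the shift formulas evaluate both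
    integrals. *)
Lemma gamma_w_end q (n : nat) : 0 < q < 1 -> (0 < n)%N ->
  (gamma_w p q (2 * n%:R * ellK p q - ellK p q)).1 =
  (2 * n%:R - 1) * (2 * ellEc p q - ellK p q).
Proof.
move=> /andP[q0 q1]; case: n => // n _.
have hq : 0 <= q < 1 by rewrite ltW.
have hpi : - (pi / 2) <= (pi : R) / 2 <= pi / 2 by have := pi_gt0 R; lra.
have -> : 2 * n.+1%:R * ellK p q - ellK p q = ellF p q (pi / 2 + n%:R * pi).
  by rewrite (ellF_shift hp)// -/(ellK p q) -[n.+1%:R]natr1; ring.
rewrite /gamma_w /= am_ellF// (ellE_shift hp)// (ellF_shift hp)//.
by rewrite -/(ellK p q) -/(ellEc p q) -[n.+1%:R]natr1; ring.
Qed.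

(** The offset d of the model curve is absorbed into the translation, and [rf] becomes the
    reflection of the similarity. *)
Lemma similarity_of_trace (gamma : curve p) P La b L S x y d (rf : bool) c : 0 < La ->
  change_of_parameter 0 (La * L) S ->
  (forall t, 0 <= t <= 1 ->
     wfun gamma.1 t = P.1 + La^-1 * (cos b * x (S t) - sin b * y (S t)) /\
     wfun gamma.2 t = P.2 + La^-1 * (sin b * x (S t) + cos b * y (S t))) ->
  pstart c = 0 -> pstop c = La * L ->
  (forall s, 0 <= s <= La * L -> x s = (ptrace c s).1 - d /\
     y s = if rf then - (ptrace c s).2 else (ptrace c s).2) ->
  same_up_to_similarity gamma c.
Proof.
move=> La0 cp gE c0 c1 tr.
exists La^-1, b, rf, (P.1 - La^-1 * (cos b * d), P.2 - La^-1 * (sin b * d)), S.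
split; [by rewrite invr_gt0|by rewrite c0 c1|].
have [dS [[S0 S1] cS _ hdS dS0]] := cp.
move=> t ht.
(* S is nondecreasing, so the trace identity may be used at S t. *)
have hS : 0 <= S t <= La * L.
  have mono u v : 0 <= u -> u <= v -> v <= 1 -> S u <= S v.
    move=> u0 uv v1; apply: (@der_nonneg_le _ S dS u v uv).
    - apply: continuous_subspaceW cS => z /=; rewrite !in_itv /=; lra.
    - by move=> z hz; apply: hdS; lra.
    - by move=> z hz; apply: ltW; apply: dS0; lra.
  by rewrite -S1 -S0 !mono//; lra.
have [gx gy] := gE t ht; have [xE yE] := tr _ hS.
by rewrite /cpos gx gy /similarity /= xE yE; case: rf {yE tr}; congr pair; ring.
Qed.

(** Passes from the list of pairs to functions on ordinals. Appending [lm] makes one list of n + 1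
    lengths whose last entry is the final segment; the defaults of [nth] are never reached. *)
Lemma flat_core_pieces (cs : seq (R * bool)) (lm : R) :
  flat_core p (fun j : 'I_(size cs) => (nth (0, true) cs j).2)
    (fun j : 'I_(size cs).+1 => nth lm (rcons (map fst cs) lm) j) =
  concat (flat_pieces p cs) (line_curve lm).
Proof.
have E : [seq nth (0, true) cs (val j) | j <- enum 'I_(size cs)] = cs.
  by rewrite (map_comp (nth (0, true) cs) val) val_enum_ord -/(mkseq _ _) mkseq_nth.
have -> : flat_pieces p cs = concats [seq flat_piece p (nth (0, true) cs (val j)) | j <- enum 'I_(size cs)].
  by rewrite /flat_pieces -[in LHS]E -map_comp.
have e1 : [seq concat (line_curve (nth lm (rcons (map fst cs) lm) (widen_ord (leqnSn (size cs)) j)))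
      (border_curve p (nth (0, true) cs j).2) | j <- enum 'I_(size cs)] =
   [seq flat_piece p (nth (0, true) cs (val j)) | j <- enum 'I_(size cs)].
  apply: eq_map => j; rewrite /flat_piece; congr (concat (line_curve _) _) => /=.
  by rewrite nth_rcons size_map ltn_ord (nth_map (0, true)).
have e2 : nth lm (rcons (map fst cs) lm) (@ord_max (size cs)) = lm.
  by rewrite nth_rcons size_map ltnn eqxx.
exact: (f_equal2 (fun a b => concat (concats a) (line_curve b)) e1 e2).
Qed.

Lemma flat_core_length (cs : seq (R * bool)) (lm : R) :
  \sum_(j < (size cs).+1) nth lm (rcons (map fst cs) lm) j = \sum_(d <- cs) d.1 + lm.
Proof.
rewrite big_ord_recr /= nth_rcons size_map ltnn eqxx; congr (_ + _).
rewrite (big_nth (0, true)) big_mkord; apply: eq_bigr => j _ /=.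
by rewrite nth_rcons size_map ltn_ord (nth_map (0, true)).
Qed.

End Assembly.

(** The real case distinction is on q: waves for q < 1, flat-cores for q = 1. The ranges of r then
    only decide which of these are possible. *)
Theorem theorem1p1 (R : realType) (p : R) (hp : 1 < p) (P0 P1 : R * R)
    (L : R) (hL : 0 < L) (r : R) (hr : r = enorm (P0 - P1) / L)
    (hr01 : 0 <= r < 1) (gamma : curve p)
    (hgamma : admissible P0 P1 L gamma)
    (hcrit : critical_point P0 P1 L gamma) :
  [/\ r = 0 ->
        exists n : nat, (0 < n)%N /\ is_figure_eight n gamma,
      0 < r < 1 / (p - 1) ->
        (exists n : nat, (0 < n)%N /\ is_arc r n gamma) \/
        (exists n : nat, (0 < n)%N /\ is_loop r n gamma)
    & 1 / (p - 1) <= r < 1 ->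
        (exists n : nat, (0 < n)%N /\ is_arc r n gamma) \/
        (exists (n : nat) (sigma : 'I_n -> bool) (l : 'I_n.+1 -> R),
           (0 < n)%N /\ is_flat_core r sigma l gamma)].
Proof.
have [r0 r1] := andP hr01.
have p1 : 0 < p - 1 by lra.
have rL : enorm (P0 - P1) = r * L by rewrite hr divfK// gt_eqF.
have short : enorm (P0 - P1) < L by rewrite rL gtr_pMl.
have [q [La [b [S [th [x [y [/andP[q0 q1] La0 cp el [gE xL]]]]]]]]] := critical_elastica hp hgamma hcrit short.
have LaL : 0 < La * L by rewrite mulr_gt0.
have xL' : x (La * L) ^+ 2 = (r * (La * L)) ^+ 2 by rewrite xL rL; ring.
have [qlt|] := ltP q 1.
  have hq : 0 < q < 1 by rewrite q0.
  have K0 : 0 < ellK p q by rewrite ellK_gt0// ltW.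
  have [n [rf [n0 Ln tr]]] := elastica_wave hp hq LaL el.
  have sim : same_up_to_similarity gamma (wave p q n).
    exact: (@similarity_of_trace _ _ gamma P0 La b L S x y _ rf (wave p q n) La0 cp gE erefl (esym Ln) tr).
  have QK : Qfun p q * ellK p q = 2 * ellEc p q - ellK p q by rewrite /Qfun; field; rewrite gt_eqF.
  (* Chord over length: over its length 2 n K a wave advances by 2 n (2 E - K) = 2 n K Q_p(q) in x,
     while the reduction gives |x| = r times the length. *)
  have Q2 : Qfun p q ^+ 2 = r ^+ 2.
    have [xe _] : x (La * L) = (gamma_w p q (La * L - ellK p q)).1 - (ellK p q - 2 * ellEc p q) /\
       y (La * L) = if rf then - (gamma_w p q (La * L - ellK p q)).2 else (gamma_w p q (La * L - ellK p q)).2.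
      by apply: tr; rewrite ltW//= lexx.
    have nn : (n%:R : R) != 0 by rewrite pnatr_eq0 -lt0n.
    have k : (2 * n%:R * ellK p q) ^+ 2 != 0 by rewrite expf_neq0// !mulf_neq0// gt_eqF.
    apply: (mulIf k); rewrite -exprMn -[RHS]exprMn -{2}Ln -xL' xe {1}Ln gamma_w_end// -QK.
    have -> : ellK p q - 2 * ellEc p q = - (Qfun p q * ellK p q) by rewrite QK opprB.
    by congr (_ ^+ 2); ring.
  have uniq s : Qfun p q = s -> unique (fun q => 0 < q < 1 /\ Qfun p q = s) q.
    move=> Qs; split => // q' [hq' Q']; apply: (Qfun_inj hp hq hq'); by rewrite Qs Q'.
  have [Qr|Qr] : Qfun p q = r \/ Qfun p q = - r.
    by move/eqP: Q2; rewrite eqf_sqr => /orP[] /eqP; [left|right].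
  - have arc : is_arc r n gamma by exists q; split => //; exact: uniq.
    by split=> [rz|_|_]; [exists n; rewrite /is_figure_eight -rz|left; exists n|left; exists n].
  - have rp : r < 1 / (p - 1).
      (* For p > 2 the lower bound on Q_p applies; for p <= 2 simply 1/(p-1) >= 1 > r. *)
      have [p2|p2] := ltP 2 p; first by have := Qfun_gt hp p2 hq; rewrite Qr ltrN2.
      apply: (lt_le_trans r1); rewrite ler_pdivlMr; lra.
    split=> [rz|_|/andP[h _]].
    + by exists n; split => //; exists q; split => //; apply: uniq; rewrite Qr rz oppr0.
    + by right; exists n; split => //; split => //; exists q; split => //; exact: uniq.
    + by have := lt_le_trans rp h; rewrite ltxx.
move=> q1'; have qE : q = 1 by apply/eqP; rewrite eq_le q1.
rewrite qE in el.
(* Since r < 1 the solution is not straight, which for q = 1 leaves only p > 2. *)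
have xlt : x (La * L) ^+ 2 < (La * L) ^+ 2.
  have h0 : 0 <= r * (La * L) by rewrite mulr_ge0// ltW.
  have h1 : r * (La * L) < La * L by rewrite gtr_pMl.
  by rewrite xL' ltr_sqr ?nnegrE// ltW.
have [p2|p2] := leP p 2.
  by have := elastica_straight_le2 hp p2 LaL el => e; move: xlt; rewrite e ltxx.
have K10 := ellK1_gt0 hp p2.
have [cs [lm [n0 hd lm0 [st sp] [LE xE tr]]]] := elastica_flat hp p2 LaL el xlt.
set T := \sum_(d <- cs) d.1 + lm in LE xE.
have T0 : 0 <= T by rewrite addr_ge0// big_seq sumr_ge0.
set N := (size cs)%:R in LE xE.
have N0 : 0 < N by rewrite ltr0n.
have m0 : 0 < (p - 1)^-1 by rewrite invr_gt0.
(* The total length is eliminated between the length and displacement formulas. All pieces of a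
   flat-core advance to the left, which fixes the sign of x at the end. *)
have mass : T * (1 - r) = 2 * N * (r - 1 / (p - 1)) * ellK1 p.
  have neg : x (La * L) = - (r * (La * L)).
    move/eqP: xL'; rewrite eqf_sqr => /orP[/eqP e|/eqP//].
    have : x (La * L) <= 0.
      rewrite xE -opprD oppr_le0 addr_ge0// !mulr_ge0// ltW//.
    have : 0 <= r * (La * L) by rewrite mulr_ge0// ltW.
    by rewrite e; lra.
  rewrite mul1r; move: neg; rewrite xE LE; lra.
(* The segments have nonnegative total length T, so the length identity itself forces the range of
   r. *)
have rp : 1 / (p - 1) <= r.
  have h : 0 <= T * (1 - r) by rewrite mulr_ge0// subr_ge0 ltW.
  rewrite -subr_ge0 -(pmulr_rge0 _ (mulr_gt0 (mulr_gt0 (ltr0n _ 2) N0) K10)).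
  by move: h; rewrite mass; congr (_ <= _); ring.
have rp0 : 0 < r by apply: lt_le_trans rp; rewrite mul1r.
split=> [rz|/andP[_ h]|_]; first by move: rp0; rewrite rz ltxx.
  by have := le_lt_trans rp h; rewrite ltxx.
right; exists (size cs), (fun j => (nth (0, true) cs j).2), (fun j => nth lm (rcons (map fst cs) lm) j).
split => //; split => //.
- move=> j; have : nth lm (rcons (map fst cs) lm) j \in rcons (map fst cs) lm.
    by apply: mem_nth; rewrite size_rcons size_map.
  by rewrite mem_rcons inE => /predU1P[->//|/mapP[d hdc ->]]; exact: hd.
- rewrite flat_core_length -/T; have r1n : 1 - r != 0 by rewrite subr_eq0 gt_eqF.
  by apply: (mulIf r1n); rewrite mass -/N; field; rewrite r1n gt_eqF.
rewrite flat_core_pieces; apply: (@similarity_of_trace _ _ _ _ _ _ _ _ _ _ 0 false _ La0 cp gE) => //.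
by move=> s hs; rewrite tr// subr0.
Qed.
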